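(* For every integer $d\ge 2$ there exists a constant $c_d$ (depending only on $d$) such that for all $R>0$ and all Borel probability measures $\mu,\nu$ on $\mathbb{R}^d$ supported on $B_R$, one has $$ W_1(\mu,\nu)\;\le\; c_d\, R^{\frac{d-1}{d}}\; SW_1(\mu,\nu)^{\frac1d}.$$
   Context: $B_R$ denotes the closed Euclidean ball of radius $R$ centered at $0$ in $\mathbb{R}^d$. For probability measures $\mu,\nu$ with finite first moment on a Euclidean space, $W_1(\mu,\nu)=\inf_{\gamma}\int |x-y|\,d\gamma(x,y)$ is the 1-Wasserstein distance, where the infimum runs over all probability measures $\gamma$ on the product space with marginals $\mu$ and $\nu$. For $\theta\in S^{d-1}$ (unit sphere of $\mathbb{R}^d$), let $P_\theta:\mathbb{R}^d\to\mathbb{R}$, $P_\theta(x)=\langle \theta,x\rangle$, and let $P_{\theta\#}\mu$ be the pushforward of $\mu$ by $P_\theta$. The sliced 1-Wasserstein distance is $$SW_1(\mu,\nu)=\int_{S^{d-1}} W_1(P_{\theta\#}\mu,P_{\theta\#}\nu)\,d\sigma_{d-1}(\theta),$$ where $\sigma_{d-1}$ is the uniform probability measure on $S^{d-1}$. *)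

(* Defs.v *)
From HB Require Import structures.
From mathcomp Require Import all_boot all_order all_algebra.
From mathcomp Require Import all_classical all_reals all_analysis.
From mathcomp Require Import measurable_realfun.

Set Implicit Arguments.
Unset Strict Implicit.
Unset Printing Implicit Defensive.

Import Order.TTheory GRing.Theory Num.Theory.
Import numFieldNormedType.Exports.

Local Open Scope classical_set_scope.
Local Open Scope ring_scope.

(* R^d is the type of d-tuples with the library's product sigma-algebra, which
   is the Borel sigma-algebra of R^d. *)
Notation "''E[' R ]_ d" := (d.-tuple (measurableTypeR R))
  (at level 8, R at level 2, d at level 2, format "''E[' R ]_ d") : type_scope.

Section euclidean.
Context {R : realType} {d : nat}.
Implicit Types x y : 'E[R]_d.

Definition edot x y : R := \sum_(i < d) tnth x i * tnth y i.

Definition enorm x : R := Num.sqrt (edot x x).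

Definition edist x y : R :=
  Num.sqrt (\sum_(i < d) (tnth x i - tnth y i) ^+ 2).

Definition eball (r : R) : set 'E[R]_d := [set x | enorm x <= r].

Definition esphere : set 'E[R]_d := [set x | enorm x = 1].

(* x / |x|; maps 0 to 0 *)
Definition enormalize x : 'E[R]_d := [tuple tnth x i / enorm x | i < d].

Lemma measurable_enorm : measurable_fun setT enorm.
Proof.
apply: (measurableT_comp (f := (Num.sqrt : R -> R))).
  by apply: continuous_measurable_fun; exact: sqrt_continuous.
by apply: measurable_sum => i; apply: measurable_funM; exact: measurable_tnth.
Qed.

Lemma measurable_eball (r : R) : measurable (eball r).
Proof.
rewrite -[eball r]setTI.
rewrite (_ : eball r = enorm @^-1` `]-oo, r]); last first.
  by apply/seteqP; split=> x; rewrite /eball /= in_itv.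
exact: measurable_enorm.
Qed.

Lemma measurable_enormalize : measurable_fun setT enormalize.
Proof.
apply/measurable_fun_tnthP => i.
apply: (eq_measurable_fun (fun x => tnth x i * (enorm x) `^ (-1))) => [x _|].
  by rewrite /= tnth_mktuple powR_inv1 ?sqrtr_ge0.
apply: measurable_funM; first exact: measurable_tnth.
exact: (measurableT_comp (measurable_powR _) measurable_enorm).
Qed.

End euclidean.

Arguments eball {R} d r.
Arguments esphere R d : clear implicits.
Arguments measurable_eball {R} d r.

(* The library's [pushforward] is a measure only in the presence of a proof of
   measurability; here the proof is an argument. *)
Section image_measure.
Context d1 d2 (T1 : measurableType d1) (T2 : measurableType d2) (R : realType).
Variables (m : {measure set T1 -> \bar R}) (f : T1 -> T2).
Hypothesis mf : measurable_fun [set: T1] f.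

Definition image_measure (_ : measurable_fun [set: T1] f) : set T2 -> \bar R :=
  pushforward m f.

Let image0 : image_measure mf set0 = 0%E.
Proof. exact: measure0. Qed.

Let image_ge0 A : (0 <= image_measure mf A)%E.
Proof. exact: measure_ge0. Qed.

Let image_sigma_additive : semi_sigma_additive (image_measure mf).
Proof. exact: measure_semi_sigma_additive. Qed.

HB.instance Definition _ := isMeasure.Build _ _ _ (image_measure mf)
  image0 image_ge0 image_sigma_additive.

End image_measure.

Section uniform_sphere.
Context {R : realType}.

Lemma measurable_econs n : measurable_fun [set: measurableTypeR R * 'E[R]_n]
  (fun p => [tuple of p.1 :: p.2] : 'E[R]_n.+1).
Proof. exact: measurable_cons. Qed.

(* Lebesgue measure on R^n, as an iterated product *)
Fixpoint elebesgue n : {measure set 'E[R]_n -> \bar R} :=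
  match n with
  | 0 => dirac [tuple]
  | n'.+1 => image_measure (lebesgue_measure \x^ elebesgue n')%E
                           (@measurable_econs n')
  end.

(* sigma_(d-1)(A) = |{x in B_1 : x / |x| in A}| / |B_1|, the normalized cone
   measure. [mnormalize] falls back on its second argument when the total mass
   is 0 or +oo, which does not happen as 0 < |B_1| < +oo. *)
Definition uniform_sphere (d : nat) : probability 'E[R]_d R :=
  mnormalize
    (image_measure (mrestr (elebesgue d) (measurable_eball d 1))
                   measurable_enormalize)
    (dirac point).

End uniform_sphere.

Section wasserstein.
Context {disp : measure_display} {T : measurableType disp} {R : realType}.
Local Open Scope ereal_scope.

Definition coupling (mu nu : set T -> \bar R) : set (probability (T * T)%type R) :=
  [set gamma | forall A, measurable A ->
     gamma (fst @^-1` A) = mu A /\ gamma (snd @^-1` A) = nu A].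

Definition wasserstein1 (dist : T -> T -> R) (mu nu : set T -> \bar R) : \bar R :=
  ereal_inf [set \int[gamma]_z (dist z.1 z.2)%:E | gamma in coupling mu nu].

End wasserstein.

Section sliced_wasserstein.
Context {R : realType} {d : nat}.
Local Open Scope ereal_scope.

Definition W1 (mu nu : set 'E[R]_d -> \bar R) : \bar R :=
  wasserstein1 edist mu nu.

Definition W1R (mu nu : set (measurableTypeR R) -> \bar R) : \bar R :=
  wasserstein1 (fun s t : R => `|s - t|%R) mu nu.

Definition proj (theta x : 'E[R]_d) : measurableTypeR R := edot theta x.

Definition SW1 (mu nu : set 'E[R]_d -> \bar R) : \bar R :=
  \int[uniform_sphere d]_(theta in esphere R d)
    W1R (pushforward mu (proj theta)) (pushforward nu (proj theta)).

End sliced_wasserstein.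

(* Main.v *)
Require Import Defs.
From HB Require Import structures.
From mathcomp Require Import all_boot all_order all_algebra.
From mathcomp Require Import all_classical all_reals all_analysis.
From mathcomp Require Import measurable_realfun gauss_integral ring lra.

Set Implicit Arguments.
Unset Strict Implicit.
Unset Printing Implicit Defensive.

Import Order.TTheory GRing.Theory Num.Theory.
Import numFieldNormedType.Exports.

Local Open Scope classical_set_scope.
Local Open Scope ring_scope.

(** A Lipschitz test function, smoothed at a small scale, is an average over
    directions of ridge functions, that is, of functions of one linear
    coordinate. Integrated against [mu] and [nu], such a function only sees the
    projections of the two measures, and the error is of the order of the
    smoothing scale.

    Duality. By [kantorovich_ball], up to an arbitrarily small error,
    W1(mu, nu) is at most the difference of the integrals of some 1-Lipschitz f against
    mu and nu, and f can be taken with support in the cube of side 4r, because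
    only its values on the ball of radius r matter. The proof discretizes: mu
    and nu are replaced by their masses on small cells of the ball, the duality
    theorem for finite sets ([finite_kantorovich]) follows from a
    finite-dimensional Hahn-Banach argument, and an almost optimal finite plan is
    turned back into a coupling that is a product measure on each pair of cells
    ([block_coupling]).

    Ridges. With k(s) the integral over t > 0 of t^(d-1) exp(-t^2) cos(t s),
    polar coordinates in the Fourier formula for the Gaussian give
      exp(-|z|^2/4) = const * (integral over th in S^(d-1) of k(<th, z>)),
    see [integral_ridge_kernel]. Hence the convolution of f with the Gaussian at
    x is, up to the constant, the average over th of g_th(<th, x>), where
    g_th(s) is the integral of f(y) k(s - <th, y>) dy ([ridge],
    [ridge_average]). After normalization the convolution is within a constant of f since
    f is 1-Lipschitz ([gauss_average]).

    The crucial estimate is that g_th is Lipschitz with constant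
    C r^(d-1), one power of r better than the volume of the support of f
    ([ridge_lipschitz]). Shifting s by h amounts to translating f by a vector
    of length O(|h|), which changes f by O(|h|) on a set of diameter O(r);
    k is integrable (two integrations by parts give decay like 1/s^2, see
    [gcos_decay]), and integrating |k(s - <th, y>)| over the cube costs the
    integral of |k| in the direction th and only r^(d-1) in the other
    directions ([slab_bound]).

    Conclusion. As the integral of g_th(<th, x>) against mu minus its integral
    against nu is at most C r^(d-1) times the W1 distance of the projections,
    averaging over th ([sliced_bound]) and rescaling by eps yield
      W1 <= C1 eps + C2 (r / eps)^(d-1) SW1     for every eps > 0
    ([W1_le_eps]), and eps^d = r^(d-1) SW1 balances the two terms. *)

(** * A finite-dimensional Hahn-Banach theorem *)

Section sublinear.
Context {R : realType} {E : lmodType R}.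
Implicit Types (p q : E -> R) (u v w : E).

Definition sublinear p :=
  (forall u v, p (u + v) <= p u + p v) /\
  (forall t u, 0 <= t -> p (t *: u) <= t * p u).

Lemma sublinear0 p : sublinear p -> p 0 = 0.
Proof.
move=> [pD pZ]; apply/eqP; rewrite eq_le; apply/andP; split.
  by have := pZ 0 0 (lexx 0); rewrite scale0r mul0r.
by have := pD 0 0; rewrite addr0; lra.
Qed.

Lemma sublinearZ p t u : sublinear p -> 0 <= t -> p (t *: u) = t * p u.
Proof.
move=> sp; have [_ pZ] := sp; rewrite le_eqVlt => /predU1P[<-|t0].
  by rewrite scale0r mul0r sublinear0.
apply/eqP; rewrite eq_le pZ ?(ltW t0)//=.
have tV : 0 <= t^-1 by rewrite invr_ge0 ltW.
have := pZ t^-1 (t *: u) tV.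
by rewrite scalerA mulVf ?gt_eqF// scale1r ler_pdivlMl.
Qed.

Lemma sublinear_geN p u : sublinear p -> - p (- u) <= p u.
Proof.
move=> sp; have [pD _] := sp; have := pD u (- u).
by rewrite subrr sublinear0//; lra.
Qed.

(** Straightening [p] along [v] makes it linear on the line spanned by [v], keeps
    its value at [v], and does not lose the linearity along other lines already
    obtained. *)
Definition straighten p v u := inf [set p (u + t *: v) - t * p v | t in [set t | 0 <= t]].

Lemma straighten_lb p v u t : sublinear p -> 0 <= t ->
  - p (- u) <= p (u + t *: v) - t * p v.
Proof.
move=> sp t0; have [pD _] := sp.
have := pD (u + t *: v) (- u); rewrite addrAC subrr add0r sublinearZ//; lra.
Qed.

Lemma straighten_le p v u t : sublinear p -> 0 <= t ->
  straighten p v u <= p (u + t *: v) - t * p v.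
Proof.
move=> sp t0; apply: ge_inf; last by exists t.
by exists (- p (- u)) => _ [s s0 <-]; exact: straighten_lb.
Qed.

Lemma straighten_ge p v u x :
  (forall t, 0 <= t -> x <= p (u + t *: v) - t * p v) -> x <= straighten p v u.
Proof.
move=> xp; apply: lb_le_inf; first by exists (p (u + 0 *: v) - 0 * p v); exists 0 => /=.
by move=> _ [t t0 <-]; exact: xp.
Qed.

Lemma sublinear_straighten p v : sublinear p -> sublinear (straighten p v).
Proof.
move=> sp; have [pD pZ] := sp; split.
  move=> u w.
  rewrite -lerBlDr; apply: straighten_ge => s s0.
  rewrite lerBlDr -lerBlDl; apply: straighten_ge => t t0.
  rewrite lerBlDl.
  apply: le_trans (straighten_le _ _ sp (addr_ge0 s0 t0)) _.
  have -> : u + w + (s + t) *: v = (u + s *: v) + (w + t *: v).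
    by rewrite scalerDl addrACA.
  by have := pD (u + s *: v) (w + t *: v); lra.
move=> t u; rewrite le_eqVlt => /predU1P[<-|t0].
  rewrite scale0r mul0r; apply: le_trans (straighten_le v 0 sp (lexx 0)) _.
  by rewrite scale0r addr0 sublinear0//; lra.
rewrite mulrC -ler_pdivrMr//; apply: straighten_ge => s s0.
rewrite ler_pdivrMr//.
have ts : 0 <= t * s by rewrite mulr_ge0// ltW.
apply: le_trans (straighten_le _ _ sp ts) _.
by rewrite -scalerA -scalerDr sublinearZ ?(ltW t0)// mulrBl; lra.
Qed.

Lemma straighten_dir p v : sublinear p ->
  [/\ forall u, straighten p v u <= p u, straighten p v v = p v &
      straighten p v (- v) = - p v].
Proof.
move=> sp; have le u : straighten p v u <= p u.
  apply: le_trans (straighten_le v u sp (lexx 0)) _.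
  by rewrite scale0r addr0; lra.
have lN : straighten p v (- v) <= - p v.
  apply: le_trans (straighten_le v _ sp ler01) _.
  by rewrite scale1r addNr sublinear0//; lra.
have g := sublinear_geN v (sublinear_straighten v sp).
split => //; apply/eqP; rewrite eq_le ?le ?lN /=; last by have := le v; lra.
by lra.
Qed.

(** It suffices here to be linear along finitely many lines, so the argument is a
    plain induction instead of an appeal to Zorn's lemma. *)
Lemma hahn_banach_seq p v0 (s : seq E) : sublinear p ->
  exists q, [/\ sublinear q, forall u, q u <= p u, q v0 = p v0 &
    forall v, v \in v0 :: s -> q (- v) = - q v].
Proof.
move=> sp; elim: s => [|v s [q [sq qp q0 qs]]].
  have [le eq eqN] := straighten_dir v0 sp.
  exists (straighten p v0); split => //; first exact: sublinear_straighten.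
  by move=> v; rewrite inE => /eqP ->; rewrite eqN eq.
have [le eq eqN] := straighten_dir v sq.
have sq' := sublinear_straighten v sq.
have keep w : q (- w) = - q w -> straighten q v w = q w.
  move=> qw; apply/eqP; rewrite eq_le le/=.
  have := sublinear_geN w sq'; have := le (- w); lra.
exists (straighten q v); split => //.
- by move=> u; exact: le_trans (le u) (qp u).
- by rewrite keep// qs// mem_head.
- have keepN w : w \in v0 :: s -> straighten q v (- w) = - straighten q v w.
    by move=> /qs qw; rewrite [in RHS]keep// -qw keep// opprK qw opprK.
  move=> w; rewrite !inE => /or3P[/eqP->|/eqP->|ws].
  + by rewrite keepN ?mem_head.
  + by rewrite eqN eq.
  + by rewrite keepN// inE ws orbT.
Qed.

(** Oddness at [u] says that [p] is linear on the line through [u]. *)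
Lemma sublinear_straightD p u v : sublinear p ->
  p (- u) = - p u -> p (u + v) = p u + p v.
Proof.
move=> [pD _] pu; apply/eqP; rewrite eq_le pD/=.
by have := pD (- u) (u + v); rewrite addKr; lra.
Qed.

Lemma sublinear_straight_sum p (I : Type) (r : seq I) (x : I -> R) (e : I -> E) :
  sublinear p -> (forall i, p (- e i) = - p (e i)) ->
  p (\sum_(i <- r) x i *: e i) = \sum_(i <- r) x i * p (e i).
Proof.
move=> sp pe.
have pZ t v : p (- v) = - p v -> p (t *: v) = t * p v.
  move=> pv; have [t0|t0] := leP 0 t; first exact: sublinearZ.
  rewrite -[t]opprK scaleNr -scalerN sublinearZ ?oppr_ge0 ?(ltW t0)// pv.
  by rewrite mulrN !mulNr.
elim: r => [|i r IH]; first by rewrite !big_nil sublinear0.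
rewrite !big_cons sublinear_straightD ?IH ?pZ//.
by rewrite -scalerN pZ pe ?opprK// mulrN.
Qed.

End sublinear.

(** * Kantorovich duality on a finite set *)

Section finite_duality.
Context {R : realType} {I : finType}.
Variables (a b : I -> R).
Hypotheses (a0 : forall i, 0 <= a i) (b0 : forall i, 0 <= b i).
Hypotheses (a1 : \sum_i a i = 1) (b1 : \sum_i b i = 1).

Let E := {ffun I * I -> R^o}.
Let e (k : I * I) : E := [ffun l => (l == k)%:R].

Let ffunE_sum (u : E) : u = \sum_k u k *: e k.
Proof.
apply/ffunP => l; rewrite sum_ffunE (bigD1 l)//= big1 => [|k kl].
  by rewrite addr0 !ffunE eqxx /GRing.scale/= mulr1.
by rewrite !ffunE eq_sym (negbTE kl) /GRing.scale/= mulr0.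
Qed.

(** The costs of the separable functions [phi + psi] that dominate [u]. The infimum
    of these costs is sublinear in [u]; a linear functional below it is a
    transport plan with marginals [a] and [b]. *)
Definition dual_set (u : I * I -> R) : set R :=
  [set x | exists phi psi : I -> R, (forall i j, u (i, j) <= phi i + psi j) /\
     x = \sum_i phi i * a i + \sum_j psi j * b j].

(** Weak duality against the product plan, which makes the infimum finite. *)
Lemma dual_set_lb u x : dual_set u x ->
  \sum_i \sum_j u (i, j) * (a i * b j) <= x.
Proof.
move=> [phi [psi [uP ->]]].
have -> : \sum_i phi i * a i + \sum_j psi j * b j =
    \sum_i \sum_j (phi i + psi j) * (a i * b j).
  under [RHS]eq_bigr => i _.
    under eq_bigr => j _ do rewrite mulrDl mulrA [psi j * _]mulrCA.
    rewrite big_split/= -mulr_sumr b1 mulr1 -mulr_sumr; over.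
  by rewrite big_split/= -mulr_suml a1 mul1r.
by apply: ler_sum => i _; apply: ler_sum => j _; rewrite ler_wpM2r ?mulr_ge0.
Qed.

Lemma dual_set_nonempty u : dual_set u !=set0.
Proof.
exists (\sum_i (\sum_k `|u k|) * a i + \sum_(j : I) 0 * b j).
exists (fun=> \sum_k `|u k|), (fun=> 0); split => // i j.
rewrite addr0 (bigD1 (i, j))//= (le_trans (ler_norm _))// lerDl.
by apply: sumr_ge0 => k _.
Qed.

Let p (u : E) : R := inf (dual_set u).

Let p_le (u : E) x : dual_set u x -> p u <= x.
Proof.
move=> ux; apply: ge_inf => //.
by exists (\sum_i \sum_j u (i, j) * (a i * b j)) => y; exact: dual_set_lb.
Qed.

Let p_ge (u : E) x : (forall y, dual_set u y -> x <= y) -> x <= p u.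
Proof. by move=> ux; apply: lb_le_inf => //; exact: dual_set_nonempty. Qed.

Let dual_setZ t (u : E) x : 0 <= t -> dual_set u x -> dual_set (t *: u) (t * x).
Proof.
move=> t0 [phi [psi [uP ->]]].
exists (fun i => t * phi i), (fun j => t * psi j); split => [i j|].
  by rewrite ffunE /GRing.scale/= -mulrDr ler_wpM2l.
by rewrite mulrDr !mulr_sumr; congr +%R; apply: eq_bigr => i _; rewrite mulrA.
Qed.

Let sublinear_p : sublinear p.
Proof.
split=> [u v|t u].
  rewrite -lerBlDr; apply: p_ge => x [phi [psi [uP ->]]].
  rewrite lerBlDr -lerBlDl; apply: p_ge => y [phi' [psi' [vP ->]]].
  rewrite lerBlDl; apply: p_le.
  exists (fun i => phi i + phi' i), (fun i => psi i + psi' i); split.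
    by move=> i j; rewrite ffunE (le_trans (lerD (uP i j) (vP i j)))// addrACA.
  under [X in _ = X + _]eq_bigr do rewrite mulrDl.
  under [X in _ = _ + X]eq_bigr do rewrite mulrDl.
  by rewrite !big_split/= addrACA.
rewrite le_eqVlt => /predU1P[<-|t0].
  rewrite scale0r mul0r; apply: p_le; exists (fun=> 0), (fun=> 0).
  split=> [i j|]; first by rewrite ffunE addr0.
  by rewrite !big1 ?addr0// => i _; rewrite mul0r.
rewrite mulrC -ler_pdivrMr//; apply: p_ge => x ux.
by rewrite ler_pdivrMr// mulrC; apply: p_le; exact: dual_setZ (ltW t0) ux.
Qed.

(** Let [p u] be the infimum of [dual_set u] and [q] a linear functional below [p]
    with the same value at [- c]. Since [p] is nonpositive on nonpositive
    functions, [q] has nonnegative coefficients; since [p] is linear on separable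
    functions, these coefficients have marginals [a] and [b]. The cost of this
    plan is then [- p (- c)], the supremum of the dual problem; [eta] accounts
    for picking an element close to that supremum. *)
Lemma finite_kantorovich (c : I -> I -> R) (eta : R) : 0 < eta ->
  exists (g : I -> I -> R) (phi psi : I -> R),
    [/\ forall i j, 0 <= g i j,
        forall i, \sum_j g i j = a i,
        forall j, \sum_i g i j = b j,
        forall i j, phi i + psi j <= c i j &
        \sum_i \sum_j g i j * c i j <=
          \sum_i phi i * a i + \sum_j psi j * b j + eta].
Proof.
move=> eta0.
pose c' : E := [ffun k => - c k.1 k.2].
have [q [sq qp qc qs]] := hahn_banach_seq c' [seq e k | k : I * I] sublinear_p.
have qe k : q (- e k) = - q (e k).
  by apply: qs; rewrite inE; apply/orP; right; apply/mapP; exists k; rewrite ?mem_enum.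
have qE (u : E) : q u = \sum_i \sum_j u (i, j) * q (e (i, j)).
  rewrite {1}(ffunE_sum u) sublinear_straight_sum// pair_bigA/=.
  by apply: eq_bigr => -[i j].
have q_dual phi psi (u : E) : (forall i j, u (i, j) = phi i + psi j) ->
    q u = \sum_i phi i * a i + \sum_j psi j * b j.
  move=> uE; apply/eqP; rewrite eq_le; apply/andP; split.
    by apply: le_trans (qp _) _; apply: p_le; exists phi, psi; split => // i j; rewrite uE.
  rewrite -lerN2; have <- : q (- u) = - q u.
    rewrite !qE -sumrN; apply: eq_bigr => i _; rewrite -sumrN.
    by apply: eq_bigr => j _; rewrite ffunE mulNr.
  apply: le_trans (qp _) _; apply: p_le; exists (fun i => - phi i), (fun j => - psi j).
  split=> [i j|]; first by rewrite ffunE uE opprD.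
  rewrite opprD -!sumrN.
  by congr +%R; apply: eq_bigr => i _; rewrite mulNr.
exists (fun i j => q (e (i, j))).
have : inf (dual_set c') < p c' + eta by rewrite ltrDl.
move=> /(inf_lt (dual_set_nonempty _))[x [phi [psi [cP xE]]] xlt].
exists (fun i => - phi i), (fun j => - psi j); split.
- move=> i j; rewrite -oppr_le0 -qe; apply: le_trans (qp _) _.
  apply: p_le; exists (fun=> 0), (fun=> 0); split=> [i' j'|].
    by rewrite !ffunE addr0 oppr_le0 ler0n.
  by rewrite !big1 ?addr0// => k _; rewrite mul0r.
- move=> i; pose u : E := [ffun k => (k.1 == i)%:R].
  have /q_dual : forall i' j' : I, u (i', j') = (i' == i)%:R + 0.
    by move=> i' j'; rewrite ffunE addr0.
  rewrite qE (bigD1 i)//= [X in _ + X]big1 => [|k ki]; last first.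
    by rewrite big1// => j _; rewrite ffunE/= (negbTE ki) mul0r.
  under eq_bigr do rewrite ffunE/= eqxx mul1r.
  rewrite addr0 => ->; rewrite (bigD1 i)//= eqxx mul1r !big1 ?addr0// => [j _|k ki].
    by rewrite mul0r.
  by rewrite (negbTE ki) mul0r.
- move=> j; pose u : E := [ffun k => (k.2 == j)%:R].
  have /q_dual : forall i' j' : I, u (i', j') = 0 + (j' == j)%:R.
    by move=> i' j'; rewrite ffunE add0r.
  rewrite qE => qj; transitivity (\sum_i \sum_k u (i, k) * q (e (i, k))).
    apply: eq_bigr => i _; rewrite (bigD1 j)//= [X in _ + X]big1 => [|k kj].
      by rewrite ffunE/= eqxx mul1r addr0.
    by rewrite ffunE/= (negbTE kj) mul0r.
  rewrite qj big1 => [|k _]; last by rewrite mul0r.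
  rewrite add0r (bigD1 j)//= eqxx mul1r big1 ?addr0// => k kj.
  by rewrite (negbTE kj) mul0r.
- by move=> i j; have := cP i j; rewrite ffunE/=; lra.
- have : \sum_i \sum_j q (e (i, j)) * c i j = - q c'.
    rewrite qE -sumrN; apply: eq_bigr => i _; rewrite -sumrN; apply: eq_bigr => j _.
    by rewrite ffunE/= mulNr opprK mulrC.
  move=> ->; rewrite qc.
  have -> : \sum_i - phi i * a i + \sum_j - psi j * b j = - x.
    by rewrite xE opprD -!sumrN; congr +%R; apply: eq_bigr => i _; rewrite mulNr.
  lra.
Qed.

End finite_duality.

(** * Lebesgue measure as an iterated integral *)

Section lebesgue_on_tuples.
Context {R : realType}.
Local Notation mu := (@lebesgue_measure R).
Implicit Types n : nat.

Definition etcons n (t : R) (y : 'E[R]_n) : 'E[R]_n.+1 := [tuple of t :: y].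

(** A synonym of [elebesgue] that carries the sigma-finite structure required by
    the theorems of Fubini and Tonelli. *)
Definition leb n : set 'E[R]_n -> \bar R := elebesgue n.
Arguments leb n A : clear implicits.

HB.instance Definition _ n := Measure.copy (leb n) (elebesgue n).

Definition cube n (a : 'I_n -> R) (l : R) : set 'E[R]_n :=
  [set x | forall i, tnth x i \in `[a i, a i + l]].

Lemma measurable_cube n a l : measurable (@cube n a l).
Proof.
have -> : cube a l = \bigcap_(i in [set: 'I_n]) (fun x => tnth x i) @^-1` [set` `[a i, a i + l]].
  apply/seteqP; split => x; first by move=> xa i _; exact: xa.
  by move=> xa i; exact: xa.
apply: fin_bigcap_measurable => // i _.
rewrite -[_ @^-1` _]setTI; apply: (measurable_tnth (T := measurableTypeR R)) => //.
Qed.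

Lemma leb_cube n (a : 'I_n -> R) l : 0 <= l -> leb n (cube a l) = (l ^+ n)%:E.
Proof.
move=> l0; elim: n a => [|n IH] a.
  by rewrite expr0 /leb/= diracE mem_set// => -[].
rewrite /leb/= /image_measure/= /pushforward.
have -> : (fun p : measurableTypeR R * 'E[R]_n => [tuple of p.1 :: p.2] : 'E[R]_n.+1) @^-1` cube a l
   = [set` `[a ord0, a ord0 + l]] `*` cube (a \o lift ord0) l.
  apply/seteqP; split => -[t y] /=.
    move=> h; split; first exact: (h ord0).
    by move=> i; have := h (lift ord0 i); rewrite tnthS.
  move=> [h1 h2] i; case: (unliftP ord0 i) => [j|] -> //.
  by rewrite tnthS; exact: h2.
rewrite product_measure2E//; last exact: measurable_cube.
have IHa := IH (a \o lift ord0); rewrite /leb in IHa; rewrite IHa.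
rewrite exprS EFinM; congr (_ * _)%E.
rewrite [LHS](lebesgue_measure_itv `[a ord0, a ord0 + l])/= lte_fin.
case: ifPn => [_|]; first by rewrite -EFinD addrAC subrr add0r.
by rewrite ltrDl -leNgt => l0'; rewrite (_ : l = 0)//; apply/eqP; rewrite eq_le l0'.
Qed.

Lemma sigma_finite_leb n : sigma_finite setT (leb n).
Proof.
exists (fun k => cube (fun=> - k%:R) (k%:R *+ 2)).
  apply/esym/seteqP; split => // x _.
  pose b := \sum_(i < n) `|tnth x i|.
  exists (Num.truncn b).+1 => // i; rewrite in_itv/=.
  rewrite mulr2n addKr -ler_norml.
  apply: (@le_trans _ _ b); last by rewrite ltW// truncnS_gt.
  by rewrite /b (bigD1 i)//= lerDl sumr_ge0.
move=> k; split; first exact: measurable_cube.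
by rewrite leb_cube ?ltry// mulrn_wge0.
Qed.

HB.instance Definition _ n :=
  Measure_isSigmaFinite.Build _ _ _ (leb n) (@sigma_finite_leb n).

(** [elebesgue n.+1] is defined from the other iterated product; the uniqueness of
    product measures allows either order of integration. *)
Lemma ge0_integral_lebS n (F : 'E[R]_n.+1 -> \bar R) :
  measurable_fun setT F -> (forall x, 0 <= F x)%E ->
  (\int[(leb n.+1)]_x F x = \int[leb n]_y \int[mu]_t F (etcons t y))%E.
Proof.
move=> mF F0; rewrite /leb/= /image_measure ge0_integral_pushforward//; last exact: measurable_econs.
rewrite preimage_setT.
transitivity (\int[mu \x (leb n)]_z F (etcons z.1 z.2))%E.
  apply: eq_measure_integral => A mA _.
  apply/esym; apply: (product_measure_unique (m' := (mu \x^ leb n)%E)) => //.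
  by move=> B C mB mC; exact: product_measure2E.
apply: (fubini_tonelli2 (m1 := mu) (m2 := leb n) (fun z => F (etcons z.1 z.2))) => //.
by apply: measurableT_comp => //; exact: measurable_econs.
Qed.

End lebesgue_on_tuples.
Arguments leb {R} n A.
Arguments cube {R n} a l.

(** * Affine changes of variables *)

Section affine_line.
Context {R : realType}.
Local Notation mu := (@lebesgue_measure R).

Lemma measurable_affine (r b : R) :
  measurable_fun setT (fun t : measurableTypeR R => r * t + b : measurableTypeR R).
Proof. by apply: measurable_funD => //; apply: measurable_funM. Qed.

(** Both sides are measures in [A] that agree on half-open intervals. *)
Lemma lebesgue_measure_affine (r b : R) (r0 : 0 < r) A : measurable A ->
  (r%:E * mu ((fun t => r * t + b)%R @^-1` A) = mu A)%E.
Proof.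
move=> mA.
have r0' : 0 <= r by exact: ltW.
pose m := mscale (NngNum r0') (image_measure mu (measurable_affine r b)).
suff : mu A = m A by move->.
apply: lebesgue_measure_unique mA => _ [[a c]] _ <-.
rewrite [RHS](_ : _ = (r%:E * mu `]((a - b) / r)%R, ((c - b) / r)%R]%classic)%E); last first.
  rewrite /mscale/=; congr (_ * mu _)%E.
  apply/seteqP; split => t /=; rewrite !in_itv/= ltr_pdivrMr// ler_pdivlMr// ltrBlDr lerBrDr (mulrC t);
  by [].
rewrite !lebesgue_measure_itv/= !lte_fin ltr_pM2r ?invr_gt0// ltrD2r.
case: ifPn => _; last by rewrite mule0.
by rewrite -!EFinB -EFinM; congr EFin; field; rewrite gt_eqF.
Qed.

Lemma ge0_integral_affine (r b : R) (F : R -> \bar R) : 0 < r ->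
  measurable_fun setT F -> (forall t, 0 <= F t)%E ->
  (\int[mu]_t F t = r%:E * \int[mu]_t F (r * t + b)%R)%E.
Proof.
move=> r0 mF F0.
have r0' : 0 <= r by exact: ltW.
pose m := mscale (NngNum r0') (image_measure mu (measurable_affine r b)).
transitivity (\int[m]_t F t)%E.
  apply: eq_measure_integral => A mA _.
  by rewrite -[LHS](lebesgue_measure_affine b r0).
rewrite ge0_integral_mscale//; congr (_ * _)%E.
by rewrite ge0_integral_pushforward//; exact: measurable_affine.
Qed.

Lemma ge0_integral_opp (F : R -> \bar R) :
  measurable_fun setT F -> (forall t, 0 <= F t)%E ->
  (\int[mu]_t F t = \int[mu]_t F (- t)%R)%E.
Proof.
move=> mF F0.
have mN : measurable_fun setT (fun t : measurableTypeR R => - t : measurableTypeR R).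
  exact: oppr_measurable.
transitivity (\int[image_measure mu mN]_t F t)%E.
  by apply: eq_measure_integral => A mA _; rewrite -[LHS]lebesgue_measureN.
by rewrite ge0_integral_pushforward.
Qed.

Lemma ge0_integral_line_affine (r b : R) (F : R -> \bar R) : r != 0 ->
  measurable_fun setT F -> (forall t, 0 <= F t)%E ->
  (\int[mu]_t F (b - r * t)%R = `|r|^-1%:E * \int[mu]_t F t)%E.
Proof.
move=> r0 mF F0.
have pos (s : R) : 0 < s -> (\int[mu]_t F (s * t + b)%R = s^-1%:E * \int[mu]_t F t)%E.
  move=> s0; rewrite (ge0_integral_affine b s0 mF F0) muleA -EFinM.
  by rewrite mulVf ?gt_eqF// mul1e.
have [rlt|rgt|req] := ltgtP r 0; last by rewrite req eqxx in r0.
- rewrite ltr0_norm// -pos ?oppr_gt0//.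
  by apply: eq_integral => t _; rewrite mulNr addrC.
- rewrite gtr0_norm// -pos// ge0_integral_opp//; last first.
    rewrite (_ : (fun t => _) = F \o (fun t => (- r) * t + b)).
      by apply: (measurableT_comp mF); exact: measurable_affine.
    by apply/funext => t /=; rewrite mulNr addrC.
  by apply: eq_integral => t _; rewrite mulrN opprK addrC.
Qed.

End affine_line.

Section elebesgue_affine.
Context {R : realType}.
Local Notation mu := (@lebesgue_measure R).

Definition eadd n (x y : 'E[R]_n) : 'E[R]_n := [tuple tnth x i + tnth y i | i < n].
Definition escale n (r : R) (x : 'E[R]_n) : 'E[R]_n := [tuple r * tnth x i | i < n].

Lemma tnth_etcons0 n t (y : 'E[R]_n) : tnth (etcons t y) ord0 = t.
Proof. by []. Qed.

Lemma tnth_etconsS n t (y : 'E[R]_n) i : tnth (etcons t y) (lift ord0 i) = tnth y i.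
Proof. by rewrite tnthS. Qed.

Lemma eadd_cons n t s (y z : 'E[R]_n) :
  eadd (etcons t y) (etcons s z) = etcons (t + s) (eadd y z).
Proof.
apply: eq_from_tnth => i; rewrite tnth_mktuple.
by case: (unliftP ord0 i) => [j|] ->; rewrite ?tnth_etconsS ?tnth_etcons0// tnth_mktuple.
Qed.

Lemma escale_cons n r t (y : 'E[R]_n) :
  escale r (etcons t y) = etcons (r * t) (escale r y).
Proof.
apply: eq_from_tnth => i; rewrite tnth_mktuple.
by case: (unliftP ord0 i) => [j|] ->; rewrite ?tnth_etconsS ?tnth_etcons0// tnth_mktuple.
Qed.

Lemma etcons_eta n (y : 'E[R]_n.+1) : exists t z, y = etcons t z.
Proof. by case/tupleP: y => t z; exists t, z. Qed.

Lemma measurable_etcons n (y : 'E[R]_n) :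
  measurable_fun setT (fun t : measurableTypeR R => etcons t y).
Proof. by apply: measurable_cons. Qed.

Lemma measurable_eaddl n (a : 'E[R]_n) : measurable_fun setT (fun x => eadd x a).
Proof.
apply/measurable_fun_tnthP => i.
apply: (eq_measurable_fun (fun x : 'E[R]_n => tnth x i + tnth a i)) => [x _|].
  by rewrite /= tnth_mktuple.
by apply: measurable_funD => //; exact: measurable_tnth.
Qed.

Lemma measurable_escale n : measurable_fun setT (fun p : measurableTypeR R * 'E[R]_n => escale p.1 p.2).
Proof.
apply/measurable_fun_tnthP => i.
apply: (eq_measurable_fun (fun x : measurableTypeR R * 'E[R]_n => x.1 * tnth x.2 i)) => [x _|].
  by rewrite /= tnth_mktuple.
apply: measurable_funM => //.
by apply: (measurableT_comp (measurable_tnth i)).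
Qed.

Lemma measurable_escaler n r : measurable_fun setT (@escale n r).
Proof.
exact: (measurableT_comp (@measurable_escale n) (pair1_measurable r)).
Qed.

Lemma ge0_integral_leb_translate n (a : 'E[R]_n) (F : 'E[R]_n -> \bar R) :
  measurable_fun setT F -> (forall x, 0 <= F x)%E ->
  (\int[leb n]_x F (eadd x a) = \int[leb n]_x F x)%E.
Proof.
elim: n a F => [|n IH] a F mF F0.
  by apply: eq_integral => x _; rewrite (tuple0 x) (tuple0 (eadd _ _)).
have [b [a' ->]] := etcons_eta a.
rewrite ge0_integral_lebS//; last first.
  by apply: measurableT_comp => //; exact: measurable_eaddl.
rewrite (ge0_integral_lebS mF F0).
rewrite -(IH a' (fun y => \int[mu]_t F (etcons t y))%E); first last.
- by move=> y; apply: integral_ge0.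
- apply: (measurable_fun_fubini_tonelli_G (m1 := mu) (fun z => F (etcons z.1 z.2))) => //.
  by apply: measurableT_comp => //; exact: measurable_econs.
- apply: eq_integral => y _; under eq_integral do rewrite eadd_cons.
  rewrite (@ge0_integral_affine _ 1 b (fun t => F (etcons t _))) ?mul1e//.
    by apply: eq_integral => t _; rewrite mul1r.
  by apply: measurableT_comp => //; exact: measurable_etcons.
Qed.

Lemma ge0_integral_leb_scale n r (F : 'E[R]_n -> \bar R) : 0 < r ->
  measurable_fun setT F -> (forall x, 0 <= F x)%E ->
  (\int[leb n]_x F x = (r ^+ n)%:E * \int[leb n]_x F (escale r x))%E.
Proof.
move=> r0; elim: n F => [|n IH] F mF F0.
  rewrite expr0 mul1e.
  by apply: eq_integral => x _; rewrite (tuple0 x) (tuple0 (escale _ _)).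
have mG : measurable_fun setT (fun y => \int[mu]_t F (etcons t y))%E.
  apply: (measurable_fun_fubini_tonelli_G (m1 := mu) (fun z => F (etcons z.1 z.2))) => //.
  by apply: measurableT_comp => //; exact: measurable_econs.
rewrite (ge0_integral_lebS mF F0) IH//; last by move=> y; exact: integral_ge0.
have mFs : measurable_fun setT (fun x => F (escale r x)).
  by apply: measurableT_comp => //; exact: measurable_escaler.
rewrite [in RHS](ge0_integral_lebS mFs (fun x => F0 (escale r x))).
rewrite exprSr EFinM -muleA; congr (_ * _)%E.
rewrite -ge0_integralZl//; last 3 first.
- apply: (measurable_fun_fubini_tonelli_G (m1 := mu) (fun z => F (escale r (etcons z.1 z.2)))) => //.
  apply: measurableT_comp => //; apply: measurableT_comp; first exact: measurable_escaler.
  exact: measurable_econs.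
- by move=> y _; exact: integral_ge0.
- by rewrite lee_fin ltW.
apply: eq_integral => y _.
under [in RHS]eq_integral do rewrite escale_cons.
rewrite (@ge0_integral_affine _ r 0 (fun t => F (etcons t _)))//.
  by congr (_ * _)%E; apply: eq_integral => t _; rewrite addr0.
by apply: measurableT_comp => //; exact: measurable_etcons.
Qed.

End elebesgue_affine.

(** * The Euclidean norm and the uniform measure on the sphere *)

Lemma ge0_integral_mrestr d (T : measurableType d) (R : realType)
    (m : {measure set T -> \bar R}) (B D : set T) (mB : measurable B)
    (f : T -> \bar R) : measurable D ->
  measurable_fun setT f -> (forall x, 0 <= f x)%E ->
  (\int[mrestr m mB]_(x in D) f x = \int[m]_(x in D `&` B) f x)%E.
Proof.
move=> mD mf f0.
have mDB : measurable (D `&` B) by exact: measurableI.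
rewrite -[in LHS](setDUK (@subIsetl _ D B)) ge0_integral_setU//; last 3 first.
- exact: measurableD.
- exact: measurable_funTS.
- by apply/eqP; rewrite setDE setICA setICr setI0.
rewrite (@eq_measure_integral _ _ _ (D `&` B) m); last first.
  by move=> A mA AB; rewrite /= /mrestr; congr (m _); apply/setIidPl => x /AB[].
rewrite [X in (_ + X)%E]null_set_integral ?adde0//.
- exact: measurableD.
- exact: measurable_funTS.
- rewrite /= /mrestr (_ : _ `&` _ = set0) ?measure0//.
  by apply/seteqP; split => x //= [[Dx nx] Bx]; exact: nx.
Qed.

Section enorm_theory.
Context {R : realType} {d : nat}.
Implicit Types x y : 'E[R]_d.

Lemma edot_ge0 x : 0 <= edot x x.
Proof. by apply: sumr_ge0 => i _; rewrite -expr2 sqr_ge0. Qed.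

Lemma enorm_ge0 x : 0 <= enorm x. Proof. exact: sqrtr_ge0. Qed.

Lemma sqr_enorm x : enorm x ^+ 2 = \sum_(i < d) tnth x i ^+ 2.
Proof. by rewrite sqr_sqrtr ?edot_ge0//; apply: eq_bigr => i _; rewrite expr2. Qed.

Lemma tnth_le_enorm x i : `|tnth x i| <= enorm x.
Proof.
rewrite -(ler_pXn2r (n := 2)) ?nnegrE ?enorm_ge0// sqr_enorm real_normK ?num_real//.
by rewrite (bigD1 i)//= lerDl; apply: sumr_ge0 => j _; exact: sqr_ge0.
Qed.

Lemma enorm_le_card x r : 0 <= r -> (forall i, `|tnth x i| <= r) ->
  enorm x <= d%:R * r.
Proof.
move=> r0 xr; rewrite -(ler_pXn2r (n := 2)) ?nnegrE ?enorm_ge0 ?mulr_ge0// sqr_enorm.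
apply: (@le_trans _ _ (\sum_(i < d) r ^+ 2)).
  apply: ler_sum => i _; rewrite -(real_normK (num_real (tnth x i))).
  by rewrite ler_pXn2r ?nnegrE.
rewrite sumr_const card_ord exprMn -[_ *+ d]mulr_natl ler_wpM2r ?sqr_ge0//.
by rewrite -natrX ler_nat; case: d => // n; rewrite expnS expn1 leq_pmulr.
Qed.

Lemma enorm_eq0 x : enorm x = 0 -> forall i, tnth x i = 0.
Proof.
by move=> x0 i; apply/eqP; have := tnth_le_enorm x i; rewrite x0 normr_le0.
Qed.

Lemma enorm_scale r x : 0 <= r -> enorm (escale r x) = r * enorm x.
Proof.
move=> r0; apply/eqP; rewrite -(eqrXn2 (n := 2)) ?enorm_ge0 ?mulr_ge0 ?enorm_ge0//.
rewrite sqr_enorm exprMn sqr_enorm mulr_sumr; apply/eqP/eq_bigr => i _.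
by rewrite tnth_mktuple exprMn.
Qed.

Lemma enormalizeE x : enormalize x = escale (enorm x)^-1 x.
Proof. by apply: eq_from_tnth => i; rewrite !tnth_mktuple mulrC. Qed.

Lemma enorm_normalize x : enorm x != 0 -> enorm (enormalize x) = 1.
Proof. by move=> x0; rewrite enormalizeE enorm_scale ?invr_ge0 ?enorm_ge0// mulVf. Qed.

Lemma measurable_esphere : measurable (esphere R d).
Proof.
rewrite -[esphere R d]setTI.
rewrite (_ : esphere R d = enorm @^-1` [set 1]); last by apply/seteqP; split.
exact: measurable_enorm.
Qed.

Lemma enormalize_sphere x : (enormalize x \in esphere R d) = (enorm x != 0).
Proof.
apply/idP/idP => [|x0]; last by rewrite inE /esphere/= enorm_normalize.
rewrite inE /esphere/=; apply: contraPneq => x0.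
rewrite enormalizeE x0 invr0 enorm_scale// mul0r => /eqP.
by rewrite eq_sym oner_eq0.
Qed.

End enorm_theory.

Section ball.
Context {R : realType} (d : nat).

Lemma leb_ball_lty : (leb d (eball d (1 : R)) < +oo)%E.
Proof.
apply: (@le_lt_trans _ _ (leb d (cube (fun=> -1) 2))).
  apply: le_measure; rewrite ?inE; [exact: measurable_eball|exact: measurable_cube|].
  move=> x; rewrite /eball/= => x1 i; rewrite in_itv/=.
  have := le_trans (tnth_le_enorm x i) x1; rewrite ler_norml; lra.
by rewrite leb_cube ?ltry.
Qed.

Lemma leb_ball_gt0 : (0 < leb d (eball d (1 : R)))%E.
Proof.
apply: (@lt_le_trans _ _ (leb d (cube (fun=> 0) (d.+1%:R^-1 : R)))).
  by rewrite leb_cube ?invr_ge0// lte_fin exprn_gt0// invr_gt0.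
apply: le_measure; rewrite ?inE; [exact: measurable_cube|exact: measurable_eball|].
move=> x xc; rewrite /eball/=; apply: (@le_trans _ _ (d%:R * d.+1%:R^-1)).
  apply: enorm_le_card; first by rewrite invr_ge0.
  by move=> i; have := xc i; rewrite in_itv/= add0r => /andP[x0 x1]; rewrite ger0_norm.
by rewrite ler_pdivrMr// mul1r ler_nat.
Qed.

Definition ballvol : R := fine (leb d (eball d (1 : R))).

Lemma ballvolE : leb d (eball d (1 : R)) = ballvol%:E.
Proof. by rewrite fineK// ge0_fin_numE// leb_ball_lty. Qed.

Lemma ballvol_gt0 : 0 < ballvol.
Proof. by rewrite -lte_fin -ballvolE leb_ball_gt0. Qed.

(** The definition of the uniform measure as the cone measure, with its
    normalization computed. *)
Lemma ge0_integral_uniform_sphere (D : set 'E[R]_d) (F : 'E[R]_d -> \bar R) :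
  measurable D -> measurable_fun setT F -> (forall x, 0 <= F x)%E ->
  (\int[uniform_sphere d]_(x in D) F x = ballvol^-1%:E *
    \int[leb d]_(v in enormalize @^-1` D `&` eball d (1 : R)) F (enormalize v))%E.
Proof.
move=> mD mF F0.
have bV : 0 <= ballvol^-1 by rewrite invr_ge0 ltW// ballvol_gt0.
pose m := image_measure (mrestr (elebesgue d) (measurable_eball d 1))
                   (@measurable_enormalize R d).
have mT : m setT = ballvol%:E by rewrite -ballvolE /m/= /image_measure /pushforward/= /mrestr preimage_setT setTI.
transitivity (\int[mscale (NngNum bV) m]_(x in D) F x)%E.
  apply: eq_measure_integral => A mA _.
  have E : mnormalize m (dirac point) A = (m A * ballvol^-1%:E)%E.
    rewrite /mnormalize; case: ifPn => [/orP[]/eqP e|_].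
    - by have [/eqP] := etrans (esym e) mT; rewrite eq_sym gt_eqF ?ballvol_gt0.
    - by have := etrans (esym e) mT.
    - by congr (_ * (_^-1)%:E)%E; exact: (congr1 fine mT).
  by rewrite [LHS]E /mscale/= muleC.
rewrite ge0_integral_mscale//; last exact: measurable_funTS.
congr (_ * _)%E; rewrite /m /image_measure ge0_integral_pushforward//; last 2 first.
- exact: measurable_enormalize.
- exact: measurable_funTS.
rewrite ge0_integral_mrestr//.
- by rewrite -[_ @^-1` _]setTI; exact: measurable_enormalize.
- by apply: measurableT_comp => //; exact: measurable_enormalize.
- by move=> x; exact: F0.
Qed.

Lemma leb_origin : (0 < d)%N -> leb d [set x : 'E[R]_d | enorm x = 0] = 0%E.
Proof.
move=> d0; rewrite (_ : [set x | _] = cube (fun=> 0) 0).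
  by rewrite leb_cube// expr0n; case: d d0.
apply/seteqP; split => x /=.
  by move=> x0 i; rewrite (enorm_eq0 x0 i) in_itv/= addr0 lexx.
move=> x0; apply/eqP; rewrite eq_le enorm_ge0 andbT.
rewrite -[leRHS](mulr0 d%:R); apply: enorm_le_card => // i.
have := x0 i; rewrite in_itv/= addr0 => /andP[x1 x2].
by rewrite (_ : tnth x i = 0) ?normr0//; apply/eqP; rewrite eq_le x1 x2.
Qed.

Lemma measurable_origin : measurable [set x : 'E[R]_d | enorm x = 0].
Proof.
rewrite -[[set x | _]]setTI (_ : [set x | _] = enorm @^-1` [set 0])//.
exact: measurable_enorm.
Qed.

End ball.

(** * Polar coordinates *)

Section polar.
Context {R : realType} (d : nat).
Hypothesis d0 : (0 < d)%N.
Local Notation mu := (@lebesgue_measure R).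
Local Notation S := (esphere R d).

Let dRgt0 : 0 < d%:R :> R. Proof. by rewrite ltr0n. Qed.

(** The cutoffs [0 < r] and [0 < |v| <= 1] are built into the weights [pw] and
    [wn], so that all integrals below range over the whole space. *)
Let pw (r : R) : R := r ^+ d.-1 * \1_(`]0, +oo[) r.
Let wn (a : R) : R := a ^+ d * \1_(`]0, 1]) a.

Let pw_ge0 r : 0 <= pw r.
Proof.
rewrite /pw indicE; case: (boolP (r \in _)) => [|_]; last by rewrite mulr0.
by rewrite inE/= in_itv/= andbT => r0; rewrite mulr1 exprn_ge0// ltW.
Qed.

Let pwE r : 0 < r -> pw r = r ^+ d.-1.
Proof. by move=> r0; rewrite /pw indicE mem_set ?mulr1//= in_itv/= r0. Qed.

Let pw0 r : r <= 0 -> pw r = 0.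
Proof.
by move=> r0; rewrite /pw indicE memNset ?mulr0//= in_itv/= andbT => /(le_lt_trans r0); rewrite ltxx.
Qed.

Let wn_ge0 r : 0 <= wn r.
Proof.
rewrite /wn indicE; case: (boolP (r \in _)) => [|_]; last by rewrite mulr0.
by rewrite inE/= in_itv/= => /andP[r0 _]; rewrite mulr1 exprn_ge0// ltW.
Qed.

Let wnE r : 0 < r -> r <= 1 -> wn r = r ^+ d.
Proof. by move=> r0 r1; rewrite /wn indicE mem_set ?mulr1//= in_itv/= r0 r1. Qed.

Let wn0 r : ~~ (0 < r <= 1) -> wn r = 0.
Proof. by move=> r0; rewrite /wn indicE memNset ?mulr0//= in_itv/=; apply/negP. Qed.

Let mpw : measurable_fun setT pw.
Proof. by apply: measurable_funM => //; exact: measurable_funX. Qed.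

Let mwn : measurable_fun setT wn.
Proof. by apply: measurable_funM => //; exact: measurable_funX. Qed.

(** The inverse, written as a power because powers are known to be measurable. *)
Let iv (r : R) : R := r `^ (-1).

Let ivE r : 0 < r -> iv r = r^-1.
Proof. by move=> r0; rewrite /iv powR_inv1// ltW. Qed.

Let miv : measurable_fun setT iv. Proof. exact: measurable_powR. Qed.

Let qr (a r : R) : R := pw r * iv r ^+ d * wn (a * iv r).

Let qr_ge0 a r : 0 <= qr a r.
Proof. by rewrite /qr; apply: mulr_ge0 => //; apply: mulr_ge0 => //; apply: exprn_ge0; exact: powR_ge0. Qed.

Let mqr : measurable_fun setT (fun p : measurableTypeR R * measurableTypeR R => qr p.1 p.2).
Proof.
have miv2 := measurableT_comp miv (@measurable_snd _ _ (measurableTypeR R) (measurableTypeR R)).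
apply: measurable_funM.
  apply: measurable_funM; first exact: (measurableT_comp mpw measurable_snd).
  exact: measurable_funX.
by apply: (measurableT_comp mwn); apply: measurable_funM.
Qed.

(* With [a = |t|], this is the computation of the integral of [a^d r^(-d-1)]
   over [r >= a]. *)
Let radial a : 0 < a ->
  (\int[mu]_r (qr a r)%:E = (d%:R^-1)%:E)%E.
Proof.
move=> a0.
pose f (r : R) := a ^+ d * r ^- d.+1.
pose F (r : R) := - (d%:R^-1 * a ^+ d * r ^- d).
transitivity (\int[mu]_(r in `[a, +oo[) (f r)%:E)%E.
  rewrite [RHS]integral_mkcond; apply: eq_integral => r _.
  rewrite patchE; case: ifPn => [|]; rewrite ?inE ?notin_setE/= in_itv/= andbT.
    move=> ar; have r0 : 0 < r by exact: lt_le_trans a0 ar.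
    rewrite /qr ivE// pwE// wnE ?divr_gt0// ?ler_pdivrMr ?mul1r//; congr EFin.
    rewrite /f expr_div_n exprVn -[in d.+1](prednK d0) !exprS.
    case: d d0 => // n _ /=; rewrite !exprS.
    by field; rewrite !expf_neq0 ?gt_eqF.
  move=> /negP; rewrite -ltNge => ra.
  have [r0|r0] := leP r 0; first by rewrite /qr pw0// !mul0r.
  rewrite /qr ivE// (wn0 (r := a / r)) ?mulr0// negb_and -!leNgt -ltNge.
  by rewrite [X in _ || X]ltr_pdivlMr// mul1r ra orbT.
have dF (r : R) : 0 < r -> is_derive r 1 F (f r).
  move=> r0.
  have r0' : r ^+ d != 0 by rewrite expf_neq0 ?gt_eqF.
  have h1 : is_derive r (1:R) (fun r : R => r ^+ d) (d%:R * r ^+ d.-1).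
    rewrite (_ : (fun r : R => r ^+ d) = id ^+ d); last first.
      by apply/funext => y; rewrite exprfctE.
    by apply: is_derive_eq; rewrite /GRing.scale/= mulr1.
  have h2 := @is_deriveV _ (fun r : R => r ^+ d) r _ 1 r0' h1.
  have h3 := is_deriveZ (- (d%:R^-1 * a ^+ d)) h2.
  have -> : F = - (d%:R^-1 * a ^+ d) \*: (fun y => (y ^+ d)^-1).
    by apply/funext => y; rewrite /F/= /GRing.scale/= mulNr.
  have -> // : f r = - (d%:R^-1 * a ^+ d) *: (- (r ^+ d) ^- 2 *: (d%:R * r ^+ d.-1)).
  rewrite /GRing.scale/= /f; have dn0 : d%:R != 0 :> R by rewrite gt_eqF.
  rewrite -(prednK d0) /= in dn0 *; rewrite !exprS.
  by field; rewrite ?expf_neq0 ?gt_eqF.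
rewrite (@ge0_continuous_FTC2y _ f F a 0).
- rewrite sub0e /F -EFinN opprK mulfK//.
  by rewrite expf_neq0 ?gt_eqF.
- move=> r ar; have r0 : 0 < r by exact: lt_le_trans a0 ar.
  by rewrite /f mulr_ge0 ?invr_ge0 ?exprn_ge0// ltW.
- apply: continuous_in_subspaceT => r; rewrite inE/= in_itv/= andbT => ar.
  have r0 : 0 < r by exact: lt_le_trans a0 ar.
  apply: cvgM; first exact: cvg_cst.
  apply: cvgV; first by rewrite expf_neq0 ?gt_eqF.
  exact: exprn_continuous.
- have -> : F = (fun r => - (d%:R^-1 * a ^+ d) * (r^-1) ^+ d).
    by apply/funext => r; rewrite /F mulNr exprVn.
  rewrite -[X in _ --> X](mulr0 (- (d%:R^-1 * a ^+ d))).
  apply: cvgM; first exact: cvg_cst.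
  have -> : (0 : R) = 0 ^+ d by rewrite expr0n gtn_eqF.
  apply: (@cvg_comp _ _ _ (fun r : R => r^-1) (fun r => r ^+ d) _ (nbhs (0:R))).
    apply/gtr0_cvgV0; last exact: cvg_id.
    exact: nbhs_pinfty_gt.
  exact: exprn_continuous.
- by move=> r ar; have [] := dF r (lt_trans a0 ar).
- apply: cvg_at_right_filter; apply: differentiable_continuous.
  by apply/derivable1_diffP; have [] := dF a a0.
- move=> r; rewrite in_itv/= andbT => ar.
  by rewrite derive1E; have [_ ->] := dF r (lt_trans a0 ar).
Qed.

Let w (v : 'E[R]_d) := wn (enorm v).

Let mw : measurable_fun setT w.
Proof. exact: (measurableT_comp mwn measurable_enorm). Qed.

Definition ray (G : 'E[R]_d -> \bar R) (v : 'E[R]_d) : \bar R :=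
  (\int[mu]_(r in `]0%R, +oo[) ((r ^+ d.-1)%:E * G (escale r v)))%E.

Let rayE G v : (ray G v = \int[mu]_r ((pw r)%:E * G (escale r v)))%E.
Proof.
rewrite /ray integral_mkcond; apply: eq_integral => r _.
rewrite patchE; case: ifPn => [|]; rewrite ?inE ?notin_setE/= in_itv/= andbT.
  by move=> r0; rewrite pwE.
by move=> /negP; rewrite -leNgt => r0; rewrite pw0// mul0e.
Qed.

Variable G : 'E[R]_d -> \bar R.
Hypothesis mG : measurable_fun setT G.
Hypothesis G0 : forall x, (0 <= G x)%E.

Let mGs : measurable_fun setT (fun p : 'E[R]_d * measurableTypeR R =>
  ((pw p.2)%:E * G (escale p.2 p.1))%E).
Proof.
apply: emeasurable_funM.
  by apply/measurable_EFinP; exact: (measurableT_comp mpw measurable_snd).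
apply: measurableT_comp => //.
exact: (measurableT_comp (@measurable_escale R d) (@measurable_swap _ _ _ _)).
Qed.

Lemma measurable_ray : measurable_fun setT (ray G).
Proof.
rewrite (_ : ray G = fubini_F mu (fun p : 'E[R]_d * measurableTypeR R =>
  ((pw p.2)%:E * G (escale p.2 p.1))%E)); last by apply/funext => v; rewrite rayE.
apply: measurable_fun_fubini_tonelli_F => // p.
by rewrite mule_ge0// lee_fin.
Qed.

Lemma ray_ge0 v : (0 <= ray G v)%E.
Proof. by rewrite rayE; apply: integral_ge0 => r _; rewrite mule_ge0// lee_fin. Qed.

Let ray_normalize v : enorm v != 0 ->
  (ray G (enormalize v) = (enorm v ^+ d)%:E * ray G v)%E.
Proof.
move=> v0; have a0 : 0 < enorm v by rewrite lt_neqAle eq_sym v0 enorm_ge0.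
set a := enorm v in v0 a0 *.
rewrite !rayE (@ge0_integral_affine _ a 0)//; last 2 first.
- exact: (measurableT_comp mGs (pair1_measurable (enormalize v))).
- by move=> r; rewrite mule_ge0// lee_fin.
have -> : a ^+ d = a * a ^+ d.-1 by rewrite -exprS prednK.
rewrite EFinM -muleA; congr (_ * _)%E.
rewrite -ge0_integralZl//; last 3 first.
- exact: (measurableT_comp mGs (pair1_measurable v)).
- by move=> r _; rewrite mule_ge0// lee_fin.
- by rewrite lee_fin exprn_ge0// ltW.
apply: eq_integral => r _; rewrite addr0 muleA -EFinM; congr ((_%:E) * G _)%E.
  have [r0|r0] := leP r 0; first by rewrite !pw0 ?mulr0// pmulr_rle0.
  by rewrite !pwE ?mulr_gt0// exprMn.
by apply: eq_from_tnth => i; rewrite !tnth_mktuple -/a; field.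
Qed.

(** In the cone description of the sphere measure, homogeneity ([ray_normalize])
    turns the right-hand side into d times the integral over |v| <= 1 and r > 0 of
    |v|^d r^(d-1) G(r v). After the substitution t = r v the condition |v| <= 1
    becomes r >= |t|, and the inner integral over r of |t|^d r^(-d-1) is 1/d. *)
Lemma ge0_integral_polar : (\int[leb d]_t G t =
  (d%:R * ballvol d)%:E * \int[uniform_sphere d]_(th in S) ray G th)%E.
Proof.
have mS : measurable S by exact: measurable_esphere.
rewrite ge0_integral_uniform_sphere//; [|exact: measurable_ray|exact: ray_ge0].
rewrite muleA -EFinM -mulrA divff ?gt_eqF ?ballvol_gt0// mulr1.
have -> : (\int[leb d]_(v in enormalize @^-1` S `&` eball d 1) ray G (enormalize v) =
    \int[leb d]_v \int[mu]_r ((w v * pw r)%:E * G (escale r v)))%E.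
  rewrite integral_mkcond; apply: eq_integral => v _.
  under eq_integral do rewrite EFinM -muleA.
  rewrite ge0_integralZl//; last 3 first.
  - exact: (measurableT_comp mGs (pair1_measurable v)).
  - by move=> r _; rewrite mule_ge0// lee_fin.
  - by rewrite lee_fin /w.
  rewrite -rayE patchE; case: ifPn => [|].
    rewrite inE => -[vS v1].
    have v0 : enorm v != 0 by rewrite -enormalize_sphere inE.
    by rewrite ray_normalize// /w wnE// lt_neqAle eq_sym v0 enorm_ge0.
  rewrite notin_setE => /not_andP nv; rewrite /w wn0 ?mul0e//.
  apply/negP => /andP[v0 v1]; case: nv; last by apply.
  apply; have : enormalize v \in S by rewrite enormalize_sphere gt_eqF.
  by rewrite inE.
rewrite (fubini_tonelli (m1 := leb d) (m2 := mu)
  (fun p => ((w p.1 * pw p.2)%:E * G (escale p.2 p.1))%E)); last 2 first.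
- under eq_fun do rewrite EFinM -muleA.
  apply: emeasurable_funM => //.
  by apply/measurable_EFinP; exact: (measurableT_comp mw measurable_fst).
- by move=> p; rewrite mule_ge0// lee_fin mulr_ge0// /w.
transitivity ((d%:R : R)%:E * \int[mu]_r \int[leb d]_t ((qr (enorm t) r)%:E * G t))%E; last first.
  apply: (congr1 (mule d%:R%:E)); apply: eq_integral => r _.
  have mqr' : measurable_fun setT (fun t : 'E[R]_d => (qr (enorm t) r)%:E).
    apply/measurable_EFinP; exact: (measurableT_comp mqr
      (measurable_fun_pair (@measurable_enorm R d) (measurable_cst r))).
  have [r0|r0] := leP r 0.
    by rewrite !integral0_eq// => t _; rewrite /qr pw0// !(mul0r, mulr0) mul0e.
  rewrite (@ge0_integral_leb_scale _ _ r)//; last 2 first.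
  - exact: emeasurable_funM.
  - by move=> t; rewrite mule_ge0// lee_fin.
  rewrite -ge0_integralZl//; last 3 first.
  - apply: (measurableT_comp (emeasurable_funM mqr' mG)); exact: measurable_escaler.
  - by move=> t _; rewrite mule_ge0// lee_fin.
  - by rewrite lee_fin exprn_ge0// ltW.
  apply: eq_integral => v _; rewrite muleA -EFinM; congr ((_%:E) * _)%E.
  rewrite enorm_scale ?ltW// /w /qr ivE// (_ : r * enorm v / r = enorm v); last first.
    by field; rewrite gt_eqF.
  by rewrite exprVn; field; rewrite expf_neq0// gt_eqF.
have mqG : measurable_fun setT (fun p : 'E[R]_d * measurableTypeR R =>
    ((qr (enorm p.1) p.2)%:E * G p.1)%E).
  apply: emeasurable_funM; last by apply: measurableT_comp.
  apply/measurable_EFinP; exact: (measurableT_comp mqr (measurable_fun_pair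
    (measurableT_comp (@measurable_enorm R d) measurable_fst) measurable_snd)).
have qG0 p : (0 <= (qr (enorm p.1) p.2)%:E * G p.1)%E by rewrite mule_ge0// lee_fin.
rewrite -(fubini_tonelli (m1 := leb d) (m2 := mu) _ mqG qG0).
have mqF := measurable_fun_fubini_tonelli_F (m2 := mu) _ mqG qG0.
have qF0 t : (0 <= \int[mu]_r ((qr (enorm t) r)%:E * G t))%E.
  by apply: integral_ge0 => r _; exact: (qG0 (t, r)).
pose N := [set x : 'E[R]_d | enorm x = 0].
pose L t := (\int[mu]_r ((qr (enorm t) r)%:E * G t))%E.
rewrite -[RHS](@ge0_integralZl _ _ _ (leb d) setT measurableT L mqF (d%:R%:E)); last 2 first.
- by move=> t _; exact: qF0.
- by rewrite lee_fin ltW.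
transitivity (\int[leb d]_(x in setT `\` N) G x)%E.
  by apply: ge0_negligible_integral => //; [exact: measurable_origin|exact: leb_origin].
transitivity (\int[leb d]_(x in setT `\` N) (d%:R%:E * L x))%E; last first.
  apply/esym/ge0_negligible_integral => //; [exact: measurable_origin|..|exact: leb_origin].
  - exact: measurable_funeM.
  - by move=> t _; apply: mule_ge0; [rewrite lee_fin ltW|exact: qF0].
apply: eq_integral => t; rewrite inE => -[_ /= /eqP t0].
rewrite /L ge0_integralZr//; last 2 first.
- apply/measurable_EFinP.
  exact: (measurableT_comp mqr (pair1_measurable (enorm t))).
- by move=> r _; rewrite lee_fin.
rewrite radial ?lt_neqAle ?(eq_sym 0) ?t0 ?enorm_ge0// muleA -EFinM.
by rewrite divff ?gt_eqF// mul1e.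
Qed.

End polar.

(** * Integration over the half-line *)

Section half_line.
Context {R : realType}.
Local Notation mu := (@lebesgue_measure R).
Implicit Types (f g F : R -> R).
Local Notation H := (`[0, +oo[%classic : set R).

(** Decay like 1/(1 + t^2): a bound by an explicit integrable function that
    vanishes at infinity, stable under sums and bounded factors. *)
Definition decays f := exists2 C, 0 <= C & forall t, 0 <= t -> `|f t| <= C * (oneDsqr t)^-1.

Let mH : measurable (H : set (measurableTypeR R)). Proof. exact: measurable_itv. Qed.

Lemma integrable_oneDsqrV : mu.-integrable H (EFin \o (fun t => (oneDsqr t)^-1)).
Proof.
have m0 : measurable_fun setT (fun t : R => (oneDsqr t)^-1).
  by apply: continuous_measurable_fun; exact: continuous_oneDsqrV.
have m1 : measurable_fun H (fun t : R => (oneDsqr t)^-1%:E).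
  by apply/measurable_EFinP; exact: measurable_funTS.
apply/integrableP; split => //.
under eq_integral do rewrite gee0_abs ?lee_fin ?invr_ge0//.
by rewrite integral0y_oneDsqr ltry.
Qed.

Lemma decays_integrable f : measurable_fun setT f -> decays f ->
  mu.-integrable H (EFin \o f).
Proof.
move=> mf [C C0 fC].
have := integrableZl mH C integrable_oneDsqrV.
apply: le_integrable => //; first exact/measurable_EFinP/measurable_funTS.
move=> t; rewrite /= in_itv/= andbT => t0; rewrite lee_fin (le_trans (fC t t0))//.
exact: ler_norm.
Qed.

Lemma decaysD f g : decays f -> decays g -> decays (fun t => f t + g t).
Proof.
move=> [C C0 fC] [D D0 gD]; exists (C + D); first exact: addr_ge0.
by move=> t t0; rewrite mulrDl (le_trans (ler_normD _ _))// lerD// ?fC ?gD.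
Qed.

Lemma decays_bounded f g M : (forall t, `|g t| <= M) -> decays f ->
  decays (fun t => f t * g t).
Proof.
move=> gM [C C0 fC]; have M0 : 0 <= M by apply: le_trans (gM 0).
exists (C * M); first exact: mulr_ge0.
by move=> t t0; rewrite normrM mulrAC ler_pM// fC.
Qed.

Lemma decaysZ f (c : R) : decays f -> decays (fun t => c * f t).
Proof.
move=> df; have -> : (fun t => c * f t) = (fun t => f t * (fun=> c) t).
  by apply/funext => t; rewrite mulrC.
by apply: (@decays_bounded f _ `|c|).
Qed.

Lemma integral_half_line_FTC f F : (forall t : R, is_derive t (1:R) F (f t)) ->
  continuous f -> decays f -> decays F ->
  \int[mu]_(t in H) f t = - F 0.
Proof.
move=> dF cf df [C C0 FC].
have mf : measurable_fun setT f by exact: continuous_measurable_fun.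
have cF : continuous F.
  move=> t; apply: differentiable_continuous; apply/derivable1_diffP.
  by have [] := dF t.
have int_n (n : nat) :
    (\int[mu]_(t in H) ((f \_ `[0, n%:R]) t)%:E = (F n%:R - F 0)%:E)%E.
  transitivity (\int[mu]_(t in `[0%R, n%:R]) (f t)%:E)%E.
    rewrite -[in RHS](_ : H `&` `[0%R, n%:R] = `[0%R, n%:R]%classic); last first.
      by apply/setIidPr => t /=; rewrite !in_itv/= andbT => /andP[].
    by rewrite integral_mkcondr; apply: eq_integral => t _; rewrite !patchE; case: ifP.
  have [->|n0] := eqVneq n 0%N; first by rewrite subrr set_itv1 integral_set1.
  rewrite (@continuous_FTC2 _ f F)//.
  - by rewrite ltr0n lt0n.
  - exact: continuous_subspaceT.
  - split=> [t _||]; first by have [] := dF t.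
    + by apply: cvg_at_right_filter; exact: cF.
    + by apply: cvg_at_left_filter; exact: cF.
  - by move=> t _; rewrite derive1E; have [_ ->] := dF t.
have lim1 : (F n%:R - F 0)%:E @[n --> \oo] --> (\int[mu]_(t in H) (f t)%:E)%E.
  rewrite (_ : (fun n : nat => (F n%:R - F 0)%:E) =
     (fun n : nat => \int[mu]_(t in H) ((f \_ `[0, n%:R]) t)%:E)%E); last first.
    by apply/funext => n; rewrite int_n.
  have [D D0 fD] := df.
  apply: (@dominated_cvg _ _ _ mu H _ (fun n t => ((f \_ `[0, n%:R]) t)%:E) (EFin \o f)
     (fun t => D%:E * (oneDsqr t)^-1%:E)%E) => //.
  - move=> n; apply/measurable_EFinP/measurable_funTS.
    by apply/(measurable_restrictT _ _).1 => //; exact: measurable_funTS.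
  - move=> t; rewrite /= in_itv/= andbT => t0.
    apply: cvg_near_cst; exists (Num.truncn t).+1 => // n /= nt.
    rewrite patchE mem_set//= in_itv/= t0 ltW// (lt_le_trans (truncnS_gt t))//.
    by rewrite ler_nat.
  - exact: (integrableZl mH D integrable_oneDsqrV).
  - move=> n t; rewrite /= in_itv/= andbT => t0; rewrite lee_fin patchE.
    by case: ifPn => _; [exact: fD|rewrite normr0 mulr_ge0].
have lim2 : (F n%:R - F 0)%:E @[n --> \oo] --> (- F 0)%:E.
  apply: cvg_EFin; first exact: nearW.
  rewrite -[X in _ --> X]add0r; apply: cvgB; last exact: cvg_cst.
  apply: (@squeeze_cvgr _ _ _ _ (fun n => - (C * n.+1%:R^-1)) (fun n => C * n.+1%:R^-1)).
  - apply: nearW => n /=; rewrite -ler_norml (le_trans (FC _ _))//.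
    rewrite ler_wpM2l// lef_pV2 ?posrE// /oneDsqr -natrX addrC natr1 ler_nat ltnS.
    by case: n => // n; rewrite expnS expn1 leq_pmulr.
  - rewrite -oppr0 -(mulr0 C); apply: cvgN; apply: cvgM; first exact: cvg_cst.
    exact: cvg_harmonic.
  - rewrite -[X in _ --> X](mulr0 C); apply: cvgM; first exact: cvg_cst.
    exact: cvg_harmonic.
by rewrite /Rintegral (cvg_unique _ lim1 lim2).
Qed.

End half_line.

(** * Cosine and sine moments of the Gaussian *)

Section gauss_moments.
Context {R : realType}.
Local Notation mu := (@lebesgue_measure R).
Local Notation H := (`[0, +oo[%classic : set R).

Definition gmono n (t : R) := t ^+ n * gauss_fun t.

Lemma expr_le_expR n (x : R) : 0 <= x -> x ^+ n <= n`!%:R * expR x.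
Proof.
move=> x0; case: n => [|n].
  by rewrite expr0 fact0 mul1r; have := expR_ge1Dx x; lra.
have := expR_ge1Dxn n x0; set q := n.+1`!%:R.
have q0 : 0 < q :> R by rewrite ltr0n fact_gt0.
by rewrite -ler_pdivrMl// mulrC; lra.
Qed.

Lemma decays_gmono n : decays (gmono n).
Proof.
exists (2 + n`!%:R + n.+2`!%:R) => [|t t0]; first by rewrite !addr_ge0.
have g0 := gauss_fun_ge0 t.
rewrite ler_pdivlMr; last by rewrite (lt_le_trans ltr01 (oneDsqr_ge1 t)).
rewrite /gmono ger0_norm ?mulr_ge0 ?exprn_ge0//.
have -> : gauss_fun t = (expR (t ^+ 2))^-1 by rewrite -expRN.
rewrite mulrAC ler_pdivrMr ?expR_gt0// /oneDsqr mulrDr mulr1 -exprD addn2.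
have le k : t ^+ k <= (1 + k`!%:R) * expR (t ^+ 2).
  apply: (@le_trans _ _ (1 + (t ^+ 2) ^+ k)).
    have [t1|t1] := leP t 1.
      by rewrite (@le_trans _ _ 1) ?exprn_ile1// lerDl exprn_ge0// exprn_ge0.
    rewrite -exprM (@le_trans _ _ (t ^+ (2 * k))) ?lerDr// ler_eXn2l//.
    by rewrite mul2n -addnn leq_addr.
  rewrite mulrDl mul1r lerD ?expr_le_expR ?sqr_ge0//.
  by have := expR_ge1Dx (t ^+ 2); have := sqr_ge0 t; lra.
by have := le n; have := le n.+2; lra.
Qed.

Lemma is_derive_gauss (t : R) : is_derive t (1:R) gauss_fun (- (2 * t) * gauss_fun t).
Proof.
have h1 : is_derive t (1:R) (fun t : R => - t ^+ 2) (- (2 * t)).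
  rewrite (_ : (fun t : R => - t ^+ 2) = - (id ^+ 2)); last first.
    by apply/funext => y; rewrite /= fctE exprfctE.
  by apply: is_derive_eq; rewrite /GRing.scale/= mulr1 expr1.
have := @is_derive1_comp R expR (fun t : R => - t ^+ 2) t _ _ (is_derive_expR _) h1.
by rewrite mulrC.
Qed.

Lemma is_derive_gmono n (t : R) :
  is_derive t (1:R) (gmono n) (n%:R * gmono n.-1 t - 2 * gmono n.+1 t).
Proof.
have h1 : is_derive t (1:R) (fun r : R => r ^+ n) (n%:R * t ^+ n.-1).
  rewrite (_ : (fun r : R => r ^+ n) = id ^+ n); last first.
    by apply/funext => y; rewrite exprfctE.
  by apply: is_derive_eq; rewrite /GRing.scale/= mulr1.
have := is_deriveM h1 (is_derive_gauss t).
rewrite /GRing.scale/= /gmono exprS => h.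
by apply: (is_derive_eq h); ring.
Qed.

Lemma continuous_gmono n : continuous (gmono n).
Proof.
move=> t; apply: differentiable_continuous; apply/derivable1_diffP.
by have [] := is_derive_gmono n t.
Qed.

Lemma is_derive_cosZ (s t : R) : is_derive t (1:R) (fun t => cos (t * s)) (- s * sin (t * s)).
Proof.
have h : is_derive t (1:R) (fun t => t * s) s.
  have := is_deriveM (is_derive_id t (1:R)) (is_derive_cst s t (1:R)).
  by rewrite /GRing.scale/= mulr0 add0r mulr1.
have := @is_derive1_comp R cos (fun t : R => t * s) t _ _ (is_derive_cos _) h.
by rewrite mulNr mulrC -mulNr.
Qed.

Lemma is_derive_sinZ (s t : R) : is_derive t (1:R) (fun t => sin (t * s)) (s * cos (t * s)).
Proof.
have h : is_derive t (1:R) (fun t => t * s) s.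
  have := is_deriveM (is_derive_id t (1:R)) (is_derive_cst s t (1:R)).
  by rewrite /GRing.scale/= mulr0 add0r mulr1.
have := @is_derive1_comp R sin (fun t : R => t * s) t _ _ (is_derive_sin _) h.
by rewrite mulrC.
Qed.

Lemma continuous_cosZ (s : R) : continuous (fun t : R => cos (t * s)).
Proof.
move=> t; apply: differentiable_continuous; apply/derivable1_diffP.
by have [] := is_derive_cosZ s t.
Qed.

Lemma continuous_sinZ (s : R) : continuous (fun t : R => sin (t * s)).
Proof.
move=> t; apply: differentiable_continuous; apply/derivable1_diffP.
by have [] := is_derive_sinZ s t.
Qed.

Lemma cos_bound (x : R) : `|cos x| <= 1.
Proof. by rewrite ler_norml cos_geN1 cos_le1. Qed.

Lemma sin_bound (x : R) : `|sin x| <= 1.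
Proof. by rewrite ler_norml sin_geN1 sin_le1. Qed.

(** Half-line Fourier transforms of [t^n exp(-t^2)]. *)
Definition gcos n (s : R) := \int[mu]_(t in H) (gmono n t * cos (t * s)).
Definition gsin n (s : R) := \int[mu]_(t in H) (gmono n t * sin (t * s)).
Definition gmoment n := \int[mu]_(t in H) `|gmono n t|.

Let decays_cos n s : decays (fun t => gmono n t * cos (t * s)).
Proof. by apply: (decays_bounded _ (decays_gmono n)) => t; exact: cos_bound. Qed.

Let decays_sin n s : decays (fun t => gmono n t * sin (t * s)).
Proof. by apply: (decays_bounded _ (decays_gmono n)) => t; exact: sin_bound. Qed.

Let cont_cos n s : continuous (fun t => gmono n t * cos (t * s)).
Proof. by move=> t; apply: cvgM; [exact: continuous_gmono|exact: continuous_cosZ]. Qed.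

Let cont_sin n s : continuous (fun t => gmono n t * sin (t * s)).
Proof. by move=> t; apply: cvgM; [exact: continuous_gmono|exact: continuous_sinZ]. Qed.

Lemma integrable_gcos n s : mu.-integrable H (EFin \o (fun t => gmono n t * cos (t * s))).
Proof. by apply: decays_integrable => //; exact: continuous_measurable_fun. Qed.

Lemma integrable_gsin n s : mu.-integrable H (EFin \o (fun t => gmono n t * sin (t * s))).
Proof. by apply: decays_integrable => //; exact: continuous_measurable_fun. Qed.

Lemma integrable_gmono n : mu.-integrable H (EFin \o gmono n).
Proof.
apply: decays_integrable; last exact: decays_gmono.
by apply: continuous_measurable_fun; exact: continuous_gmono.
Qed.

Let mH : measurable (H : set (measurableTypeR R)). Proof. exact: measurable_itv. Qed.

Let RintB (f g : R -> R) : mu.-integrable H (EFin \o f) -> mu.-integrable H (EFin \o g) ->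
  \int[mu]_(t in H) (f t - g t) = \int[mu]_(t in H) f t - \int[mu]_(t in H) g t.
Proof. by move=> *; exact: RintegralB. Qed.

Let RintZ (f : R -> R) c : mu.-integrable H (EFin \o f) ->
  \int[mu]_(t in H) (c * f t) = c * \int[mu]_(t in H) f t.
Proof. by move=> *; exact: RintegralZl. Qed.

Let intZ (f : R -> R) c : mu.-integrable H (EFin \o f) ->
  mu.-integrable H (EFin \o (fun t => c * f t)).
Proof. by move=> fi; have := integrableZl mH c fi. Qed.

Let intB (f g : R -> R) : mu.-integrable H (EFin \o f) -> mu.-integrable H (EFin \o g) ->
  mu.-integrable H (EFin \o (fun t => f t - g t)).
Proof. by move=> fi gi; have := integrableB mH fi gi. Qed.

(** The fundamental theorem of calculus for [t^n exp(-t^2) cos(t s)]; the boundary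
    term at 0 is present for [n = 0] only. *)
Lemma gcos_parts n s :
  n%:R * gcos n.-1 s - 2 * gcos n.+1 s - s * gsin n s = - (0 ^+ n).
Proof.
pose F t := gmono n t * cos (t * s).
pose f t := n%:R * (gmono n.-1 t * cos (t * s)) - 2 * (gmono n.+1 t * cos (t * s))
  - s * (gmono n t * sin (t * s)).
have -> : n%:R * gcos n.-1 s - 2 * gcos n.+1 s - s * gsin n s = \int[mu]_(t in H) f t.
  rewrite /f RintB; [|apply: intB; apply: intZ; exact: integrable_gcos|apply: intZ; exact: integrable_gsin].
  rewrite RintB; [|apply: intZ; exact: integrable_gcos..].
  by rewrite !RintZ//; [exact: integrable_gsin|exact: integrable_gcos..].
have dF t : is_derive t (1:R) F (f t).
  have := is_deriveM (is_derive_gmono n t) (is_derive_cosZ s t).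
  by rewrite /GRing.scale/= => h; apply: (is_derive_eq h); rewrite /f; ring.
rewrite (@integral_half_line_FTC _ f F dF).
- by rewrite /F /gmono mul0r cos0 mulr1 /gauss_fun (expr0n _ 2)/= oppr0 expR0 mulr1.
- move=> t; apply: cvgB; last by apply: cvgM; [exact: cvg_cst|exact: cont_sin].
  by apply: cvgB; (apply: cvgM; [exact: cvg_cst|exact: cont_cos]).
- apply: decaysD; last first.
    by under eq_fun do rewrite -mulNr; exact: decaysZ.
  apply: decaysD; first exact: decaysZ.
  by under eq_fun do rewrite -mulNr; exact: decaysZ.
- exact: decays_cos.
Qed.

Lemma gsin_parts n s :
  n%:R * gsin n.-1 s - 2 * gsin n.+1 s + s * gcos n s = 0.
Proof.
pose F t := gmono n t * sin (t * s).
pose f t := n%:R * (gmono n.-1 t * sin (t * s)) - 2 * (gmono n.+1 t * sin (t * s))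
  - (- s) * (gmono n t * cos (t * s)).
have -> : n%:R * gsin n.-1 s - 2 * gsin n.+1 s + s * gcos n s = \int[mu]_(t in H) f t.
  rewrite /f RintB; [|apply: intB; apply: intZ; exact: integrable_gsin|apply: intZ; exact: integrable_gcos].
  rewrite RintB; [|apply: intZ; exact: integrable_gsin..].
  by rewrite !RintZ; [rewrite mulNr opprK|exact: integrable_gcos|exact: integrable_gsin..].
have dF t : is_derive t (1:R) F (f t).
  have := is_deriveM (is_derive_gmono n t) (is_derive_sinZ s t).
  by rewrite /GRing.scale/= => h; apply: (is_derive_eq h); rewrite /f; ring.
rewrite (@integral_half_line_FTC _ f F dF).
- by rewrite /F mul0r sin0 mulr0 oppr0.
- move=> t; apply: cvgB; last by apply: cvgM; [exact: cvg_cst|exact: cont_cos].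
  by apply: cvgB; (apply: cvgM; [exact: cvg_cst|exact: cont_sin]).
- apply: decaysD; last first.
    by under eq_fun do rewrite -mulNr; exact: decaysZ.
  apply: decaysD; first exact: decaysZ.
  by under eq_fun do rewrite -mulNr; exact: decaysZ.
- exact: decays_sin.
Qed.

Lemma gcos_le n s : `|gcos n s| <= gmoment n.
Proof.
apply: le_trans (le_normr_Rintegral _ _) _ => //; first exact: integrable_gcos.
apply: le_Rintegral => //.
- exact: (integrable_norm (integrable_gcos n s)).
- exact: (integrable_norm (integrable_gmono n)).
- by move=> t _; rewrite normrM ler_piMr// cos_bound.
Qed.

Lemma gmoment_ge0 n : 0 <= gmoment n.
Proof. exact: Rintegral_ge0. Qed.

(** Two integrations by parts express [s^2 gcos n s] through moments that are
    bounded in [s]. *)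
Lemma gcos_decay n : (0 < n)%N -> exists2 C, 0 <= C & forall s, `|gcos n s| <= C * (oneDsqr s)^-1.
Proof.
case: n => // n _.
pose C := gmoment n.+1 + 2 * (n.+2%:R * gmoment n.+1 + 2 * gmoment n.+3)
  + n.+1%:R * (n%:R * gmoment n.-1 + 2 * gmoment n.+1 + 1).
exists C.
  by rewrite /C; repeat (exact: ler0n || exact: ler01 || exact: gmoment_ge0 || apply: mulr_ge0 || apply: addr_ge0).
move=> s; rewrite ler_pdivlMr; last by rewrite (lt_le_trans ltr01 (oneDsqr_ge1 s)).
rewrite -[X in _ * X]ger0_norm; last by rewrite (le_trans ler01 (oneDsqr_ge1 s)).
rewrite -normrM /oneDsqr mulrDr mulr1.
have -> : gcos n.+1 s * s ^+ 2 = 2 * (n.+2%:R * gcos n.+1 s - 2 * gcos n.+3 s)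
   - n.+1%:R * (n%:R * gcos n.-1 s - 2 * gcos n.+1 s + 0 ^+ n).
  have h1 := gsin_parts n.+1 s; have h2 := gcos_parts n.+2 s; have h3 := gcos_parts n s.
  rewrite /= in h1 h2 h3.
  have e1 : s * gcos n.+1 s = 2 * gsin n.+2 s - n.+1%:R * gsin n s by lra.
  have e2 : s * gsin n.+2 s = n.+2%:R * gcos n.+1 s - 2 * gcos n.+3 s.
    by move: h2; rewrite expr0n/=; lra.
  have e3 : s * gsin n s = n%:R * gcos n.-1 s - 2 * gcos n.+1 s + 0 ^+ n by lra.
  by rewrite -e2 -e3 expr2 mulrC -mulrA e1; ring.
have l1 := gcos_le n.+1 s; have l2 := gcos_le n.+3 s; have l3 := gcos_le n.-1 s.
have l0 : `|(0 : R) ^+ n| <= 1 by rewrite expr0n normr_nat lern1 leq_b1.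
have lm (c x y M N : R) : 0 <= c -> `|x| <= M -> `|y| <= N -> `|c * x - 2 * y| <= c * M + 2 * N.
  move=> c0 xM yN; rewrite (le_trans (ler_normB _ _))// !normrM (ger0_norm c0) (ger0_norm (ler0n _ 2)).
  by apply: lerD; rewrite ler_wpM2l.
have lA := lm _ _ _ _ _ (ler0n _ n.+2) l1 l2.
have lB := lm _ _ _ _ _ (ler0n _ n) l3 l1.
rewrite /C -[leRHS]addrA (le_trans (ler_normD _ _))// lerD//.
rewrite (le_trans (ler_normB _ _))// !normrM !(ger0_norm (ler0n _ _)).
apply: lerD; first by rewrite ler_wpM2l.
by rewrite ler_wpM2l// (le_trans (ler_normD _ _))// lerD.
Qed.

End gauss_moments.

(** * The Fourier transform of the Gaussian *)

Section gauss_fourier.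
Context {R : realType}.
Local Notation mu := (@lebesgue_measure R).
Local Notation H := (`[0, +oo[%classic : set R).

Let mH : measurable (H : set (measurableTypeR R)). Proof. exact: measurable_itv. Qed.

Lemma is_derive_gcos n (s : R) : is_derive s (1:R) (gcos n) (- gsin n.+1 s).
Proof.
pose f (x t : R) := gmono n t * cos (t * x).
have dfx (t x : R) : is_derive x (1:R) (f ^~ t) (- (gmono n.+1 t * sin (t * x))).
  have h : is_derive x (1:R) (fun x => t * x) t.
    have := is_deriveM (is_derive_cst t x (1:R)) (is_derive_id x (1:R)).
    by rewrite /GRing.scale/= mulr0 addr0 mulr1.
  have h2 := @is_derive1_comp R cos (fun x : R => t * x) x _ _ (is_derive_cos _) h.
  have := is_deriveM (is_derive_cst (gmono n t) x (1:R)) h2.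
  rewrite /GRing.scale/= mulr0 addr0 => h3; apply: (is_derive_eq h3).
  by rewrite /gmono exprS; ring.
have dfE : partial1of2 f = fun x t => - (gmono n.+1 t * sin (t * x)).
  by apply/funext => x; apply/funext => t; rewrite partial1of2E; have [_ ->] := dfx t x.
have sI : `]s - 1, s + 1[%classic s by rewrite /= in_itv/=; apply/andP; split; lra.
have i1 x : `]s - 1, s + 1[%classic x -> mu.-integrable H (EFin \o f x).
  by move=> _; exact: integrable_gcos.
have i2 x t : `]s - 1, s + 1[%classic x -> H t -> derivable (f ^~ t) x 1.
  by move=> _ _; have [] := dfx t x.
have i3 : forall t : R, 0 <= (fun t : R => `|gmono n.+1 t|) t by [].
have i4 : mu.-integrable H (EFin \o (fun t : R => `|gmono n.+1 t|)).
  exact: (integrable_norm (integrable_gmono n.+1)).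
have i5 x t : `]s - 1, s + 1[%classic x -> H t -> `|partial1of2 f x t| <= `|gmono n.+1 t|.
  by move=> _ _; rewrite dfE normrN normrM ler_piMr// sin_bound.
split.
  exact: (derivable_under_integral mH sI i1 i2 i3 i4 i5).
rewrite -derive1E (differentiation_under_integral mH sI i1 i2 i3 i4 i5) dfE /gsin.
under eq_Rintegral do rewrite -mulN1r.
rewrite RintegralZl//; last exact: integrable_gsin.
by rewrite mulN1r.
Qed.

Lemma continuous_gcos n : continuous (gcos n : R -> R).
Proof.
move=> t; apply: differentiable_continuous; apply/derivable1_diffP.
by have [] := is_derive_gcos n t.
Qed.

(** Differentiating under the integral and integrating by parts shows that
    [gcos 0] solves y' = - s y / 2. *)
Lemma gcos0E (s : R) : gcos 0 s = Num.sqrt pi / 2 * expR (- (s ^+ 2 / 4)).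
Proof.
have e0 : gcos 0 0 = Num.sqrt pi / 2 :> R.
  rewrite /gcos -[RHS]/(fine (Num.sqrt pi / 2)%:E) -integral0y_gauss.
  congr fine; apply: eq_integral => t _.
  by rewrite /gmono expr0 mul1r mulr0 cos0 mulr1.
pose E (s : R) := expR (s ^+ 2 / 4).
have dE (x : R) : is_derive x (1:R) E (x / 2 * E x).
  have h1 : is_derive x (1:R) (fun t : R => t ^+ 2 / 4) (x / 2).
    rewrite (_ : (fun t : R => t ^+ 2 / 4) = (id ^+ 2) * cst (4^-1)); last first.
      by apply/funext => y; rewrite /= fctE exprfctE.
    have h := is_deriveM (is_deriveX 2 (is_derive_id x (1:R))) (is_derive_cst (4^-1 : R) x (1:R)).
    by apply: (is_derive_eq h); rewrite /GRing.scale/=; field.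
  have := @is_derive1_comp R expR (fun t : R => t ^+ 2 / 4) x _ _ (is_derive_expR _) h1.
  by rewrite mulrC.
have cst x y : gcos 0 x * E x = gcos 0 y * E y.
  apply: (@is_derive_0_is_cst R (fun x => gcos 0 x * E x)) => z.
  have h := is_deriveM (is_derive_gcos 0 z) (dE z).
  apply: (is_derive_eq h); rewrite /GRing.scale/=.
  by have := gsin_parts 0 z; rewrite mul0r => hh; nra.
have := cst s 0; rewrite e0 {2}/E expr0n/= mul0r expR0 mulr1 => <-.
by rewrite -mulrA -expRD subrr expR0 mulr1.
Qed.

(** Adding 1 to the cosine makes the integrand nonnegative, so that this formula can
    be iterated over the coordinates without integrability conditions. The phase
    [b] receives the contribution of the other coordinates. *)
Lemma integral_gauss_cos (b s : R) :
  (\int[mu]_t (gauss_fun t * (1 + cos (b + t * s)))%:E =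
   (Num.sqrt pi * (1 + cos b * expR (- (s ^+ 2 / 4))))%:E)%E.
Proof.
pose h (t : R) := gauss_fun t * (1 + cos (b + t * s)).
have h0 t : 0 <= h t.
  rewrite mulr_ge0 ?gauss_fun_ge0//; have := cos_geN1 (b + t * s); lra.
have ch : continuous h.
  move=> t; apply: cvgM; first exact: continuous_gauss_fun.
  apply: cvgD; first exact: cvg_cst.
  apply: continuous_cvg; first exact: continuous_cos.
  by apply: cvgD; [exact: cvg_cst|apply: cvgM; [exact: cvg_id|exact: cvg_cst]].
have mh : measurable_fun setT (EFin \o h).
  by apply/measurable_EFinP; exact: continuous_measurable_fun.
have mhN : measurable_fun setT (EFin \o (fun t => h (- t))).
  apply/measurable_EFinP; apply: measurableT_comp; first exact: continuous_measurable_fun.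
  exact: oppr_measurable.
have -> : (\int[mu]_t (h t)%:E = \int[mu]_(t in H) (h t)%:E + \int[mu]_(t in H) (h (- t))%:E)%E.
  rewrite (@ge0_integration_by_substitution0 _ (fun t => (h (- t))%:E))//; last by move=> t; rewrite lee_fin.
  under [X in (_ + X)%E]eq_integral do rewrite opprK.
  rewrite -[in LHS](setUv (H : set (measurableTypeR R))) ge0_integral_setU//; last 4 first.
  - exact: measurableC.
  - exact: measurable_funTS.
  - by move=> t _; rewrite lee_fin.
  - exact/disj_setPCl.
  congr (_ + _)%E.
  rewrite setCitvr/= integral_itv_bndo_bndc//.
  exact: measurable_funTS.
rewrite -ge0_integralD//; last 4 first.
- by move=> t _; rewrite lee_fin.
- exact: measurable_funTS.
- by move=> t _; rewrite lee_fin.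
- exact: measurable_funTS.
transitivity (\int[mu]_(t in H) ((2 * gmono 0 t + 2 * cos b * (gmono 0 t * cos (t * s)))%:E))%E.
  apply: eq_integral => t _; rewrite -EFinD /h /gmono expr0 mul1r.
  rewrite mulNr cosB cosD; congr EFin.
  by rewrite /gauss_fun sqrrN; ring.
have i1 := integrable_gmono (R := R) 0.
have i2 := integrable_gcos 0 s.
rewrite -[LHS]fineK; last first.
  apply: integrable_fin_num => //.
  have := integrableD mH (integrableZl mH 2 i1) (integrableZl mH (2 * cos b) i2).
  by [].
congr EFin.
transitivity (2 * gcos 0 0 + 2 * cos b * gcos 0 s); last first.
  by rewrite !gcos0E expr0n/= mul0r oppr0 expR0; field.
rewrite -[LHS]/(\int[mu]_(t in H) (2 * gmono 0 t + 2 * cos b * (gmono 0 t * cos (t * s)))).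
rewrite RintegralD//; [|exact: (integrableZl mH 2 i1)|exact: (integrableZl mH (2 * cos b) i2)].
have -> : gcos 0 0 = \int[mu]_(t in H) gmono 0 t.
  by apply: eq_Rintegral => t _; rewrite mulr0 cos0 mulr1.
by congr (_ + _); exact: RintegralZl.
Qed.

End gauss_fourier.

Section edot_theory.
Context {R : realType}.

Lemma measurable_edot n :
  measurable_fun setT (fun p : 'E[R]_n * 'E[R]_n => edot p.1 p.2).
Proof.
apply: measurable_sum => i; apply: measurable_funM.
  exact: (measurableT_comp (measurable_tnth i) measurable_fst).
exact: (measurableT_comp (measurable_tnth i) measurable_snd).
Qed.

Lemma measurable_edotl n (z : 'E[R]_n) : measurable_fun setT (fun x => edot x z).
Proof. exact: (measurableT_comp (@measurable_edot n) (@pair2_measurable _ _ _ _ z)). Qed.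

Lemma edot_cons n t s (y z : 'E[R]_n) :
  edot (etcons t y) (etcons s z) = t * s + edot y z.
Proof.
by rewrite /edot big_ord_recl !tnth_etcons0; congr +%R; apply: eq_bigr => i _; rewrite !tnth_etconsS.
Qed.

Lemma edot0 (x y : 'E[R]_0) : edot x y = 0.
Proof. by rewrite /edot big_ord0. Qed.

Lemma edot_scalel n r (x y : 'E[R]_n) : edot (escale r x) y = r * edot x y.
Proof. by rewrite /edot mulr_sumr; apply: eq_bigr => i _; rewrite tnth_mktuple mulrA. Qed.

Lemma edotC n (x y : 'E[R]_n) : edot x y = edot y x.
Proof. by apply: eq_bigr => i _; rewrite mulrC. Qed.

Lemma edotE n (x : 'E[R]_n) : edot x x = enorm x ^+ 2.
Proof. by rewrite sqr_sqrtr ?edot_ge0. Qed.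

Lemma edotDr n (x y z : 'E[R]_n) : edot x (eadd y z) = edot x y + edot x z.
Proof.
by rewrite /edot -big_split/=; apply: eq_bigr => i _; rewrite tnth_mktuple mulrDr.
Qed.

Definition egauss n (t : 'E[R]_n) : R := expR (- edot t t).

Lemma measurable_egauss n : measurable_fun setT (@egauss n).
Proof.
apply: measurableT_comp => //; apply: measurable_funN.
by apply: measurable_sum => i; apply: measurable_funM; exact: measurable_tnth.
Qed.

Let wave n (b : R) (z : 'E[R]_n) t := egauss t * (1 + cos (b + edot t z)).

Let wave_ge0 n b (z : 'E[R]_n) t : 0 <= wave b z t.
Proof. by rewrite mulr_ge0 ?expR_ge0//; have := cos_geN1 (b + edot t z); lra. Qed.

Lemma measurable_wave n b (z : 'E[R]_n) :
  measurable_fun setT (fun t : 'E[R]_n => egauss t * (1 + cos (b + edot t z))).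
Proof.
apply: measurable_funM; first exact: measurable_egauss.
apply: measurable_funD => //; apply: measurableT_comp.
  by apply: continuous_measurable_fun; exact: continuous_cos.
by apply: measurable_funD => //; exact: measurable_edotl.
Qed.

(** Integrating out the first coordinate leaves the wave in the other coordinates
    with amplitude [q <= 1] instead of 1. It is put back into the form required by
    the induction hypothesis as the convex combination of a wave with amplitude 1
    and of the constant 1, the latter being a wave with phase pi/2 and frequency 0. *)
Lemma integral_wave n b (z : 'E[R]_n) :
  (\int[leb n]_t (egauss t * (1 + cos (b + edot t z)))%:E =
   (Num.sqrt pi ^+ n * (1 + cos b * expR (- (edot z z / 4))))%:E)%E.
Proof.
elim: n b z => [|n IH] b z.
  rewrite /leb/= integral_dirac//; last first.
    by apply/measurable_EFinP; exact: measurable_wave.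
  rewrite diracT mul1e expr0 mul1r /egauss !edot0 mul0r !oppr0 expR0.
  by rewrite addr0 mul1r mulr1.
have [s [y ->]] := etcons_eta z; rewrite {z}.
rewrite ge0_integral_lebS//; last 2 first.
- by apply/measurable_EFinP; exact: measurable_wave.
- by move=> t; rewrite lee_fin wave_ge0.
set q := expR (- (s ^+ 2 / 4)).
have q0 : 0 <= q by exact: expR_ge0.
have q1 : 0 <= 1 - q by rewrite subr_ge0 expR_le1 oppr_le0 divr_ge0// sqr_ge0.
have e1 y' : (\int[@lebesgue_measure R]_t (egauss (etcons t y') * (1 + cos (b + edot (etcons t y') (etcons s y))))%:E
   = (Num.sqrt pi)%:E * ((1 - q)%:E * (egauss y' * (1 + cos (pi / 2 + edot y' [tuple 0 | _ < n])))%:E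
     + q%:E * (egauss y' * (1 + cos (b + edot y' y)))%:E))%E.
  transitivity (\int[@lebesgue_measure R]_t ((egauss y')%:E * (gauss_fun t * (1 + cos ((b + edot y' y) + t * s)))%:E))%E.
    apply: eq_integral => t _; rewrite -EFinM; congr EFin.
    rewrite /egauss !edot_cons opprD expRD -expr2 /gauss_fun.
    have -> : b + (t * s + edot y' y) = b + edot y' y + t * s by ring.
    by ring.
  rewrite ge0_integralZl//; last 3 first.
  - apply/measurable_EFinP; apply: measurable_funM; first exact: measurable_gauss_fun.
    apply: measurable_funD => //; apply: measurableT_comp.
      by apply: continuous_measurable_fun; exact: continuous_cos.
    by apply: measurable_funD => //; exact: mulrr_measurable.
  - move=> t _; have h := cos_geN1 (b + edot y' y + t * s).
    by rewrite lee_fin; apply: mulr_ge0; [exact: gauss_fun_ge0|lra].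
  - by rewrite lee_fin expR_ge0.
  rewrite integral_gauss_cos -!EFinM; congr EFin.
  rewrite (_ : edot y' [tuple 0 | _ < n] = 0); last first.
    by rewrite /edot big1// => i _; rewrite tnth_mktuple mulr0.
  rewrite addr0 cos_pihalf -/q; ring.
under eq_integral do rewrite e1.
have mw c z : measurable_fun setT (fun t : 'E[R]_n => (egauss t * (1 + cos (c + edot t z)))%:E).
  by apply/measurable_EFinP; exact: measurable_wave.
have w0 c z t : (0 <= (egauss t * (1 + cos (c + @edot R n t z)))%:E)%E.
  by rewrite lee_fin wave_ge0.
rewrite ge0_integralZl//; last 2 first.
- by apply: emeasurable_funD; apply: measurable_funeM; exact: mw.
- by move=> t _; apply: adde_ge0; apply: mule_ge0; rewrite ?lee_fin//; exact: w0.
rewrite ge0_integralD//; last 4 first.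
- by move=> t _; apply: mule_ge0; rewrite ?lee_fin//; exact: w0.
- by apply: measurable_funeM; exact: mw.
- by move=> t _; apply: mule_ge0; rewrite ?lee_fin//; exact: w0.
- by apply: measurable_funeM; exact: mw.
rewrite !ge0_integralZl//.
rewrite !IH cos_pihalf mul0r addr0 mulr1 edot_cons -!EFinM; congr EFin.
have -> : - ((s * s + edot y y) / 4) = - (s ^+ 2 / 4) + - (edot y y / 4) by field.
by rewrite expRD -/q exprS; ring.
Qed.

End edot_theory.

(** * The Gaussian as an average of ridge functions *)

Section sphere_kernel.
Context {R : realType} (d : nat).
Hypothesis d0 : (0 < d)%N.
Local Notation mu := (@lebesgue_measure R).
Local Notation S := (esphere R d).
Local Notation sigma := (@uniform_sphere R d).

Definition ridge_kernel : R -> R := gcos d.-1.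

Definition ridge_const : R := Num.sqrt pi ^+ d / (d%:R * ballvol d).

Lemma ridge_const_gt0 : 0 < ridge_const.
Proof.
by rewrite divr_gt0 ?exprn_gt0 ?sqrtr_gt0 ?pi_gt0// mulr_gt0 ?ltr0n ?ballvol_gt0.
Qed.

Let mono_wave (x : R) :
  (\int[mu]_(r in `]0%R, +oo[) ((r ^+ d.-1)%:E * (gauss_fun r * (1 + cos (r * x)))%:E) =
   (ridge_kernel 0 + ridge_kernel x)%:E)%E.
Proof.
have i1 := integrable_gcos d.-1 (0 : R).
have i2 := integrable_gcos d.-1 x.
have mH : measurable (`[0, +oo[%classic : set (measurableTypeR R)) by exact: measurable_itv.
transitivity (\int[mu]_(r in `[0%R, +oo[) (gmono d.-1 r * cos (r * 0) + gmono d.-1 r * cos (r * x))%:E)%E.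
  rewrite -integral_itv_obnd_cbnd.
    apply: eq_integral => r _; rewrite -EFinM mulr0 cos0 mulr1; congr EFin.
    by rewrite /gmono; ring.
  have := measurable_int _ (integrableD mH i1 i2).
  by apply: measurable_funS => // r /=; rewrite !in_itv/= !andbT => /ltW.
rewrite -[LHS]fineK; last first.
  by apply: integrable_fin_num => //; exact: (integrableD mH i1 i2).
congr EFin.
exact: (RintegralD mH i1 i2).
Qed.

Lemma measurable_ridge_kernel : measurable_fun setT ridge_kernel.
Proof. by apply: continuous_measurable_fun; exact: continuous_gcos. Qed.

Let ridge_kernel_bound x : `|ridge_kernel x| <= gmoment d.-1.
Proof. exact: gcos_le. Qed.

Lemma integrable_ridge_kernel (z : 'E[R]_d) :
  sigma.-integrable S (EFin \o (fun th => ridge_kernel (edot th z))).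
Proof.
have mS : measurable S by exact: measurable_esphere.
apply: measurable_bounded_integrable => //.
- by rewrite (le_lt_trans (probability_le1 _ _))// ltry.
- apply: measurable_funTS; apply: measurableT_comp; first exact: measurable_ridge_kernel.
  exact: measurable_edotl.
- exists (gmoment d.-1); split; first exact: num_real.
  by move=> M ltM th _; apply: le_trans (ridge_kernel_bound _) _; exact: ltW.
Qed.

(** Polar coordinates in [integral_wave] with phase 0. The summand 1 in the
    wave contributes [ridge_kernel 0] for every direction; the case [z = 0]
    computes this contribution, which is then subtracted. *)
Lemma integral_ridge_kernel (z : 'E[R]_d) :
  \int[sigma]_(th in S) ridge_kernel (edot th z) =
  ridge_const * expR (- (edot z z / 4)).
Proof.
have mS : measurable S by exact: measurable_esphere.
have dn0 : (d%:R * ballvol d : R) != 0.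
  by rewrite gt_eqF// mulr_gt0 ?ltr0n ?ballvol_gt0.
have key z' : (\int[sigma]_(th in S) (ridge_kernel 0 + ridge_kernel (edot th z'))%:E
    = (ridge_const * (1 + expR (- (edot z' z' / 4))))%:E)%E.
  have := integral_wave 0 z'; rewrite cos0 mul1r.
  rewrite (ge0_integral_polar d0)//; last 2 first.
  - by apply/measurable_EFinP; exact: measurable_wave.
  - by move=> t; rewrite lee_fin mulr_ge0 ?expR_ge0//; have := cos_geN1 (0 + edot t z'); lra.
  rewrite (_ : (\int[sigma]_(th in S) _ = \int[sigma]_(th in S)
     (ridge_kernel 0 + ridge_kernel (edot th z'))%:E)%E); last first.
    apply: eq_integral => th; rewrite inE /esphere/= => th1.
    rewrite -mono_wave; apply: eq_integral => r _.
    rewrite add0r edot_scalel; congr (_ * (_ * _)%:E)%E.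
    by rewrite /egauss edot_scalel edotC edot_scalel edotE th1 /gauss_fun; congr expR; ring.
  move=> /(congr1 (fun x => ((d%:R * ballvol d)^-1)%:E * x)%E).
  rewrite muleA -!EFinM mulVf// mul1e => ->; congr EFin.
  by rewrite /ridge_const mulrA [_^-1 * _]mulrC.
have mass : ridge_kernel 0 * fine (sigma S) = ridge_const.
  have := key [tuple 0 | _ < d].
  have -> : edot [tuple 0 | _ < d] [tuple (0:R) | _ < d] = 0.
    by rewrite /edot big1// => i _; rewrite tnth_mktuple mul0r.
  rewrite mul0r oppr0 expR0.
  rewrite (eq_integral (cst (ridge_kernel 0 + ridge_kernel 0)%:E)); last first.
    move=> th _; rewrite /= (_ : edot _ _ = 0)//.
    by rewrite /edot big1// => i _; rewrite tnth_mktuple mulr0.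
  have mE : sigma S = (fine (sigma S))%:E.
    by rewrite fineK// ge0_fin_numE// (le_lt_trans (probability_le1 _ _))// ltry.
  rewrite integral_cst// [X in (_ * X)%E]mE => -[]; lra.
have := congr1 fine (key z) => /=; rewrite -[LHS]/(\int[sigma]_(th in S) (ridge_kernel 0 + ridge_kernel (edot th z))).
rewrite RintegralD//; last 2 first.
- exact: finite_measure_integrable_cst.
- exact: integrable_ridge_kernel.
rewrite Rintegral_cst// -[fine _]/(fine (sigma S)) mass; lra.
Qed.

End sphere_kernel.

(** * Integrals of a function of one coordinate over a cube *)

Lemma measurable_fun_integral2 d1 d2 (T1 : measurableType d1) (T2 : measurableType d2)
    (R : realType) (m2 : {sigma_finite_measure set T2 -> \bar R}) (F : T1 * T2 -> \bar R) :
  measurable_fun setT F -> measurable_fun setT (fun x => \int[m2]_y F (x, y))%E.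
Proof.
move=> mF.
have mp := measurable_fun_fubini_tonelli_F (m2 := m2) _ (measurable_funepos mF) (funepos_ge0 _).
have mn := measurable_fun_fubini_tonelli_F (m2 := m2) _ (measurable_funeneg mF) (funeneg_ge0 _).
rewrite (_ : (fun x => _) = fun x => (fubini_F m2 F^\+%E x - fubini_F m2 F^\-%E x)%E).
  exact: emeasurable_funB.
apply/funext => x; rewrite integralE.
by rewrite -[fun y => F (x, y)]/(F \o pair x) funepos_comp funeneg_comp.
Qed.

(** For nonnegative functions monotonicity follows from the definition of the
    integral as a supremum over simple functions, for arbitrary [f] and [g]. This
    matters for the sliced distance, the integral of a function of the direction
    that is not shown to be measurable. *)
Lemma ge0_le_integral_any d (T : measurableType d) (R : realType)
    (m : {measure set T -> \bar R}) (D : set T) (f g : T -> \bar R) :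
  (forall x, D x -> 0 <= f x)%E -> (forall x, D x -> f x <= g x)%E ->
  (\int[m]_(x in D) f x <= \int[m]_(x in D) g x)%E.
Proof.
move=> f0 fg; have g0 x : D x -> (0 <= g x)%E.
  by move=> Dx; exact: le_trans (f0 x Dx) (fg x Dx).
rewrite ge0_integralE// [leRHS]ge0_integralE//.
apply: le_ereal_sup => _ [h /= hf <-]; exists h => //= x.
apply: le_trans (hf x) _; rewrite !patchE.
by case: ifPn => // /set_mem; exact: fg.
Qed.

Section slab.
Context {R : realType}.
Local Notation mu := (@lebesgue_measure R).

Lemma integral_leb_translate n (a : 'E[R]_n) (F : 'E[R]_n -> \bar R) :
  measurable_fun setT F -> (\int[leb n]_x F (eadd x a) = \int[leb n]_x F x)%E.
Proof.
move=> mF; rewrite integralE [RHS]integralE.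
rewrite -[fun x => F (eadd x a)]/(F \o (fun x => eadd x a)) funepos_comp funeneg_comp.
congr (_ - _)%E.
- by rewrite -[RHS](ge0_integral_leb_translate a)//; exact: measurable_funepos.
- by rewrite -[RHS](ge0_integral_leb_translate a)//; exact: measurable_funeneg.
Qed.

Lemma indic_cube_cons n (a : 'I_n.+1 -> R) l t (y : 'E[R]_n) :
  \1_(cube a l) (etcons t y) =
  \1_[set` `[a ord0, a ord0 + l]] t * \1_(cube (a \o lift ord0) l) y :> R.
Proof.
rewrite !indicE -natrM mulnb; congr (_ %:R); congr nat_of_bool.
apply/idP/andP => [|[]]; rewrite !inE.
  move=> h; split; first exact: (h ord0).
  by move=> i; have := h (lift ord0 i); rewrite tnth_etconsS.
move=> h1 h2 i; case: (unliftP ord0 i) => [j|] -> //.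
by rewrite tnth_etconsS; exact: h2.
Qed.

Lemma measurable_ridge d (U : measurableType d) n (phi : measurableTypeR R -> U) (s : R)
    (th : 'E[R]_n) :
  measurable_fun setT phi -> measurable_fun setT (fun y => phi (s - edot th y)).
Proof.
move=> mphi; apply: measurableT_comp => //; apply: measurable_funB => //.
exact: (measurableT_comp (@measurable_edot R n) (pair1_measurable th)).
Qed.

Let mcube n (b : 'I_n -> R) l :
  measurable_fun setT (fun y => (\1_(cube b l) y)%:E : \bar R).
Proof. by apply/measurable_EFinP/measurable_indic; exact: measurable_cube. Qed.

Let mitv (b l : R) : measurable_fun setT (fun t : measurableTypeR R =>
  (\1_[set` `[b, b + l]] t)%:E : \bar R).
Proof. by apply/measurable_EFinP/measurable_indic. Qed.

Let mline (phi : R -> \bar R) (c b : R) : measurable_fun setT phi ->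
  measurable_fun setT (fun t : measurableTypeR R => phi (b - c * t)).
Proof.
move=> mphi; rewrite (_ : (fun t => _) = phi \o (fun t => (- c) * t + b)).
  by apply: (measurableT_comp mphi); exact: measurable_affine.
by apply/funext => t /=; rewrite mulNr addrC.
Qed.

Section step.
Variables (n : nat) (a : 'I_n.+1 -> R) (l : R) (phi : R -> \bar R) (s t0 : R).
Variable th : 'E[R]_n.
Hypotheses (mphi : measurable_fun setT phi) (phi0 : forall t, (0 <= phi t)%E).
Let a' := a \o lift ord0.
Let I : set R := [set` `[a ord0, a ord0 + l]].

Let F (z : R * 'E[R]_n) : \bar R :=
  ((\1_(cube a' l) z.2)%:E * ((\1_I z.1)%:E * phi ((s - t0 * z.1) - edot th z.2)%R))%E.

Let F0 z : (0 <= F z)%E.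
Proof. by rewrite /F !mule_ge0// lee_fin. Qed.

Let mF : measurable_fun setT (F : measurableTypeR R * 'E[R]_n -> \bar R).
Proof.
apply: emeasurable_funM; first exact: (measurableT_comp (mcube a' l) measurable_snd).
apply: emeasurable_funM; first exact: (measurableT_comp (mitv (a ord0) l) measurable_fst).
apply: (measurableT_comp mphi); apply: measurable_funB; last first.
  exact: (measurableT_comp (measurableT_comp (@measurable_edot R n) (pair1_measurable th)) measurable_snd).
apply: measurable_funB; first exact: measurable_cst.
by apply: measurable_funM; [exact: measurable_cst|exact: measurable_fst].
Qed.

Let FE t y : ((\1_(cube a l) (etcons t y))%:E *
   phi (s - edot (etcons t0 th) (etcons t y))%R)%E = F (t, y).
Proof.
rewrite /F edot_cons indic_cube_cons EFinM muleAC muleC.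
by congr (_ * (_ * phi _))%E; rewrite /=; ring.
Qed.

Let mS : measurable_fun setT (fun y => ((\1_(cube a l) y)%:E *
   phi (s - edot (etcons t0 th) y)%R)%E).
Proof. exact: (emeasurable_funM (mcube a l) (measurable_ridge s (etcons t0 th) mphi)). Qed.

(** The first coordinate is integrated first, for a direction with [t0 != 0]. *)
Lemma slab_head :
  (\int[leb n.+1]_y ((\1_(cube a l) y)%:E * phi (s - edot (etcons t0 th) y)%R) =
   \int[leb n]_y ((\1_(cube a' l) y)%:E *
     \int[mu]_t ((\1_I t)%:E * phi ((s - edot th y) - t0 * t)%R)))%E.
Proof.
rewrite ge0_integral_lebS//; last by move=> y; rewrite mule_ge0// lee_fin.
apply: eq_integral => y _.
have mI := emeasurable_funM (mitv (a ord0) l) (mline t0 (s - edot th y) mphi).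
rewrite -(ge0_integralZl mu measurableT mI) ?lee_fin//; last first.
  by move=> t _; rewrite mule_ge0// lee_fin.
by apply: eq_integral => t _; rewrite FE /F/= addrAC.
Qed.

(** The first coordinate is integrated last. *)
Lemma slab_tail :
  (\int[leb n.+1]_y ((\1_(cube a l) y)%:E * phi (s - edot (etcons t0 th) y)%R) =
   \int[mu]_t ((\1_I t)%:E * \int[leb n]_y ((\1_(cube a' l) y)%:E *
     phi ((s - t0 * t) - edot th y)%R)))%E.
Proof.
rewrite ge0_integral_lebS//; last by move=> y; rewrite mule_ge0// lee_fin.
under eq_integral do under eq_integral do rewrite FE.
rewrite -(fubini_tonelli (m1 := mu) (m2 := leb n) F mF F0).
apply: eq_integral => t _.
have mC := emeasurable_funM (mcube a' l) (measurable_ridge (s - t0 * t) th mphi).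
rewrite -(ge0_integralZl (leb n) measurableT mC) ?lee_fin//; last first.
  by move=> y _; rewrite mule_ge0// lee_fin.
by apply: eq_integral => y _; rewrite /F muleCA.
Qed.

End step.

(** The substitution t = s - <th, y> in the coordinate [i] turns the integral over
    that coordinate into the integral of [phi] over the line, with the Jacobian
    [1 / |th_i|], and each of the other coordinates contributes a factor [l]. *)
Lemma slab_bound n (i : 'I_n.+1) (a : 'I_n.+1 -> R) l (phi : R -> \bar R) (s : R)
    (th : 'E[R]_n.+1) : 0 <= l -> tnth th i != 0 ->
  measurable_fun setT phi -> (forall t, 0 <= phi t)%E ->
  (\int[leb n.+1]_y ((\1_(cube a l) y)%:E * phi (s - edot th y)%R) <=
   (l ^+ n / `|tnth th i|)%:E * \int[mu]_t phi t)%E.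
Proof.
move=> l0 thi mphi phi0; have I0 : (0 <= \int[mu]_t phi t)%E by apply: integral_ge0.
have intcube m (b : 'I_m -> R) (c : \bar R) : (0 <= c)%E ->
    (\int[leb m]_y ((\1_(cube b l) y)%:E * c) = (l ^+ m)%:E * c)%E.
  move=> c0; rewrite (ge0_integralZr (leb m) measurableT (mcube b l))//.
  rewrite (integral_indic (leb m) measurableT (measurable_cube b l)) setIT.
  by congr (_ * _)%E; exact: leb_cube.
have head m (b : 'I_m.+1 -> R) u t0 (eta : 'E[R]_m) : t0 != 0 ->
    (\int[leb m.+1]_y ((\1_(cube b l) y)%:E * phi (u - edot (etcons t0 eta) y)%R) <=
    (l ^+ m / `|t0|)%:E * \int[mu]_t phi t)%E.
  move=> t00; rewrite slab_head//.
  have le1 y : (\int[mu]_t ((\1_[set` `[b ord0, b ord0 + l]] t)%:E * phi ((u - edot eta y) - t0 * t)%R) <=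
      `|t0|^-1%:E * \int[mu]_t phi t)%E.
    rewrite -(ge0_integral_line_affine (u - edot eta y) t00 mphi phi0).
    apply: ge0_le_integral_any => t _; first by rewrite mule_ge0// lee_fin.
    by rewrite -[leRHS]mul1e lee_wpmul2r// lee_fin indicE lern1 leq_b1.
  apply: (@le_trans _ _ (\int[leb m]_y ((\1_(cube (b \o lift ord0) l) y)%:E *
      (`|t0|^-1%:E * \int[mu]_t phi t)))%E).
    apply: ge0_le_integral_any => y _.
      rewrite mule_ge0 ?lee_fin//; apply: integral_ge0 => t _.
      by rewrite mule_ge0// lee_fin.
    by rewrite lee_wpmul2l// lee_fin.
  by rewrite intcube ?mule_ge0 ?lee_fin// EFinM muleA.
elim: n i a s th thi => [|n IH] i a s th.
  have [t0 [th' ->]] := etcons_eta th; rewrite (ord1 i) tnth_etcons0 => t00.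
  exact: head.
have [t0 [th' ->]] := etcons_eta th; case: (unliftP ord0 i) => [j|] ->.
  rewrite tnth_etconsS => thj; rewrite slab_tail//.
  set K := (\int[mu]_t phi t)%E in I0 IH *.
  apply: (@le_trans _ _ (\int[mu]_t ((\1_[set` `[a ord0, a ord0 + l]] t)%:E *
      ((l ^+ n / `|tnth th' j|)%:E * K)))%E).
    apply: ge0_le_integral_any => t _.
      rewrite mule_ge0 ?lee_fin//; apply: integral_ge0 => y _.
      by rewrite mule_ge0// lee_fin.
    by rewrite lee_wpmul2l// ?lee_fin//; exact: IH.
  rewrite (ge0_integralZr mu measurableT (mitv _ _))//; last first.
    by rewrite mule_ge0// lee_fin divr_ge0// exprn_ge0.
  rewrite integral_indic//= setIT [X in (X * _)%E](_ : _ = l%:E).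
    by rewrite muleA -EFinM exprS mulrA.
  rewrite [LHS]lebesgue_measure_itv/= lte_fin; case: ifPn => [_|].
    by rewrite -EFinD addrAC subrr add0r.
  rewrite ltrDl -leNgt => l0'.
  by rewrite (_ : l = 0)//; apply/eqP; rewrite eq_le l0'.
by rewrite tnth_etcons0 => t00; exact: head.
Qed.

Lemma slab_bound_pred n (i : 'I_n) (a : 'I_n -> R) l (phi : R -> \bar R) (s : R)
    (th : 'E[R]_n) : 0 <= l -> tnth th i != 0 ->
  measurable_fun setT phi -> (forall t, 0 <= phi t)%E ->
  (\int[leb n]_y ((\1_(cube a l) y)%:E * phi (s - edot th y)%R) <=
   (l ^+ n.-1 / `|tnth th i|)%:E * \int[mu]_t phi t)%E.
Proof. by case: n i a th => [[]//|n] i a th; exact: slab_bound. Qed.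

End slab.

(** * Ridge functions *)

Section kernel_L1.
Context {R : realType} (d : nat).
Hypothesis d2 : (2 <= d)%N.
Local Notation mu := (@lebesgue_measure R).
Local Notation k := (@ridge_kernel R d).

Lemma ridge_kernel_even s : k (- s) = k s.
Proof.
by apply: eq_Rintegral => t _; rewrite mulrN cosN.
Qed.

Lemma integral_oneDsqrV_lty : (\int[mu]_t ((oneDsqr t)^-1)%:E < +oo)%E.
Proof.
rewrite (@ge0_symfun_integralT R (fun t => (oneDsqr t)^-1)).
- rewrite (_ : [set x | _] = `[0, +oo[%classic); last first.
    by apply/seteqP; split => x/=; rewrite in_itv/= andbT.
  by rewrite integral0y_oneDsqr -EFinM ltry.
- by move=> t; rewrite invr_ge0 (le_trans ler01 (oneDsqr_ge1 t)).
- exact: continuous_oneDsqrV.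
- by move=> t /=; rewrite /oneDsqr sqrrN.
Qed.

Lemma ridge_kernel_L1 : (\int[mu]_t `|k t|%:E < +oo)%E.
Proof.
have d1 : (0 < d.-1)%N by rewrite -ltnS prednK// ltnW.
have [C C0 kC] := gcos_decay (R := R) d1.
apply: (@le_lt_trans _ _ (\int[mu]_t (C%:E * ((oneDsqr t)^-1)%:E))%E).
  by apply: ge0_le_integral_any => t _; rewrite ?lee_fin//; exact: kC.
have m1 : measurable_fun setT (fun t : R => ((oneDsqr t)^-1)%:E : \bar R).
  apply/measurable_EFinP; apply: continuous_measurable_fun.
  exact: continuous_oneDsqrV.
rewrite (ge0_integralZl mu measurableT m1)//.
by apply: lte_mul_pinfty; rewrite ?lee_fin//; exact: integral_oneDsqrV_lty.
Qed.

Definition ridge_L1 : R := fine (\int[mu]_t `|k t|%:E)%E.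

Lemma ridge_L1E : (\int[mu]_t `|k t|%:E = ridge_L1%:E)%E.
Proof. by rewrite fineK// ge0_fin_numE ?ridge_kernel_L1//; exact: integral_ge0. Qed.

Lemma ridge_L1_ge0 : 0 <= ridge_L1.
Proof. by rewrite -lee_fin -ridge_L1E; apply: integral_ge0. Qed.

End kernel_L1.

Section ridge.
Context {R : realType} (d : nat).
Hypothesis d2 : (2 <= d)%N.
Local Notation k := (@ridge_kernel R d).
Local Notation S := (esphere R d).

Let d0 : (0 < d)%N. Proof. exact: ltnW. Qed.

Lemma bounded_cube_integrable (h : 'E[R]_d -> R) a l C : 0 <= l ->
  measurable_fun setT h -> (forall y, `|h y| <= C * \1_(cube a l) y) ->
  (leb d).-integrable setT (EFin \o h).
Proof.
move=> l0 mh hC; have mc : measurable (@cube R d a l) by exact: measurable_cube.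
have : (leb d).-integrable setT (EFin \o (\1_(cube a l) : 'E[R]_d -> R)).
  have mi : measurable_fun setT (fun y => (\1_(cube a l) y)%:E : \bar R).
    by apply/measurable_EFinP/measurable_indic.
  apply/integrableP; split => //.
  rewrite (eq_integral (fun y => (\1_(cube a l) y)%:E)) => [|y _]; last first.
    by rewrite gee0_abs// lee_fin.
  rewrite (integral_indic (leb d) measurableT mc) setIT.
  by rewrite [X in (X < _)%E](leb_cube a l0) ltry.
move=> /(integrableZl measurableT C); apply: le_integrable => //.
  exact/measurable_EFinP.
by move=> y _ /=; rewrite lee_fin (le_trans (hC y))// ler_norm.
Qed.

Variables (f : 'E[R]_d -> R) (r B : R).
Hypotheses (r0 : 0 <= r) (B0 : 0 <= B).
Let Q := @cube R d (fun=> - (2 * r)) (4 * r).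
Hypothesis mf : measurable_fun setT f.
Hypothesis fB : forall y, `|f y| <= B * \1_Q y.
Hypothesis f1 : forall x y, `|f x - f y| <= Defs.edist x y.

Let M : R := gmoment d.-1.
Let kM s : `|k s| <= M. Proof. exact: gcos_le. Qed.
Let M0 : 0 <= M. Proof. exact: gmoment_ge0. Qed.
Let l0 : 0 <= 4 * r. Proof. by rewrite mulr_ge0. Qed.
Let mk := @measurable_ridge_kernel R d.

(** The profile in the direction [th] of the convolution of [f] with the Gaussian;
    see [ridge_average]. *)
Definition ridge (th : 'E[R]_d) (s : R) : R :=
  \int[leb d]_y (f y * k (s - edot th y)).

Let mridge th s : measurable_fun setT (fun y : 'E[R]_d => k (s - edot th y)).
Proof. exact: measurable_ridge. Qed.

Let integrable_ridge th s :
  (leb d).-integrable setT (EFin \o (fun y => f y * k (s - edot th y))).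
Proof.
apply: (bounded_cube_integrable (a := fun=> - (2 * r)) (l := 4 * r) (C := B * M)) => //.
  by apply: measurable_funM.
move=> y; rewrite normrM mulrAC ler_pM//; exact: fB.
Qed.

Lemma ridge_bounded th s : `|ridge th s| <= B * M * (4 * r) ^+ d.
Proof.
rewrite -lee_fin EFin_normr_Rintegral//.
apply: le_trans (le_abse_integral _ _ _) _ => //.
  by apply/measurable_EFinP; apply: measurable_funM.
apply: (@le_trans _ _ (\int[leb d]_y ((B * M)%:E * (\1_Q y)%:E))%E).
  apply: ge0_le_integral_any => y _ //=.
  by rewrite lee_fin normrM mulrAC ler_pM//; exact: fB.
have mI : measurable_fun setT (fun y => (\1_Q y)%:E : \bar R).
  by apply/measurable_EFinP/measurable_indic; exact: measurable_cube.
rewrite (ge0_integralZl (leb d) measurableT mI)// ?lee_fin ?mulr_ge0//.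
rewrite (integral_indic (leb d) measurableT (@measurable_cube _ _ _ _)) setIT.
by rewrite [X in (_ * X <= _)%E](@leb_cube _ _ _ _ l0) EFinM.
Qed.

(** Some coordinate of a unit vector is bounded below, which makes the
    estimate of [slab_bound] uniform in the direction. *)
Lemma esphere_coord (th : 'E[R]_d) : S th -> exists i, (2 * d%:R)^-1 <= `|tnth th i|.
Proof.
rewrite /esphere/= => th1; apply/existsP; apply: contraPT th1.
rewrite negb_exists => /forallP thi; apply/eqP; rewrite lt_eqF//.
apply: (@le_lt_trans _ _ (d%:R * (2 * d%:R)^-1)).
  apply: enorm_le_card; first by rewrite invr_ge0 mulr_ge0.
  by move=> i; rewrite ltW// ltNge; exact: thi.
have dn0 : (d%:R : R) != 0 by rewrite pnatr_eq0 -lt0n.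
by rewrite invfM mulrCA divff// mulr1 invf_lt1// ltr1n.
Qed.

(** The factor 2 counts the supports of [f] and of its translate; one factor
    [2 d] comes from the length of the translation, the other from the slab
    estimate. *)
Definition ridge_lip : R := 2 * (2 * d%:R) ^+ 2 * 4 ^+ d.-1 * ridge_L1 d.

(** With [a] a multiple of the basis vector of a large coordinate of [th], chosen
    such that <th, a> = h, a translation by [a] in the integral that defines
    [ridge] moves the increment from the kernel to [f]. The increment of [f] is at
    most |a| and vanishes outside the cube and its translate, where the kernel is
    controlled by [slab_bound]. *)
Lemma ridge_lipschitz th s h : S th ->
  `|ridge th (s + h) - ridge th s| <= ridge_lip * r ^+ d.-1 * `|h|.
Proof.
move=> /esphere_coord[i thi].
have c0 : 0 < (2 * d%:R)^-1 :> R by rewrite invr_gt0 mulr_gt0// ltr0n.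
have thi0 : 0 < `|tnth th i| by exact: lt_le_trans c0 thi.
have thn0 : tnth th i != 0 by rewrite -normr_gt0.
have [a [ea da]] : exists a : 'E[R]_d,
    edot th a = h /\ forall y, Defs.edist (eadd y a) y = `|h| / `|tnth th i|.
  exists [tuple if j == i then h / tnth th i else 0 | j < d]; split.
    rewrite /edot (bigD1 i)//= big1 => [|j ji]; rewrite tnth_mktuple.
      by rewrite eqxx addr0 mulrCA divff// mulr1.
    by rewrite (negbTE ji) mulr0.
  move=> y; rewrite /Defs.edist (bigD1 i)//= big1 => [|j ji]; rewrite !tnth_mktuple.
    by rewrite eqxx addr0 addrAC subrr add0r sqrtr_sqr normf_div.
  by rewrite (negbTE ji) addr0 subrr expr0n.
have mfa : measurable_fun setT (fun y => f (eadd y a)).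
  by apply: measurableT_comp => //; exact: measurable_eaddl.
pose w := fun y => (f (eadd y a) - f y) * k (s - edot th y).
have mw : measurable_fun setT w.
  by apply: measurable_funM => //; apply: measurable_funB.
have ish : (leb d).-integrable setT (EFin \o (fun y => f (eadd y a) * k (s - edot th y))).
  apply: (bounded_cube_integrable (a := fun j => - (2 * r) - tnth a j) (l := 4 * r) (C := B * M)) => //.
    by apply: measurable_funM.
  move=> y; rewrite normrM mulrAC ler_pM// (le_trans (fB _))//.
  rewrite ler_wpM2l// !indicE ler_nat; case: (boolP (eadd y a \in Q)) => //.
  rewrite inE => yQ; rewrite mem_set// => j; have := yQ j.
  by rewrite tnth_mktuple !in_itv/= => /andP[? ?]; apply/andP; split; lra.
have -> : ridge th (s + h) - ridge th s = \int[leb d]_y w y.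
  have -> : ridge th (s + h) = \int[leb d]_y (f (eadd y a) * k (s - edot th y)).
    apply: (congr1 fine); rewrite -(integral_leb_translate a); last first.
      by apply/measurable_EFinP; apply: measurable_funM.
    apply: eq_integral => y _; congr (_ * k _)%:E.
    by rewrite edotDr ea; ring.
  rewrite /ridge -RintegralB//.
  by apply: eq_Rintegral => y _; rewrite /w mulrBl.
have iw : (leb d).-integrable setT (EFin \o w).
  have := integrableB measurableT ish (integrable_ridge th s).
  by apply: eq_integrable => // y _; rewrite /w /= mulrBl EFinB.
rewrite -lee_fin EFin_normr_Rintegral//.
apply: le_trans (le_abse_integral _ _ _) _ => //; first exact/measurable_EFinP.
set c := `|h| / `|tnth th i|.
have c00 : 0 <= c by rewrite divr_ge0.
have mQ : measurable_fun setT (fun y => (\1_Q y)%:E : \bar R).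
  by apply/measurable_EFinP/measurable_indic; exact: measurable_cube.
have mG u : measurable_fun setT (fun y => ((\1_Q y)%:E * `|k (u - edot th y)|%:E)%E).
  apply: emeasurable_funM => //; apply/measurable_EFinP.
  by apply: measurableT_comp => //; exact: mridge.
have G0 u y : (0 <= (\1_Q y)%:E * `|k (u - edot th y)|%:E)%E by rewrite -EFinM lee_fin mulr_ge0.
have slab u : (\int[leb d]_y ((\1_Q y)%:E * `|k (u - edot th y)|%:E) <=
    ((4 * r) ^+ d.-1 / `|tnth th i| * ridge_L1 d)%:E)%E.
  rewrite EFinM -(ridge_L1E d2).
  apply: (@slab_bound_pred _ _ i _ _ (fun t => `|k t|%:E)) => //.
  by apply/measurable_EFinP; apply: measurableT_comp.
apply: (@le_trans _ _ (\int[leb d]_y (c%:E * ((\1_Q y)%:E * `|k (s - edot th y)|%:E +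
    (\1_Q (eadd y a))%:E * `|k ((s + h) - edot th (eadd y a))|%:E)))%E).
  apply: ge0_le_integral_any => y _ //=.
  rewrite -!EFinM lee_fin /w normrM edotDr ea.
  have -> : s + h - (edot th y + h) = s - edot th y by ring.
  rewrite -mulrDl mulrA ler_wpM2r//.
  have [yQ|yQ] := boolP (y \in Q).
    rewrite (le_trans (f1 _ _))// da indicE yQ ler_peMr// lerDl.
    by rewrite indicE ler0n.
  have [yaQ|yaQ] := boolP (eadd y a \in Q).
    by rewrite (le_trans (f1 _ _))// da !indicE yaQ ler_peMr// lerDr ler0n.
  have f0 z : z \notin Q -> f z = 0.
    by move=> zQ; apply/eqP; rewrite -normr_le0 (le_trans (fB z))// indicE (negbTE zQ) mulr0.
  by rewrite !f0// subrr normr0 mulr_ge0// addr_ge0// indicE ler0n.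
have mGa : measurable_fun setT (fun y => ((\1_Q (eadd y a))%:E * `|k ((s + h) - edot th (eadd y a))|%:E)%E).
  exact: (measurableT_comp (mG (s + h)) (measurable_eaddl a)).
rewrite ge0_integralZl ?lee_fin//; last 2 first.
- by apply: emeasurable_funD => //; exact: mG.
- by move=> y _; rewrite adde_ge0.
rewrite ge0_integralD//.
rewrite (ge0_integral_leb_translate a (F := fun y => ((\1_Q y)%:E * `|k (s + h - edot th y)|%:E)%E))//.
apply: (@le_trans _ _ (c%:E * (((4 * r) ^+ d.-1 / `|tnth th i| * ridge_L1 d)%:E +
   ((4 * r) ^+ d.-1 / `|tnth th i| * ridge_L1 d)%:E))%E).
  by rewrite lee_wpmul2l ?lee_fin// leeD.
rewrite -EFinD -EFinM lee_fin.
have q1 : `|tnth th i|^-1 <= 2 * d%:R.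
  by rewrite -[leRHS]invrK lef_pV2// posrE.
have q2 : `|tnth th i|^-1 ^+ 2 <= (2 * d%:R) ^+ 2.
  by rewrite ler_pXn2r ?nnegrE// ?invr_ge0// mulr_ge0.
rewrite (_ : c * _ = (2 * 4 ^+ d.-1 * ridge_L1 d * r ^+ d.-1 * `|h|) * `|tnth th i|^-1 ^+ 2); last first.
  by rewrite /c exprMn; field; rewrite gt_eqF.
rewrite (_ : ridge_lip * _ * _ = (2 * 4 ^+ d.-1 * ridge_L1 d * r ^+ d.-1 * `|h|) * (2 * d%:R) ^+ 2); last first.
  by rewrite /ridge_lip; ring.
have L0 := @ridge_L1_ge0 R d d2.
rewrite ler_wpM2l//; repeat (exact: L0 || exact: ler0n || apply: exprn_ge0 || apply: mulr_ge0 || done).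
Qed.

End ridge.

(** * Averaging ridge functions over the directions *)

Section gauss_scaled.
Context {R : realType} (d : nat).

Lemma measurable_gauss_scaled (s : R) :
  measurable_fun setT (fun z : 'E[R]_d => expR (- (edot z z / s ^+ 2))).
Proof.
apply: measurableT_comp => //; apply: measurable_funN; apply: measurable_funM => //.
by apply: measurable_sum => i; apply: measurable_funM; exact: measurable_tnth.
Qed.

Lemma gauss_scaled_le1 (s : R) (z : 'E[R]_d) : `|expR (- (edot z z / s ^+ 2))| <= 1.
Proof.
rewrite ger0_norm ?expR_ge0// expR_le1 oppr_le0 mulr_ge0 ?edot_ge0//.
by rewrite invr_ge0 sqr_ge0.
Qed.

Lemma integral_gauss_scaled (s : R) : 0 < s ->
  (\int[leb d]_z (expR (- (edot z z / s ^+ 2)))%:E = ((s * Num.sqrt pi) ^+ d)%:E)%E.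
Proof.
move=> s0; rewrite (@ge0_integral_leb_scale _ d s _ s0); last 2 first.
- by apply/measurable_EFinP; exact: measurable_gauss_scaled.
- by move=> z; rewrite lee_fin expR_ge0.
rewrite exprMn EFinM; congr (_ * _)%E.
have := integral_wave (pi / 2) [tuple (0 : R) | _ < d].
rewrite cos_pihalf mul0r addr0 mulr1 => <-; apply: eq_integral => z _; congr EFin.
rewrite (_ : edot z _ = 0); last by rewrite /edot big1// => i _; rewrite tnth_mktuple mulr0.
rewrite addr0 cos_pihalf addr0 mulr1 /egauss edot_scalel edotC edot_scalel; congr expR.
by field; rewrite gt_eqF.
Qed.

(** A wider Gaussian absorbs the factor |z|, as
    u <= 2 (1 + 5/36 u^2) <= 2 exp(5/36 u^2) and 1/4 = 1/9 + 5/36. *)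
Lemma enorm_gauss_le (z : 'E[R]_d) :
  enorm z * expR (- (edot z z / 2 ^+ 2)) <= 2 * expR (- (edot z z / 3 ^+ 2)).
Proof.
set u := enorm z; rewrite edotE -/u.
have -> : - (u ^+ 2 / 2 ^+ 2) = - (5 / 36 * u ^+ 2) + - (u ^+ 2 / 3 ^+ 2) by field.
rewrite expRD mulrA ler_wpM2r ?expR_ge0// expRN ler_pdivrMr ?expR_gt0//.
have := expR_ge1Dx (5 / 36 * u ^+ 2); have := sqr_ge0 (u - 2); rewrite sqrrB; nra.
Qed.

End gauss_scaled.

Section ridge_average.
Context {R : realType} (d : nat).
Hypothesis d2 : (2 <= d)%N.
Local Notation k := (@ridge_kernel R d).
Local Notation S := (esphere R d).
Local Notation sigma := (@uniform_sphere R d).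

Let d0 : (0 < d)%N. Proof. exact: ltnW. Qed.

Variables (f : 'E[R]_d -> R) (r B : R).
Hypotheses (r0 : 0 <= r) (B0 : 0 <= B).
Let Q := @cube R d (fun=> - (2 * r)) (4 * r).
Hypothesis mf : measurable_fun setT f.
Hypothesis fB : forall y, `|f y| <= B * \1_Q y.
Hypothesis f1 : forall x y, `|f x - f y| <= Defs.edist x y.

Let M : R := gmoment d.-1.
Let kM s : `|k s| <= M. Proof. exact: gcos_le. Qed.
Let M0 : 0 <= M. Proof. exact: gmoment_ge0. Qed.
Let l0 : 0 <= 4 * r. Proof. by rewrite mulr_ge0. Qed.
Let mk := @measurable_ridge_kernel R d.
Let mS : measurable S. Proof. exact: measurable_esphere. Qed.

Let fBs x z : `|f (eadd z x)| <= B * \1_(cube (fun j => - (2 * r) - tnth x j) (4 * r)) z.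
Proof.
rewrite (le_trans (fB _))// ler_wpM2l// !indicE ler_nat.
case: (boolP (eadd z x \in Q)) => //.
rewrite inE => yQ; rewrite mem_set// => j; have := yQ j.
by rewrite tnth_mktuple !in_itv/= => /andP[? ?]; apply/andP; split; lra.
Qed.

Lemma measurable_ridge2 :
  measurable_fun setT (fun p : 'E[R]_d * 'E[R]_d => ridge f p.2 (edot p.2 p.1)).
Proof.
apply: (measurableT_comp (f := fine)) => //.
apply: (measurable_fun_integral2 (leb d)
  (F := fun q : ('E[R]_d * 'E[R]_d) * 'E[R]_d => (f q.2 * k (edot q.1.2 q.1.1 - edot q.1.2 q.2))%:E)).
have m12 : measurable_fun setT (fun q : ('E[R]_d * 'E[R]_d) * 'E[R]_d => q.1.2).
  exact: (measurableT_comp measurable_snd measurable_fst).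
have m11 : measurable_fun setT (fun q : ('E[R]_d * 'E[R]_d) * 'E[R]_d => q.1.1).
  exact: (measurableT_comp measurable_fst measurable_fst).
apply/measurable_EFinP; apply: measurable_funM.
  exact: (measurableT_comp mf measurable_snd).
apply: (measurableT_comp mk); apply: measurable_funB.
  exact: (measurableT_comp (@measurable_edot R d) (measurable_fun_pair m12 m11)).
exact: (measurableT_comp (@measurable_edot R d) (measurable_fun_pair m12 measurable_snd)).
Qed.

Let Psi x (p : 'E[R]_d * 'E[R]_d) : R :=
  \1_S p.1 * (f (eadd p.2 x) * k (edot p.1 p.2)).

Let mPsi x : measurable_fun setT (EFin \o Psi x).
Proof.
apply/measurable_EFinP; apply: measurable_funM.
  by apply: (measurableT_comp _ measurable_fst); exact: measurable_indic.
apply: measurable_funM.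
  apply: (measurableT_comp mf).
  exact: (measurableT_comp (measurable_eaddl x) measurable_snd).
apply: (measurableT_comp mk); exact: measurable_edot.
Qed.

Let C : R := B * M * (4 * r) ^+ d.

Let Psi_int x th : (\int[leb d]_z `|Psi x (th, z)|%:E <= C%:E)%E.
Proof.
set q := cube (fun j => - (2 * r) - tnth x j) (4 * r).
apply: (@le_trans _ _ (\int[leb d]_y ((B * M)%:E * (\1_q y)%:E))%E).
  apply: ge0_le_integral_any => y _ //=; rewrite ?lee_fin//.
  rewrite /Psi/= !normrM.
  rewrite -[leRHS]mul1r ler_pM//.
    by rewrite indicE normr_nat lern1 leq_b1.
  by rewrite mulrAC ler_pM.
have mq : measurable q by exact: measurable_cube.
have mI : measurable_fun setT (fun y => (\1_q y)%:E : \bar R).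
  by apply/measurable_EFinP/measurable_indic.
rewrite (ge0_integralZl (leb d) measurableT mI)// ?lee_fin ?mulr_ge0//.
rewrite (integral_indic (leb d) measurableT mq) setIT.
by rewrite [X in (_ * X <= _)%E](@leb_cube _ _ _ _ l0) EFinM.
Qed.

(** After the translation y = z + x, the integrals over [z] and over the directions
    are exchanged and [integral_ridge_kernel] is applied. *)
Lemma ridge_average x :
  \int[sigma]_(th in S) ridge f th (edot th x) =
  ridge_const d * \int[leb d]_z (f (eadd z x) * expR (- (edot z z / 2 ^+ 2))).
Proof.
have iPsi : (sigma \x leb d)%E.-integrable setT (EFin \o Psi x).
  apply/(integrable12ltyP sigma (leb d) (mPsi x)).
  apply: (@le_lt_trans _ _ (\int[sigma]_th C%:E)%E).
    apply: ge0_le_integral_any => th _; first exact: integral_ge0.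
    exact: Psi_int.
  by rewrite integral_cst// [X in (_ * X)%E](_ : _ = 1%E) ?mule1 ?ltry//; exact: probability_setT.
have e1 th : (\int[leb d]_z (EFin \o Psi x) (th, z) = ((fun th => ridge f th (edot th x)) \_ S th)%:E)%E.
  rewrite patchE; case: ifPn => thS; last first.
    by rewrite integral0_eq// => z _; rewrite /Psi/= indicE (negbTE thS) mul0r.
  have itg : (leb d).-integrable setT (EFin \o (fun z => f (eadd z x) * k (edot th z))).
    apply: (bounded_cube_integrable (a := fun j => - (2 * r) - tnth x j) (l := 4 * r) (C := B * M)) => //.
      apply: measurable_funM.
        by apply: (measurableT_comp mf); exact: measurable_eaddl.
      apply: (measurableT_comp mk).
      exact: (measurableT_comp (@measurable_edot R d) (pair1_measurable th)).
    by move=> y; rewrite normrM mulrAC ler_pM.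
  transitivity (\int[leb d]_z (f (eadd z x) * k (edot th z))%:E)%E.
    by apply: eq_integral => z _; rewrite /Psi/= indicE thS mul1r.
  have mfk : measurable_fun setT (fun y => (f y * k (edot th x - edot th y))%:E).
    by apply/measurable_EFinP; apply: measurable_funM => //; exact: measurable_ridge.
  rewrite /ridge /Rintegral -(integral_leb_translate x mfk).
  rewrite [in RHS](eq_integral (EFin \o (fun z => f (eadd z x) * k (edot th z)))).
    by rewrite fineK// integrable_fin_num.
  move=> z _ /=; rewrite edotDr opprD addrCA subrr addr0.
  by rewrite ridge_kernel_even.
rewrite Rintegral_mkcond {1}/Rintegral.
have e2 z : (\int[sigma]_th (EFin \o Psi x) (th, z) =
   (f (eadd z x) * (ridge_const d * expR (- (edot z z / 2 ^+ 2))))%:E)%E.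
  have ik := integrable_ridge_kernel z.
  transitivity (\int[sigma]_(th in S) ((f (eadd z x))%:E * (k (edot th z))%:E))%E.
    rewrite [RHS]integral_mkcond; apply: eq_integral => th _.
    rewrite patchE /Psi/= indicE; case: ifPn => _; last by rewrite mul0r.
    by rewrite mul1r EFinM.
  rewrite integralZl// EFinM; congr (_ * _)%E.
  have -> : 2 ^+ 2 = 4 :> R by ring.
  rewrite -(integral_ridge_kernel d0) /Rintegral fineK//.
  exact: integrable_fin_num.
rewrite (eq_integral (fun th => \int[leb d]_z (EFin \o Psi x) (th, z))%E) => [|th _]; last first.
  by rewrite e1.
rewrite (Fubini iPsi) (eq_integral (fun z =>
  (f (eadd z x) * (ridge_const d * expR (- (edot z z / 2 ^+ 2))))%:E)) => [|z _]; last first.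
  by rewrite e2.
have iE : (leb d).-integrable setT (EFin \o (fun z => f (eadd z x) * expR (- (edot z z / 2 ^+ 2)))).
  apply: (bounded_cube_integrable (a := fun j => - (2 * r) - tnth x j) (l := 4 * r) (C := B)) => //.
    apply: measurable_funM; last exact: measurable_gauss_scaled.
    by apply: (measurableT_comp mf); exact: measurable_eaddl.
  move=> y; rewrite normrM; apply: le_trans (fBs x y).
  by rewrite ler_piMr// gauss_scaled_le1.
rewrite -RintegralZl// /Rintegral; congr fine; apply: eq_integral => z _.
by congr EFin; ring.
Qed.

Definition gauss_mass : R := (2 * Num.sqrt pi) ^+ d.
(** An upper bound for the first absolute moment of the Gaussian. *)
Definition gauss_spread : R := 2 * (3 * Num.sqrt pi) ^+ d.

Lemma gauss_average x :
  `|\int[leb d]_z (f (eadd z x) * expR (- (edot z z / 2 ^+ 2))) - gauss_mass * f x|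
  <= gauss_spread.
Proof.
have ig : (leb d).-integrable setT (EFin \o (fun z : 'E[R]_d => expR (- (edot z z / 2 ^+ 2)))).
  apply/integrableP; split.
    by apply/measurable_EFinP; exact: measurable_gauss_scaled.
  under eq_integral do rewrite /= ger0_norm ?expR_ge0//.
  by rewrite integral_gauss_scaled ?ltry.
have iE : (leb d).-integrable setT (EFin \o (fun z => f (eadd z x) * expR (- (edot z z / 2 ^+ 2)))).
  apply: (bounded_cube_integrable (a := fun j => - (2 * r) - tnth x j) (l := 4 * r) (C := B)) => //.
    apply: measurable_funM; last exact: measurable_gauss_scaled.
    by apply: (measurableT_comp mf); exact: measurable_eaddl.
  move=> y; rewrite normrM; apply: le_trans (fBs x y).
  by rewrite ler_piMr// gauss_scaled_le1.
have -> : gauss_mass * f x = \int[leb d]_z (f x * expR (- (edot z z / 2 ^+ 2))).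
  by rewrite RintegralZl// /Rintegral integral_gauss_scaled//= mulrC.
have iC : (leb d).-integrable setT (EFin \o (fun z => f x * expR (- (edot z z / 2 ^+ 2)))).
  by have := integrableZl measurableT (f x) ig.
rewrite -RintegralB//.
have iD := integrableB measurableT iE iC.
rewrite -lee_fin EFin_normr_Rintegral//.
apply: le_trans (le_abse_integral _ _ _) _ => //.
  by have /integrableP[] := iD.
apply: (@le_trans _ _ (\int[leb d]_z (2%:E * (expR (- (edot z z / 3 ^+ 2)))%:E))%E).
  apply: ge0_le_integral_any => z _ //=.
  rewrite -EFinM lee_fin -mulrBl normrM [`|expR _|]ger0_norm ?expR_ge0//.
  apply: le_trans (enorm_gauss_le z).
  rewrite ler_wpM2r ?expR_ge0// (le_trans (f1 _ _))// /Defs.edist.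
  rewrite (_ : \sum_(i < d) _ = edot z z)//.
  by apply: eq_bigr => i _; rewrite tnth_mktuple addrK expr2.
have mG : measurable_fun setT (fun z : 'E[R]_d => (expR (- (edot z z / 3 ^+ 2)))%:E : \bar R).
  by apply/measurable_EFinP; exact: measurable_gauss_scaled.
rewrite (ge0_integralZl (leb d) measurableT mG)//.
by rewrite integral_gauss_scaled.
Qed.

End ridge_average.

(** * Couplings with prescribed masses on cells *)

Lemma measure_sum_cells d (T : measurableType d) (R : realType) (I : finType)
    (m : {measure set T -> \bar R}) (A : I -> set T) :
  (forall i, measurable (A i)) -> trivIset setT A ->
  (m (\bigcup_i A i) = \sum_i m (A i))%E.
Proof.
move=> mA tA.
have -> : [set: I] = [set` index_enum I].
  by apply/seteqP; split => i //= _; rewrite mem_index_enum.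
rewrite measure_fin_bigcup//; last exact: sub_trivIset tA.
by rewrite -fsbig_seq//; exact: index_enum_uniq.
Qed.

Section block_coupling.
Context {disp : measure_display} {T : measurableType disp} {R : realType} {I : finType}.
Variables (mu nu : probability T R) (A : I -> set T).
Hypotheses (mA : forall i, measurable (A i)) (tA : trivIset setT A).
Hypotheses (muA : mu (\bigcup_i A i) = 1%E) (nuA : nu (\bigcup_i A i) = 1%E).
Variable g : I -> I -> R.
Hypothesis g0 : forall i j, 0 <= g i j.

Definition mass (m : probability T R) (i : I) : R := fine (m (A i)).

Hypothesis ga : forall i, \sum_j g i j = mass mu i.
Hypothesis gb : forall j, \sum_i g i j = mass nu j.

Let fineA (m : probability T R) (B : set T) : measurable B -> (fine (m B))%:E = m B.
Proof.
by move=> mB; rewrite fineK// ge0_fin_numE// (le_lt_trans (probability_le1 _ mB))// ltry.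
Qed.

Lemma mass_ge0 m i : 0 <= mass m i. Proof. exact: fine_ge0. Qed.

Lemma sum_mass (m : probability T R) : m (\bigcup_i A i) = 1%E -> \sum_i mass m i = 1.
Proof.
move=> m1; apply: EFin_inj; rewrite -m1 measure_sum_cells// -sumEFin.
by apply: eq_bigr => i _; exact: fineA.
Qed.

Lemma sum_mass_setI (m : probability T R) (B : set T) : measurable B ->
  m (\bigcup_i A i) = 1%E -> \sum_i fine (m (B `&` A i)) = fine (m B).
Proof.
move=> mB m1; apply: EFin_inj; rewrite -sumEFin fineA//.
have mU : measurable (\bigcup_i A i) by apply: fin_bigcup_measurable => //; exact: finite_setT.
transitivity (m (\bigcup_i (B `&` A i))); last first.
  rewrite -setI_bigcupr.
  have -> : m B = (m (B `&` \bigcup_i A i) + m (B `\` \bigcup_i A i))%E.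
    by rewrite addeC -measureDI.
  rewrite [X in (_ + X)%E](_ : _ = 0%E) ?adde0//.
  apply/eqP; rewrite eq_le measure_ge0 andbT.
  have <- : m (~` \bigcup_i A i) = 0%E by rewrite probability_setC// m1 subee.
  by apply: le_measure; rewrite ?inE; [exact: measurableD|exact: measurableC|move=> x []].
rewrite measure_sum_cells//.
- by apply: eq_bigr => i _; rewrite fineA//; exact: measurableI.
- by move=> i; exact: measurableI.
- by apply: trivIset_setIl.
Qed.

Definition block_weight (p : I * I) : R := g p.1 p.2 / (mass mu p.1 * mass nu p.2).

Lemma block_weight_ge0 p : 0 <= block_weight p.
Proof. by rewrite mulr_ge0// invr_ge0 mulr_ge0// mass_ge0. Qed.

Let mAA (p : I * I) : measurable (A p.1 `*` A p.2).
Proof. exact: measurableX. Qed.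

Definition block_part (p : I * I) : {measure set (T * T) -> \bar R} :=
  mscale (NngNum (block_weight_ge0 p)) (mrestr (mu \x nu)%E (mAA p)).

Variable p0 : I * I.

(** The sum over all pairs of cells of multiples of the restrictions of [mu \x nu];
    [p0] is only a default value for the enumeration of the pairs. *)
Definition block_measure : {measure set (T * T) -> \bar R} :=
  msum (fun k => block_part (nth p0 (enum {: I * I}) k)) (size (enum {: I * I})).

Let sum_enum (F : I * I -> \bar R) :
  (\sum_(k < size (enum {: I * I})) F (nth p0 (enum {: I * I}) k) = \sum_p F p)%E.
Proof.
transitivity (\sum_(p <- enum {: I * I}) F p)%E; first by rewrite (big_nth p0) big_mkord.
by rewrite big_enum.
Qed.

Lemma block_measureE S : block_measure S =
  (\sum_p (block_weight p)%:E * (mu \x nu) (S `&` (A p.1 `*` A p.2)))%E.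
Proof.
by rewrite -(sum_enum (fun p => (block_weight p)%:E * (mu \x nu) (S `&` (A p.1 `*` A p.2)))%E).
Qed.

Lemma g_eq0l i j : mass mu i = 0 -> g i j = 0.
Proof.
rewrite -ga => /eqP; rewrite psumr_eq0// => /allP/(_ j).
by rewrite mem_index_enum => /(_ isT)/eqP.
Qed.

Lemma g_eq0r i j : mass nu j = 0 -> g i j = 0.
Proof.
rewrite -gb => /eqP; rewrite psumr_eq0// => /allP/(_ i).
by rewrite mem_index_enum => /(_ isT)/eqP.
Qed.

(** A cell of mass 0 carries no weight of [g], so that the division by 0 in
    [block_weight] is harmless. *)
Lemma block_weightM i j : block_weight (i, j) * (mass mu i * mass nu j) = g i j.
Proof.
rewrite /block_weight/=; have [a0|a0] := eqVneq (mass mu i) 0; first by rewrite g_eq0l// !mul0r.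
have [b0|b0] := eqVneq (mass nu j) 0; first by rewrite g_eq0r// !mul0r.
by rewrite divfK// mulf_neq0.
Qed.

Lemma block_measure_fst B : measurable B -> block_measure (fst @^-1` B) = mu B.
Proof.
move=> mB; rewrite block_measureE.
rewrite -(fineA mu mB) -(sum_mass_setI mB muA) -sumEFin.
rewrite -(pair_bigA _ (fun i j => (block_weight (i, j))%:E *
  (mu \x nu) (fst @^-1` B `&` (A i `*` A j)))%E)/=.
apply: eq_bigr => i _.
have e j : ((block_weight (i, j))%:E * (mu \x nu) (fst @^-1` B `&` (A i `*` A j)) =
    (block_weight (i, j) * (fine (mu (B `&` A i)) * fine (nu (A j))))%:E)%E.
  rewrite (_ : fst @^-1` B `&` (A i `*` A j) = (B `&` A i) `*` A j); last first.
    by apply/seteqP; split => -[x y]/=; [move=> [? []]|move=> [[]]].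
  rewrite !EFinM !fineA//; last exact: measurableI.
  by congr (_ * _)%E; apply: product_measure1E => //; exact: measurableI.
under eq_bigr do rewrite e.
rewrite sumEFin; congr EFin.
have [a0|a0] := eqVneq (mass mu i) 0.
  rewrite big1 => [|j _]; last by rewrite /block_weight/= g_eq0l// !mul0r.
  apply/esym/eqP; rewrite eq_le fine_ge0// andbT -a0 fine_le//.
  - by rewrite -fineA//; exact: measurableI.
  - by rewrite -fineA.
  - by apply: le_measure; rewrite ?inE//; exact: measurableI.
transitivity (\sum_j (g i j / mass mu i * fine (mu (B `&` A i)))).
  apply: eq_bigr => j _; rewrite -[in RHS]block_weightM.
  by rewrite -/(mass nu j); field.
by rewrite -mulr_suml -mulr_suml ga divff// mul1r.
Qed.

Lemma block_measure_snd B : measurable B -> block_measure (snd @^-1` B) = nu B.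
Proof.
move=> mB; rewrite block_measureE.
rewrite -(fineA nu mB) -(sum_mass_setI mB nuA) -sumEFin.
rewrite -(pair_bigA _ (fun i j => (block_weight (i, j))%:E *
  (mu \x nu) (snd @^-1` B `&` (A i `*` A j)))%E)/= exchange_big/=.
apply: eq_bigr => j _.
have e i : ((block_weight (i, j))%:E * (mu \x nu) (snd @^-1` B `&` (A i `*` A j)) =
    (block_weight (i, j) * (fine (mu (A i)) * fine (nu (B `&` A j))))%:E)%E.
  rewrite (_ : snd @^-1` B `&` (A i `*` A j) = A i `*` (B `&` A j)); last first.
    by apply/seteqP; split => -[x y]/=; [move=> [? []]|move=> [? []]].
  rewrite !EFinM !fineA//; last exact: measurableI.
  by congr (_ * _)%E; apply: product_measure1E => //; exact: measurableI.
under eq_bigr do rewrite e.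
rewrite sumEFin; congr EFin.
have [b0|b0] := eqVneq (mass nu j) 0.
  rewrite big1 => [|i _]; last by rewrite /block_weight/= g_eq0r// !mul0r.
  apply/esym/eqP; rewrite eq_le fine_ge0// andbT -b0 fine_le//.
  - by rewrite -fineA//; exact: measurableI.
  - by rewrite -fineA.
  - by apply: le_measure; rewrite ?inE//; exact: measurableI.
transitivity (\sum_i (g i j / mass nu j * fine (nu (B `&` A j)))).
  apply: eq_bigr => i _; rewrite -[in RHS]block_weightM.
  by rewrite -/(mass mu i); field.
by rewrite -mulr_suml -mulr_suml gb divff// mul1r.
Qed.

(** [block_measure] has mass 1, so that normalizing it does not change it. *)
Definition block_coupling : probability (T * T)%type R :=
  mnormalize block_measure (mu \x nu)%E.

Lemma block_couplingE S : block_coupling S = block_measure S.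
Proof.
have mT : block_measure setT = 1%E.
  by have := block_measure_fst measurableT; rewrite preimage_setT probability_setT.
rewrite /block_coupling/= /mnormalize; case: ifPn => [/orP[]/eqP e|_].
- by have [/eqP] := etrans (esym e) mT; rewrite eq_sym oner_eq0.
- by have := etrans (esym e) mT.
transitivity (block_measure S * (1^-1 : R)%:E)%E; last by rewrite invr1 mule1.
by congr (_ * (_^-1)%:E)%E; exact: (congr1 fine mT).
Qed.

Lemma coupling_block : coupling mu nu block_coupling.
Proof.
by move=> B mB; rewrite !block_couplingE block_measure_fst// block_measure_snd.
Qed.

Lemma block_coupling_cost (c : T * T -> R) (C : I -> I -> R) :
  measurable_fun setT c -> (forall z, 0 <= c z) ->
  (forall i j x y, A i x -> A j y -> c (x, y) <= C i j) ->
  (\int[block_coupling]_z (c z)%:E <= (\sum_i \sum_j g i j * C i j)%:E)%E.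
Proof.
move=> mc c0 cC.
have mc' : measurable_fun setT (fun z => (c z)%:E) by exact/measurable_EFinP.
rewrite (eq_measure_integral block_measure); last by move=> S mS _; exact: block_couplingE.
rewrite ge0_integral_measure_sum//; last by move=> z _; rewrite lee_fin.
rewrite (sum_enum (fun p => \int[block_part p]_z (c z)%:E)%E) pair_bigA/= -sumEFin.
apply: lee_sum => -[i j] _ /=.
rewrite ge0_integral_mscale//; last by move=> z _; rewrite lee_fin.
rewrite ge0_integral_mrestr// setTI.
apply: (@le_trans _ _ ((block_weight (i, j))%:E *
    \int[(mu \x nu)%E]_(z in A i `*` A j) (C i j)%:E)%E).
  rewrite lee_wpmul2l ?lee_fin ?block_weight_ge0//.
  apply: ge0_le_integral_any => [z _|[x y] [/= Ax Ay]]; rewrite lee_fin//.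
  exact: cC.
rewrite integral_cst//; last exact: (mAA (i, j)).
rewrite [X in (_ * (_ * X) <= _)%E](_ : _ = (mass mu i * mass nu j)%:E); last first.
  by rewrite EFinM /mass !fineA//; exact: product_measure1E.
by rewrite -!EFinM lee_fin -[in leRHS](block_weightM i j) mulrCA mulrC.
Qed.

End block_coupling.

(** * The Euclidean distance and cells of small diameter *)

Section edist_theory.
Context {R : realType} {d : nat}.
Implicit Types x y z : 'E[R]_d.

Lemma cauchy_schwarz (a b : 'I_d -> R) :
  \sum_i a i * b i <= Num.sqrt (\sum_i a i ^+ 2) * Num.sqrt (\sum_i b i ^+ 2).
Proof.
have A0 : 0 <= \sum_i a i ^+ 2 by apply: sumr_ge0 => i _; exact: sqr_ge0.
have B0 : 0 <= \sum_i b i ^+ 2 by apply: sumr_ge0 => i _; exact: sqr_ge0.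
have sA := sqr_sqrtr A0; have sB := sqr_sqrtr B0.
set al := Num.sqrt _ in sA *; set be := Num.sqrt _ in sB *.
have al0 : 0 <= al by exact: sqrtr_ge0.
have be0 : 0 <= be by exact: sqrtr_ge0.
have zero (c e : 'I_d -> R) : \sum_i c i ^+ 2 = 0 -> \sum_i c i * e i = 0.
  move=> /eqP; rewrite psumr_eq0 => [/allP c0|i _]; last exact: sqr_ge0.
  rewrite big1// => i _; have := c0 i; rewrite mem_index_enum => /(_ isT).
  by rewrite sqrf_eq0 => /eqP ->; rewrite mul0r.
have [p|np] := ltP 0 (al * be); last first.
  have : al * be == 0 by rewrite eq_le np mulr_ge0.
  rewrite mulf_eq0 => /orP[/eqP z0|/eqP z0].
    by rewrite zero ?mulr_ge0// -sA z0 expr0n.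
  under eq_bigr do rewrite mulrC.
  by rewrite zero ?mulr_ge0// -sB z0 expr0n.
have : 0 <= \sum_i (be * a i - al * b i) ^+ 2 by apply: sumr_ge0 => i _; exact: sqr_ge0.
have -> : \sum_i (be * a i - al * b i) ^+ 2 =
    be ^+ 2 * \sum_i a i ^+ 2 - 2 * (al * be) * \sum_i a i * b i + al ^+ 2 * \sum_i b i ^+ 2.
  rewrite !mulr_sumr -sumrB -big_split/=; apply: eq_bigr => i _; ring.
rewrite -sA -sB => h; rewrite -(ler_pM2l p); nra.
Qed.

Lemma edist_ge0 x y : 0 <= Defs.edist x y. Proof. exact: sqrtr_ge0. Qed.

Lemma edistxx x : Defs.edist x x = 0.
Proof. by rewrite /Defs.edist big1 ?sqrtr0// => i _; rewrite subrr expr0n. Qed.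

Lemma edist_sym x y : Defs.edist x y = Defs.edist y x.
Proof. by congr Num.sqrt; apply: eq_bigr => i _; rewrite -sqrrN opprB. Qed.

Lemma edist_triangle y x z : Defs.edist x z <= Defs.edist x y + Defs.edist y z.
Proof.
have S0 (c : 'I_d -> R) : 0 <= \sum_i c i ^+ 2 by apply: sumr_ge0 => i _; exact: sqr_ge0.
rewrite -(ler_pXn2r (n := 2)) ?nnegrE ?addr_ge0 ?edist_ge0//.
rewrite sqr_sqrtr// sqrrD !sqr_sqrtr//.
have := cauchy_schwarz (fun i => tnth x i - tnth y i) (fun i => tnth y i - tnth z i).
rewrite -/(Defs.edist x y) -/(Defs.edist y z) => cs.
have -> : \sum_(i < d) (tnth x i - tnth z i) ^+ 2 = \sum_(i < d) (tnth x i - tnth y i) ^+ 2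
   + 2 * \sum_(i < d) (tnth x i - tnth y i) * (tnth y i - tnth z i)
   + \sum_(i < d) (tnth y i - tnth z i) ^+ 2.
  rewrite mulr_sumr -!big_split/=; apply: eq_bigr => i _; ring.
rewrite mulr2n; lra.
Qed.

Definition eorigin : 'E[R]_d := [tuple 0 | _ < d].

Lemma enormE x : enorm x = Defs.edist x eorigin.
Proof. by congr Num.sqrt; apply: eq_bigr => i _; rewrite tnth_mktuple subr0 expr2. Qed.

Lemma enorm_lipschitz x y : `|enorm x - enorm y| <= Defs.edist x y.
Proof.
rewrite !enormE; have := edist_triangle y x eorigin; have := edist_triangle x y eorigin.
by rewrite (edist_sym y x) ler_norml => ? ?; apply/andP; split; lra.
Qed.

Lemma measurable_edist2 :
  measurable_fun setT (fun p : 'E[R]_d * 'E[R]_d => Defs.edist p.1 p.2).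
Proof.
apply: (measurableT_comp (f := (Num.sqrt : R -> R))).
  by apply: continuous_measurable_fun; exact: sqrt_continuous.
apply: measurable_sum => i; apply: measurable_funX; apply: measurable_funB.
  exact: (measurableT_comp (measurable_tnth i) measurable_fst).
exact: (measurableT_comp (measurable_tnth i) measurable_snd).
Qed.

Lemma edist_le_coord x y l : 0 <= l -> (forall i, `|tnth x i - tnth y i| <= l) ->
  Defs.edist x y <= d%:R * l.
Proof.
move=> l0 xy; have -> : Defs.edist x y = enorm ([tuple tnth x i - tnth y i | i < d] : 'E[R]_d).
  by congr Num.sqrt; apply: eq_bigr => i _; rewrite tnth_mktuple expr2.
by apply: enorm_le_card => // i; rewrite tnth_mktuple.
Qed.

End edist_theory.

Section cells.
Context {R : realType} {d : nat}.

(** Half-open cubes of side [delta / (d + 1)], intersected with the ball and indexed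
    by their integer positions. *)
Lemma ball_cells (r delta : R) : 0 < r -> 0 < delta ->
  exists (I : finType) (A : I -> set 'E[R]_d) (z : I -> 'E[R]_d),
    [/\ forall i, measurable (A i), trivIset setT A,
        \bigcup_i A i = eball d r &
        forall i x, A i x -> Defs.edist x (z i) <= delta].
Proof.
move=> r0 delta0; pose eta := delta / d.+1%:R.
have eta0 : 0 < eta by rewrite divr_gt0.
pose N := (Num.truncn (2 * r / eta)).+1.
pose c (n : nat) : R := n%:R * eta - r.
pose A (i : {ffun 'I_d -> 'I_N}) : set 'E[R]_d :=
  eball d r `&` \bigcap_(j in [set: 'I_d]) (fun x => tnth x j) @^-1` [set` `[c (i j), c (i j).+1[].
exists {ffun 'I_d -> 'I_N}, A, (fun i : {ffun 'I_d -> 'I_N} => [tuple c (i j) | j < d]).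
have cE n t : 0 <= t + r -> (t \in `[c n, c n.+1[) = (Num.truncn ((t + r) / eta) == n).
  move=> t0; rewrite truncn_eq; last by rewrite divr_ge0// ltW.
  by rewrite in_itv/= /c lerBlDr ltrBrDr ler_pdivlMr// ltr_pdivrMr.
have ball_coord x j : eball d r x -> 0 <= tnth x j + r <= 2 * r.
  move=> /(le_trans (tnth_le_enorm x j)); rewrite ler_norml => /andP[? ?].
  by apply/andP; split; lra.
split.
- move=> i; apply: measurableI; first exact: measurable_eball.
  apply: fin_bigcap_measurable => // j _.
  rewrite -[_ @^-1` _]setTI; apply: (measurable_tnth (T := measurableTypeR R)) => //.
- apply/trivIsetP => i i' _ _ ii'; apply/seteqP; split => // x [[Bx xi] [_ xi']].
  move/eqP: ii'; apply; apply/ffunP => j; apply/val_inj.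
  have /andP[xj _] := ball_coord x j Bx.
  by have := xi j I; have := xi' j I; rewrite /= !cE// => /eqP <- /eqP <-.
- apply/seteqP; split => [x [i _ []]//|x Bx].
  have lt j : (Num.truncn ((tnth x j + r) / eta) < N)%N.
    have /andP[x0 x1] := ball_coord x j Bx.
    by rewrite ltnS le_truncn// ler_pM2r// invr_gt0.
  exists [ffun j => Ordinal (lt j)] => //; split => // j _ /=.
  by have /andP[xj _] := ball_coord x j Bx; rewrite cE// ffunE/=.
- move=> i x [_ xi]; apply: (@le_trans _ _ (d%:R * eta)); last first.
    by rewrite /eta mulrCA (ler_piMr (ltW delta0))// ler_pdivrMr// mul1r ler_nat.
  apply: edist_le_coord; first exact: ltW.
  move=> j; rewrite tnth_mktuple; have := xi j I; rewrite /= in_itv/= /c => /andP[h1 h2].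
  by rewrite ger0_norm; move: h1 h2; rewrite -natr1; lra.
Qed.

End cells.

Section integral_cells.
Context {disp : measure_display} {T : measurableType disp} {R : realType} {I : finType}.
Variables (m : probability T R) (A : I -> set T).
Hypotheses (mA : forall i, measurable (A i)) (tA : trivIset setT A).
Hypothesis m1 : m (\bigcup_i A i) = 1%E.

Lemma bounded_prob_integrable (f : T -> R) K : measurable_fun setT f ->
  (forall x, `|f x| <= K) -> m.-integrable setT (EFin \o f).
Proof.
move=> mf fK; apply: measurable_bounded_integrable => //.
  by rewrite (le_lt_trans (probability_le1 m _))// ltry.
exists K; split; first exact: num_real.
by move=> M KM x _; exact: le_trans (fK x) (ltW KM).
Qed.

Lemma integral_cells (f : T -> R) (s : I -> R) (K delta : R) :
  measurable_fun setT f -> (forall x, `|f x| <= K) ->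
  (forall i x, A i x -> `|f x - s i| <= delta) ->
  `|\int[m]_x f x - \sum_i s i * mass A m i| <= delta.
Proof.
move=> mf fK fs; have fi := bounded_prob_integrable mf fK.
have mU : measurable (\bigcup_i A i) by apply: fin_bigcup_measurable => //; exact: finite_setT.
have fiA i : m.-integrable (A i) (EFin \o f) by apply: integrableS fi.
have mfin i : m (A i) = (mass A m i)%:E.
  by rewrite /mass fineK// ge0_fin_numE// (le_lt_trans (probability_le1 _ _))// ltry.
have -> : \int[m]_x f x = \sum_i \int[m]_(x in A i) f x.
  have -> : \int[m]_x f x = fine (\int[m]_(x in \bigcup_i A i) (f x)%:E).
    congr fine; rewrite (@negligible_integral _ _ _ m setT (~` \bigcup_i A i))//.
    - by rewrite setTD setCK.
    - exact: measurableC.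
    - by apply: etrans (probability_setC m mU) _; rewrite m1 subee.
  have UE : \bigcup_i A i = \big[setU/set0]_(i <- index_enum I) A i.
    by rewrite -bigcup_seq; apply/seteqP; split => x [i _ Ax]; exists i => //=; rewrite mem_index_enum.
  rewrite UE integral_bigsetU_EFin//.
  - by rewrite sum_fine// => i _; exact: integrable_fin_num.
  - exact: index_enum_uniq.
  - exact: sub_trivIset tA.
  - by rewrite -UE; apply: measurable_funTS; exact/measurable_EFinP.
rewrite -sumrB (le_trans (ler_norm_sum _ _ _))//.
apply: (@le_trans _ _ (\sum_i delta * mass A m i)); last first.
  by rewrite -mulr_sumr sum_mass// mulr1.
apply: ler_sum => i _.
have ic x : m.-integrable (A i) (EFin \o cst x).
  by apply: finite_measure_integrable_cst; exact: mA.
have cstE x : \int[m]_(y in A i) cst x y = x * mass A m i.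
  by rewrite Rintegral_cst.
rewrite -cstE -RintegralB//.
apply: le_trans (le_normr_Rintegral _ _) _ => //.
  by have := integrableB (mA i) (fiA i) (ic (s i)).
rewrite -cstE; apply: le_Rintegral => //.
- exact: (integrable_norm (integrableB (mA i) (fiA i) (ic (s i)))).
- by move=> x Ax; exact: fs.
Qed.

End integral_cells.

(** * Kantorovich duality on a ball *)

Section potential.
Context {R : realType} {d : nat} {I : finType}.
Variables (z : I -> 'E[R]_d) (psi : I -> R) (i0 : I).
Implicit Types x y : 'E[R]_d.

(** The greatest function that is 1-Lipschitz and at most [- psi j] at each [z j]. *)
Definition potential x : R :=
  \big[Num.min/Defs.edist x (z i0) - psi i0]_(j <- index_enum I) (Defs.edist x (z j) - psi j).

Lemma potential_le x j : potential x <= Defs.edist x (z j) - psi j.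
Proof. exact: bigmin_le. Qed.

Lemma le_potential x c : (forall j, c <= Defs.edist x (z j) - psi j) -> c <= potential x.
Proof. by move=> h; apply: le_bigmin. Qed.

Lemma potential_lipschitz x y : `|potential x - potential y| <= Defs.edist x y.
Proof.
have one u v : potential u - potential v <= Defs.edist u v.
  rewrite lerBlDl -lerBlDr; apply: le_potential => j.
  have := potential_le u j; have := edist_triangle v u (z j); lra.
rewrite ler_norml one andbT -lerN2 opprK opprB.
by rewrite edist_sym one.
Qed.

Lemma measurable_edist_to y : measurable_fun setT (fun x : 'E[R]_d => Defs.edist x y).
Proof. exact: (measurableT_comp measurable_edist2 (@pair2_measurable _ _ _ _ y)). Qed.

Lemma measurable_potential : measurable_fun setT potential.
Proof.
rewrite /potential; elim: (index_enum I) => [|j s IH].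
  under eq_fun do rewrite big_nil.
  by apply: measurable_funB => //; exact: measurable_edist_to.
under eq_fun do rewrite big_cons.
apply: measurable_minr => //.
by apply: measurable_funB => //; exact: measurable_edist_to.
Qed.

End potential.

Section cutoff.
Context {R : realType} {d : nat}.
Variables (f : 'E[R]_d -> R) (r : R).
Hypothesis r0 : 0 <= r.
Hypothesis mf : measurable_fun setT f.
Hypothesis f1 : forall x y, `|f x - f y| <= Defs.edist x y.

Let bump (x : 'E[R]_d) : R := Num.max 0 (2 * r - enorm x).

(** [f - f 0] truncated between the tents of slope 1 over the ball of radius [2 r].
    On the ball of radius [r] the tents are at least [r], hence at least
    [|f - f 0|]. *)
Definition cutoff x : R := Num.max (- bump x) (Num.min (f x - f eorigin) (bump x)).

Let bump0 x : 0 <= bump x. Proof. by rewrite le_max lexx. Qed.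

Let max_lip (a b a' b' e : R) : `|a - a'| <= e -> `|b - b'| <= e ->
  `|Num.max a b - Num.max a' b'| <= e.
Proof.
rewrite !ler_norml => /andP[? ?] /andP[? ?].
by rewrite !maxEle; case: (leP a b); case: (leP a' b') => ? ?; apply/andP; split; lra.
Qed.

Let min_lip (a b a' b' e : R) : `|a - a'| <= e -> `|b - b'| <= e ->
  `|Num.min a b - Num.min a' b'| <= e.
Proof.
rewrite !ler_norml => /andP[? ?] /andP[? ?].
by rewrite !minEle; case: (leP a b); case: (leP a' b') => ? ?; apply/andP; split; lra.
Qed.

Let bump_lip x y : `|bump x - bump y| <= Defs.edist x y.
Proof.
apply: max_lip; first by rewrite subrr normr0 edist_ge0.
rewrite (_ : _ - _ = - (enorm x - enorm y)); last by ring.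
by rewrite normrN; exact: enorm_lipschitz.
Qed.

Lemma cutoff_lipschitz x y : `|cutoff x - cutoff y| <= Defs.edist x y.
Proof.
apply: max_lip; first by rewrite -opprD normrN; exact: bump_lip.
apply: min_lip; last exact: bump_lip.
by rewrite opprB addrA subrK; exact: f1.
Qed.

Lemma measurable_cutoff : measurable_fun setT cutoff.
Proof.
have mb : measurable_fun setT bump.
  by apply: measurable_maxr => //; apply: measurable_funB => //; exact: measurable_enorm.
apply: measurable_maxr; first exact: measurable_funN.
by apply: measurable_minr => //; apply: measurable_funB.
Qed.

Lemma cutoffE x : enorm x <= r -> cutoff x = f x - f eorigin.
Proof.
move=> xr; have := f1 x eorigin; rewrite -enormE ler_norml => /andP[h1 h2].
have hb : r <= bump x by rewrite le_max; apply/orP; right; lra.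
rewrite /cutoff min_l; last by lra.
by rewrite max_r//; lra.
Qed.

Lemma cutoff_bound x : `|cutoff x| <= 2 * r * \1_(cube (fun=> - (2 * r)) (4 * r)) x.
Proof.
have cb : `|cutoff x| <= bump x.
  have b0 := bump0 x; rewrite ler_norml le_max lexx/= ge_max ge_min lexx orbT andbT; lra.
rewrite indicE; case: (boolP (x \in _)) => xQ.
  by rewrite mulr1 (le_trans cb)// ge_max mulr_ge0//= lerBlDr lerDl enorm_ge0.
rewrite mulr0 (le_trans cb)// ge_max lexx/= subr_le0.
rewrite leNgt; apply/negP => x2; move/negP: xQ; apply; rewrite inE => i.
have := le_trans (tnth_le_enorm x i) (ltW x2).
by rewrite in_itv/= ler_norml => /andP[? ?]; apply/andP; split; lra.
Qed.

End cutoff.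

Section duality.
Context {R : realType} {d : nat}.

(** The measures are replaced by their masses on cells of diameter O([e]). The
    finite duality gives a plan and a dual pair; the plan yields a coupling by
    [block_coupling], whose cost exceeds that of the plan by at most [2 e], and the
    dual pair yields the 1-Lipschitz function [potential], which is then cut off.
    The constant subtracted by [cutoff] cancels because both measures have
    mass 1. *)
Lemma kantorovich_ball (mu nu : probability 'E[R]_d R) (r delta : R) :
  0 < r -> 0 < delta -> mu (eball d r) = 1%E -> nu (eball d r) = 1%E ->
  exists f : 'E[R]_d -> R,
    [/\ measurable_fun setT f, forall x y, `|f x - f y| <= Defs.edist x y,
        forall x, `|f x| <= 2 * r * \1_(cube (fun=> - (2 * r)) (4 * r)) x &
        (W1 mu nu <= (\int[mu]_x f x - \int[nu]_x f x + delta)%:E)%E].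
Proof.
move=> r0 delta0 mur nur.
(* One [e] is lost in [finite_kantorovich], two in the cost of the coupling and
   one in the integral of [f] against each measure. *)
pose e := delta / 5.
have e0 : 0 < e by rewrite divr_gt0.
have [I [A [z [mA tA UA zA]]]] := @ball_cells R d r e r0 e0.
have muA : mu (\bigcup_i A i) = 1%E by rewrite UA.
have nuA : nu (\bigcup_i A i) = 1%E by rewrite UA.
have [g [phi [psi [g0 ga gb pp cost]]]] := finite_kantorovich
  (mass_ge0 A mu) (mass_ge0 A nu) (sum_mass mA tA muA) (sum_mass mA tA nuA)
  (fun i j => Defs.edist (z i) (z j)) e0.
have [i0 _] : exists i0 : I, True.
  case: (pickP (fun _ : I => true)) => [i0 _|noI]; first by exists i0.
  have := sum_mass mA tA muA; rewrite big1 => [/eqP|i _]; last by have := noI i.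
  by rewrite eq_sym oner_eq0.
pose h := potential z psi i0.
pose f := cutoff h r.
have h1 := potential_lipschitz z psi i0.
have mh := measurable_potential z psi i0.
exists f; split.
- exact: measurable_cutoff.
- exact: cutoff_lipschitz.
- by move=> x; apply: cutoff_bound; exact: ltW.
have fb x : `|f x| <= 2 * r.
  apply: le_trans (cutoff_bound h (ltW r0) x) _.
  by rewrite ler_piMr ?mulr_ge0 ?(ltW r0)// indicE lern1 leq_b1.
have fz i x : A i x -> `|f x - (h (z i) - h eorigin)| <= e.
  move=> Ax; rewrite /f cutoffE//; last first.
    by have : (\bigcup_i A i) x by [exists i]; rewrite UA.
  by rewrite opprB addrA subrK (le_trans (h1 _ _))//; exact: zA.
have Imu := integral_cells mA tA muA (measurable_cutoff r mh) fb fz.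
have Inu := integral_cells mA tA nuA (measurable_cutoff r mh) fb fz.
rewrite -/f in Imu Inu.
pose gam := block_coupling mu nu mA g0 (i0, i0).
pose C i j := Defs.edist (z i) (z j) + 2 * e.
have W : (W1 mu nu <= (\sum_i \sum_j g i j * C i j)%:E)%E.
  apply: (@le_trans _ _ (\int[gam]_t (Defs.edist t.1 t.2)%:E)%E).
    by apply: ereal_inf_lbound; exists gam => //; exact: coupling_block.
  apply: (block_coupling_cost mA tA muA g0 ga gb (i0, i0) (C := C)) => //.
  - exact: measurable_edist2.
  - by move=> t; exact: edist_ge0.
  move=> i j x y Ax Ay; have := edist_triangle (z i) x y.
  have := edist_triangle (z j) (z i) y; have := zA i x Ax; have := zA j y Ay.
  rewrite /= /C (edist_sym (z j) y); lra.
apply: (le_trans W); rewrite lee_fin.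
have sumC : \sum_i \sum_j g i j * C i j =
    \sum_i \sum_j g i j * Defs.edist (z i) (z j) + 2 * e.
  have -> : 2 * e = \sum_i (2 * e) * mass A mu i by rewrite -mulr_sumr sum_mass// mulr1.
  rewrite -big_split/=.
  apply: eq_bigr => i _; rewrite -ga mulr_sumr -big_split/=.
  by apply: eq_bigr => j _; rewrite /C mulrDr [g i j * (2 * e)]mulrC.
have hphi : \sum_i phi i * mass A mu i <= \sum_i h (z i) * mass A mu i.
  apply: ler_sum => i _; rewrite ler_wpM2r ?mass_ge0//.
  by apply: le_potential => j; rewrite lerBrDr; exact: pp.
have hpsi : \sum_j psi j * mass A nu j <= - \sum_j h (z j) * mass A nu j.
  rewrite -sumrN; apply: ler_sum => j _; rewrite -mulNr ler_wpM2r ?mass_ge0//.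
  by have := potential_le z psi i0 (z j) j; rewrite edistxx -/h; lra.
have shift (m : probability _ R) : m (\bigcup_i A i) = 1%E ->
    \sum_i (h (z i) - h eorigin) * mass A m i = \sum_i h (z i) * mass A m i - h eorigin.
  move=> m1; rewrite -[X in _ = _ - X]mulr1 -(sum_mass mA tA m1) mulr_sumr -sumrB.
  by apply: eq_bigr => i _; rewrite mulrBl.
move: Imu Inu; rewrite !shift// sumC !ler_norml => /andP[+ _] /andP[_ +].
rewrite (_ : delta = 5 * e); last by rewrite /e; field.
move: cost hphi hpsi; lra.
Qed.

End duality.

(** * From the distance of projections to the sliced distance *)

Lemma bounded_prob_Rintegral d (T : measurableType d) (R : realType) (m : probability T R)
    (f : T -> R) K : 0 <= K -> measurable_fun setT f -> (forall x, `|f x| <= K) ->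
  `|\int[m]_x f x| <= K.
Proof.
move=> K0 mf fK; have fi := bounded_prob_integrable m mf fK.
apply: le_trans (le_normr_Rintegral measurableT fi) _.
have ic : m.-integrable setT (EFin \o cst K) by exact: finite_measure_integrable_cst.
apply: (@le_trans _ _ (\int[m]_x cst K x)).
  by apply: le_Rintegral => //; exact: integrable_norm fi.
rewrite Rintegral_cst// (_ : fine _ = 1) ?mulr1//.
by have := @probability_setT _ _ _ m => /(congr1 fine).
Qed.

Section coupling_marginals.
Context {disp : measure_display} {T : measurableType disp} {R : realType}.

Lemma wasserstein1_ge0 (dist : T -> T -> R) (mu nu : set T -> \bar R) :
  (forall x y, 0 <= dist x y) -> (0 <= wasserstein1 dist mu nu)%E.
Proof.
move=> d0; apply: le_ereal_inf_tmp => _ [gam _ <-].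
by apply: integral_ge0 => z _; rewrite lee_fin.
Qed.

(** Here [pr] is one of the two projections of the product. *)
Lemma Rintegral_pushforward_coupling d' (U : measurableType d') (m : probability U R)
    (phi : U -> T) (mphi : measurable_fun setT phi) (gam : probability (T * T)%type R)
    (pr : T * T -> T) (mpr : measurable_fun setT pr) (g : T -> R) (K : R) :
  (forall A, measurable A -> gam (pr @^-1` A) = m (phi @^-1` A)) ->
  measurable_fun setT g -> (forall s, `|g s| <= K) ->
  \int[m]_x g (phi x) = \int[gam]_z g (pr z).
Proof.
move=> gE mg gK.
have i1 : m.-integrable setT ((EFin \o g) \o phi).
  by apply: (bounded_prob_integrable _ (K := K)) => //; exact: measurableT_comp.
have i2 : gam.-integrable setT ((EFin \o g) \o pr).
  by apply: (bounded_prob_integrable _ (K := K)) => //; exact: measurableT_comp.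
have mg' : measurable_fun setT (EFin \o g) by exact/measurable_EFinP.
congr fine.
have := integral_pushforward mphi mg' (mu := m) (D := setT).
rewrite preimage_setT => <- //.
have := integral_pushforward mpr mg' (mu := gam) (D := setT).
rewrite preimage_setT => <- //.
by apply: eq_measure_integral => A mA _; rewrite /= /pushforward gE.
Qed.

(** The trivial half of Kantorovich duality. *)
Lemma wasserstein1_pushforward_ge d' (U : measurableType d') (mu nu : probability U R)
    (dist : T -> T -> R) (phi : U -> T) (g : T -> R) (K L : R) :
  measurable_fun setT (fun z : T * T => dist z.1 z.2) -> (forall s t, 0 <= dist s t) ->
  measurable_fun setT phi -> measurable_fun setT g -> (forall s, `|g s| <= K) ->
  0 < L -> (forall s t, `|g s - g t| <= L * dist s t) ->
  (((\int[mu]_x g (phi x) - \int[nu]_x g (phi x)) / L)%:E <=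
   wasserstein1 dist (pushforward mu phi) (pushforward nu phi))%E.
Proof.
move=> mdist dist0 mphi mg gK L0 gL; apply: le_ereal_inf_tmp => _ [gam cgam <-].
rewrite (Rintegral_pushforward_coupling (m := mu) (gam := gam) mphi measurable_fst (fun A mA => (cgam A mA).1) mg gK).
rewrite (Rintegral_pushforward_coupling (m := nu) (gam := gam) mphi measurable_snd (fun A mA => (cgam A mA).2) mg gK).
have i1 : gam.-integrable setT (EFin \o (fun z => g z.1)).
  by apply: (bounded_prob_integrable _ (K := K)) => //; exact: (measurableT_comp mg measurable_fst).
have i2 : gam.-integrable setT (EFin \o (fun z => g z.2)).
  by apply: (bounded_prob_integrable _ (K := K)) => //; exact: (measurableT_comp mg measurable_snd).
have iB := integrableB measurableT i1 i2.
rewrite -RintegralB// EFinM muleC lee_pdivrMl//.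
have md : measurable_fun setT (fun z : T * T => (dist z.1 z.2)%:E).
  exact/measurable_EFinP.
rewrite -(ge0_integralZl gam measurableT md) ?lee_fin ?(ltW L0)//; last first.
  by move=> z _; rewrite lee_fin.
apply: (@le_trans _ _ `|\int[gam]_z (g z.1 - g z.2)|%:E); first by rewrite lee_fin ler_norm.
rewrite EFin_normr_Rintegral//.
apply: le_trans (le_abse_integral _ _ _) _ => //; first by have /integrableP[] := iB.
by apply: ge0_le_integral_any => z _ //=; rewrite -EFinM lee_fin; exact: gL.
Qed.

End coupling_marginals.

Section slicing.
Context {R : realType} {d : nat}.
Local Notation S := (esphere R d).
Local Notation sigma := (@uniform_sphere R d).
Variables (mu nu : probability 'E[R]_d R) (f : 'E[R]_d -> R).
Variables (G : 'E[R]_d -> R -> R) (K Kf L c eta : R).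
Hypotheses (K0 : 0 <= K) (L0 : 0 < L) (eta0 : 0 <= eta).
Hypothesis mf : measurable_fun setT f.
Hypothesis fK : forall x, `|f x| <= Kf.
Hypothesis mG2 : measurable_fun setT (fun p : 'E[R]_d * 'E[R]_d => G p.2 (edot p.2 p.1)).
Hypothesis mG : forall th, measurable_fun setT (G th).
Hypothesis GK : forall th s, `|G th s| <= K.
Hypothesis GL : forall th s t, S th -> `|G th s - G th t| <= L * `|s - t|.
Hypothesis Gf : forall x, `|\int[sigma]_(th in S) G th (edot th x) - c * f x| <= eta.

Let H (p : 'E[R]_d * 'E[R]_d) : R := \1_S p.2 * G p.2 (edot p.2 p.1).

Let mS : measurable S. Proof. exact: measurable_esphere. Qed.

Let mH : measurable_fun setT H.
Proof.
apply: measurable_funM => //.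
by apply: (measurableT_comp _ measurable_snd); exact: measurable_indic.
Qed.

Let HK p : `|H p| <= K.
Proof.
rewrite /H indicE; case: (p.2 \in S); first by rewrite mul1r.
by rewrite mul0r normr0.
Qed.

Let mH1 x : measurable_fun setT (fun th => H (x, th)).
Proof. exact: (measurableT_comp mH (pair1_measurable x)). Qed.

Let mH2 th : measurable_fun setT (fun x => H (x, th)).
Proof. exact: (measurableT_comp mH (pair2_measurable th)). Qed.

Let average x : \int[sigma]_(th in S) G th (edot th x) = \int[sigma]_th H (x, th).
Proof.
rewrite Rintegral_mkcond; apply: eq_Rintegral => th _.
by rewrite patchE /H/= indicE; case: ifP => _; rewrite ?mul1r ?mul0r.
Qed.

Let iH (m : probability 'E[R]_d R) : (m \x sigma)%E.-integrable setT (EFin \o H).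
Proof.
have mH' : measurable_fun setT (EFin \o H) by exact/measurable_EFinP.
apply/(integrable12ltyP m sigma mH').
apply: (@le_lt_trans _ _ (\int[m]_x \int[sigma]_y K%:E)%E).
  apply: ge0_le_integral_any => x _; first exact: integral_ge0.
  by apply: ge0_le_integral_any => y _ //=; rewrite lee_fin.
have one (P : probability 'E[R]_d R) : (\int[P]_y K%:E = K%:E)%E.
  by rewrite integral_cst// [X in (_ * X)%E](_ : _ = 1%E) ?mule1//; exact: probability_setT.
by under eq_integral do rewrite one; rewrite one ltry.
Qed.

Let fin1 x : (\int[sigma]_th (H (x, th))%:E = (\int[sigma]_th H (x, th))%:E)%E.
Proof. by rewrite fineK// integrable_fin_num// (bounded_prob_integrable _ (K := K)). Qed.

Let fin2 (m : probability 'E[R]_d R) th :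
  (\int[m]_x (H (x, th))%:E = (\int[m]_x H (x, th))%:E)%E.
Proof. by rewrite fineK// integrable_fin_num// (bounded_prob_integrable _ (K := K)). Qed.

Let swap (m : probability 'E[R]_d R) :
  \int[m]_x \int[sigma]_th H (x, th) = \int[sigma]_th \int[m]_x H (x, th).
Proof.
have := Fubini (iH m); rewrite /Rintegral => e; congr fine.
rewrite (eq_integral (fun x => \int[sigma]_th (EFin \o H) (x, th))%E) => [|x _]; last first.
  by rewrite -fin1.
by rewrite e; apply: eq_integral => th _; rewrite -fin2.
Qed.

Let mA1 : measurable_fun setT (fun x => \int[sigma]_th H (x, th)).
Proof.
apply: (measurableT_comp (f := fine)) => //.
by apply: (measurable_fun_integral2 sigma (F := EFin \o H)); exact/measurable_EFinP.
Qed.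

Let mA2 (m : probability 'E[R]_d R) : measurable_fun setT (fun th => \int[m]_x H (x, th)).
Proof.
apply: (measurableT_comp (f := fine)) => //.
apply: (measurable_fun_integral2 m (F := fun q => (H (q.2, q.1))%:E)).
apply/measurable_EFinP; apply: (measurableT_comp mH).
by apply: measurable_fun_pair; [exact: measurable_snd|exact: measurable_fst].
Qed.

Let close (m : probability 'E[R]_d R) :
  `|\int[sigma]_th \int[m]_x H (x, th) - c * \int[m]_x f x| <= eta.
Proof.
rewrite -swap.
have i1 : m.-integrable setT (EFin \o (fun x => \int[sigma]_th H (x, th))).
  by apply: (bounded_prob_integrable _ (K := K)) => // x; exact: bounded_prob_Rintegral.
have i2 : m.-integrable setT (EFin \o f) by exact: (bounded_prob_integrable _ mf fK).
have i3 : m.-integrable setT (EFin \o (fun x => c * f x)).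
  by have := integrableZl measurableT c i2.
rewrite -RintegralZl// -RintegralB//; apply: bounded_prob_Rintegral => //.
  by apply: measurable_funB => //; apply: measurable_funM.
by move=> x; rewrite -average.
Qed.

(** If averaging the functions [G th] of one linear coordinate reproduces [c f] up to
    [eta], then [f] hardly distinguishes measures with close projections. *)
Lemma sliced_bound :
  (((c * (\int[mu]_x f x - \int[nu]_x f x) - 2 * eta) / L)%:E <= SW1 mu nu)%E.
Proof.
pose D th : R := (\int[mu]_x H (x, th) - \int[nu]_x H (x, th)) / L.
have DK (m : probability 'E[R]_d R) : sigma.-integrable setT (EFin \o (fun th => \int[m]_x H (x, th))).
  by apply: (bounded_prob_integrable _ (K := K)) => // th; exact: bounded_prob_Rintegral.
have iB : sigma.-integrable setT (EFin \o (fun th => \int[mu]_x H (x, th) - \int[nu]_x H (x, th))).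
  by have := integrableB measurableT (DK mu) (DK nu).
have iD : sigma.-integrable setT (EFin \o D).
  have := integrableZl measurableT L^-1 iB.
  by apply: eq_integrable => // th _; rewrite /D /= -EFinM mulrC.
apply: (@le_trans _ _ (\int[sigma]_th (D th)%:E)%E).
  rewrite -[leRHS]fineK; last exact: integrable_fin_num.
  rewrite lee_fin -[fine _]/(\int[sigma]_th D th).
  rewrite /D RintegralZr// RintegralB// ler_wpM2r ?invr_ge0 ?(ltW L0)//.
  by have := close mu; have := close nu; rewrite !ler_norml => /andP[? ?] /andP[? ?]; lra.
rewrite integralE; apply: (@le_trans _ _ (\int[sigma]_th (fun th => (D th)%:E)^\+ th)%E).
  by rewrite -[leRHS]sube0 leeB// integral_ge0.
rewrite /SW1 [leRHS]integral_mkcond.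
apply: ge0_le_integral_any => th _ //; rewrite patchE funeposE ge_max.
case: ifPn => [thS|thS]; last first.
  rewrite lexx andbT lee_fin /D [X in X - _](_ : _ = 0) ?[X in _ - X](_ : _ = 0) ?subrr ?mul0r//.
    by rewrite /Rintegral integral0_eq// => x _; rewrite /H indicE (negbTE thS) mul0r.
  by rewrite /Rintegral integral0_eq// => x _; rewrite /H indicE (negbTE thS) mul0r.
have HG (m : probability 'E[R]_d R) : \int[m]_x H (x, th) = \int[m]_x G th (Defs.proj th x).
  by apply: eq_Rintegral => x _; rewrite /H indicE thS mul1r.
rewrite wasserstein1_ge0 ?andbT//.
rewrite /D !HG.
have md : measurable_fun setT (fun z : R * R => `|z.1 - z.2|).
  by apply: measurableT_comp => //; exact: measurable_funB.
have GL' s t : `|G th s - G th t| <= L * `|s - t| by apply: GL; rewrite inE in thS.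
have mp : measurable_fun setT (Defs.proj th : _ -> R).
  exact: (measurableT_comp (@measurable_edot R d) (pair1_measurable th)).
exact: (wasserstein1_pushforward_ge mu nu (phi := Defs.proj th : _ -> R)
  md (fun s t => normr_ge0 (s - t)) mp (mG th) (GK th) L0 GL').
Qed.

End slicing.

(** * Optimizing the smoothing scale *)

Section rescaling.
Context {R : realType} {d : nat}.
Hypothesis d2 : (2 <= d)%N.
Variables (f : 'E[R]_d -> R) (r eps : R).
Hypotheses (r0 : 0 < r) (eps0 : 0 < eps).
Hypothesis mf : measurable_fun setT f.
Hypothesis f1 : forall x y, `|f x - f y| <= Defs.edist x y.
Hypothesis fB : forall x, `|f x| <= 2 * r * \1_(cube (fun=> - (2 * r)) (4 * r)) x.

Definition rescaled (x : 'E[R]_d) : R := f (escale eps x) / eps.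

Lemma measurable_rescaled : measurable_fun setT rescaled.
Proof.
apply: measurable_funM => //.
by apply: (measurableT_comp mf); exact: measurable_escaler.
Qed.

Lemma edist_scale (x y : 'E[R]_d) : Defs.edist (escale eps x) (escale eps y) = eps * Defs.edist x y.
Proof.
rewrite /Defs.edist -[eps in RHS](ger0_norm (ltW eps0)) -sqrtr_sqr -sqrtrM ?sqr_ge0//.
rewrite mulr_sumr; congr Num.sqrt; apply: eq_bigr => i _.
by rewrite !tnth_mktuple -mulrBr exprMn.
Qed.

Lemma rescaled_lipschitz x y : `|rescaled x - rescaled y| <= Defs.edist x y.
Proof.
rewrite -mulrBl normrM normfV (gtr0_norm eps0) ler_pdivrMr//.
by rewrite [leRHS]mulrC -edist_scale; exact: f1.
Qed.

Lemma rescaled_bound x : `|rescaled x| <=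
  2 * (r / eps) * \1_(cube (fun=> - (2 * (r / eps))) (4 * (r / eps))) x.
Proof.
rewrite normrM normfV (gtr0_norm eps0) ler_pdivrMr// (le_trans (fB _))//.
rewrite [leRHS]mulrAC mulrA divfK ?gt_eqF//.
rewrite ler_wpM2l ?mulr_ge0 ?(ltW r0)// !indicE ler_nat.
case: (boolP (escale eps x \in _)) => //.
rewrite inE => xQ; rewrite mem_set// => i; have := xQ i.
rewrite tnth_mktuple !in_itv/= => /andP[h1 h2]; apply/andP; split.
  by rewrite -mulNr ler_pdivrMr// [leRHS]mulrC.
rewrite (_ : - _ + _ = (- (2 * r) + 4 * r) / eps); last by field; rewrite gt_eqF.
by rewrite ler_pdivlMr// [leLHS]mulrC.
Qed.

Lemma escaleK (x : 'E[R]_d) : escale eps (escale eps^-1 x) = x.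
Proof. by apply: eq_from_tnth => i; rewrite !tnth_mktuple mulrA divff ?gt_eqF// mul1r. Qed.

(** Smoothing at scale [eps] is smoothing at scale 1 of the rescaled function,
    which is supported in a cube of side [4 r / eps]. *)
Lemma sliced_bound_rescaled (mu nu : probability 'E[R]_d R) :
  (((ridge_const d * @gauss_mass R d / eps * (\int[mu]_x f x - \int[nu]_x f x) -
     2 * (ridge_const d * @gauss_spread R d)) /
    ((@ridge_lip R d + 1) * (r / eps) ^+ d.-1 / eps))%:E <= SW1 mu nu)%E.
Proof.
have rho0 : 0 < r / eps by rewrite divr_gt0.
have B0 : 0 <= 2 * (r / eps) by rewrite mulr_ge0// ltW.
have d0 : (0 < d)%N by exact: ltnW.
have lip0 : 0 <= @ridge_lip R d.
  by rewrite /ridge_lip !mulr_ge0// ridge_L1_ge0.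
have mF := measurable_rescaled; have F1 := rescaled_lipschitz; have FB := rescaled_bound.
have rc0 := ltW (@ridge_const_gt0 R d d0).
apply: (@sliced_bound R d mu nu f (fun th s => ridge rescaled th (s / eps))
   (2 * (r / eps) * gmoment d.-1 * (4 * (r / eps)) ^+ d) (2 * r)).
- apply: mulr_ge0; first by apply: mulr_ge0 => //; exact: gmoment_ge0.
  by apply/exprn_ge0/mulr_ge0 => //; exact: ltW.
- by rewrite divr_gt0// mulr_gt0 ?exprn_gt0// ltr_wpDl.
- by rewrite mulr_ge0// /gauss_spread mulr_ge0// exprn_ge0// mulr_ge0// sqrtr_ge0.
- exact: mf.
- move=> x; apply: le_trans (fB x) _.
  by rewrite ler_piMr ?mulr_ge0 ?(ltW r0)// indicE lern1 leq_b1.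
- have := measurableT_comp (measurable_ridge2 mF) (measurable_fun_pair
    (measurableT_comp (measurable_escaler (n := d) eps^-1) (@measurable_fst _ _ _ _))
    (@measurable_snd _ _ 'E[R]_d 'E[R]_d)).
  apply: eq_measurable_fun => p _ /=; congr (ridge _ _ _).
  by rewrite [LHS]edotC edot_scalel mulrC edotC.
- move=> th; apply: (measurableT_comp (f := fine)) => //.
  apply: (measurable_fun_integral2 (leb d)
    (F := fun q : R * 'E[R]_d => (rescaled q.2 * ridge_kernel d (q.1 / eps - edot th q.2))%:E)).
  apply/measurable_EFinP; apply: measurable_funM.
    exact: (measurableT_comp mF measurable_snd).
  apply: (measurableT_comp (@measurable_ridge_kernel R d)); apply: measurable_funB.
    by apply: measurable_funM => //; exact: measurable_fst.
  apply: (measurableT_comp (f := fun x => edot th x)); last exact: measurable_snd.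
  exact: (measurableT_comp (@measurable_edot R d) (pair1_measurable th)).
- by move=> th s; apply: (ridge_bounded (ltW rho0) B0 mF FB).
- move=> th s t thS.
  have := ridge_lipschitz d2 (ltW rho0) B0 mF FB F1 (t / eps) (s / eps - t / eps) thS.
  rewrite addrCA subrr addr0 => /le_trans -> //.
  rewrite -mulrBl normrM normfV (gtr0_norm eps0) mulrA.
  rewrite [leRHS]mulrAC ler_wpM2r ?invr_ge0 ?(ltW eps0)// ler_wpM2r//.
  by rewrite ler_wpM2r ?exprn_ge0 ?(ltW rho0)// lerDl.
- move=> x; pose y := escale eps^-1 x.
  have -> : \int[uniform_sphere d]_(th in esphere R d) ridge rescaled th (edot th x / eps) =
     \int[uniform_sphere d]_(th in esphere R d) ridge rescaled th (edot th y).
    apply: eq_Rintegral => th _; congr (ridge _ _ _).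
    by rewrite [RHS]edotC edot_scalel mulrC edotC.
  rewrite (ridge_average d2 (ltW rho0) B0 mF FB).
  rewrite (_ : _ / eps * f x = ridge_const d * (gauss_mass d * rescaled y)); last first.
    by rewrite /rescaled /y escaleK; ring.
  rewrite -mulrBr normrM (ger0_norm rc0); apply: ler_wpM2l; first exact: rc0.
  exact: (gauss_average (ltW rho0) B0 mF FB F1).
Qed.

End rescaling.

Lemma W1_le_eps (R : realType) (d : nat) : (2 <= d)%N ->
  exists C1 C2 : R, [/\ 0 < C1, 0 < C2 & forall (r eps : R) (mu nu : probability 'E[R]_d R),
    0 < r -> 0 < eps -> mu (eball d r) = 1%E -> nu (eball d r) = 1%E ->
    (W1 mu nu <= (C1 * eps)%:E + (C2 * (r / eps) ^+ d.-1)%:E * SW1 mu nu)%E].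
Proof.
move=> d2; have d0 : (0 < d)%N by exact: ltnW.
have rc0 := @ridge_const_gt0 R d d0.
have sp0 : 0 < Num.sqrt (pi : R) by rewrite sqrtr_gt0 pi_gt0.
have gm0 : 0 < @gauss_mass R d by rewrite /gauss_mass exprn_gt0// mulr_gt0.
have gs0 : 0 < @gauss_spread R d by rewrite /gauss_spread mulr_gt0// exprn_gt0// mulr_gt0.
have lip0 : 0 < @ridge_lip R d + 1.
  by rewrite ltr_wpDl// /ridge_lip !mulr_ge0// ridge_L1_ge0.
pose C1 := 1 + 2 * @gauss_spread R d / @gauss_mass R d.
pose C2 := (@ridge_lip R d + 1) / (ridge_const d * @gauss_mass R d).
have C10 : 0 < C1 by rewrite addr_gt0// divr_gt0// mulr_gt0.
have C20 : 0 < C2 by rewrite divr_gt0// mulr_gt0.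
exists C1, C2; split => // r eps mu nu r0 eps0 mur nur.
have rho0 : 0 < (r / eps) ^+ d.-1 by rewrite exprn_gt0// divr_gt0.
have [f [mf f1 fB]] := kantorovich_ball r0 eps0 mur nur.
have := sliced_bound_rescaled d2 r0 eps0 mf f1 fB mu nu.
have : (0 <= SW1 mu nu)%E.
  by apply: integral_ge0 => th _; apply: wasserstein1_ge0 => x y; exact: normr_ge0.
case: (SW1 mu nu) => [s||//]; last first.
  have c0 : (0 < (C2 * (r / eps) ^+ d.-1)%:E)%E by rewrite lte_fin mulr_gt0.
  by move=> _ _ _; rewrite (gt0_muley c0) addey// leey.
rewrite !lee_fin => s0 h W; apply: (le_trans W); rewrite -EFinM -EFinD lee_fin.
move: h; rewrite ler_pdivrMr; last by rewrite divr_gt0// mulr_gt0.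
set D := _ - _ in W *; rewrite lerBlDr => h.
have -> : C1 * eps + C2 * (r / eps) ^+ d.-1 * s = (s * ((ridge_lip d + 1) * (r / eps) ^+ d.-1 / eps) +
     2 * (ridge_const d * gauss_spread d)) / (ridge_const d * gauss_mass d / eps) + eps.
  by rewrite /C1 /C2; field; rewrite !gt_eqF.
rewrite lerD2r ler_pdivlMr; last by rewrite divr_gt0// mulr_gt0.
by rewrite mulrC.
Qed.

Theorem theorem2p1 (R : realType) (d : nat) (hd : (2 <= d)%N) :
  exists c : R, forall (r : R) (mu nu : probability 'E[R]_d R),
    0 < r -> mu (eball d r) = 1%E -> nu (eball d r) = 1%E ->
    (W1 mu nu <=
     (c * r `^ ((d%:R - 1) / d%:R))%:E * SW1 mu nu `^ (d%:R^-1))%E.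
Proof.
have [C1 [C2 [C10 C20 bound]]] := @W1_le_eps R d hd.
have d0 : d%:R != 0 :> R by rewrite pnatr_eq0 -lt0n ltnW.
exists (C1 + C2) => r mu nu r0 mur nur.
have c0 : 0 < (C1 + C2) * r `^ ((d%:R - 1) / d%:R).
  by rewrite mulr_gt0 ?powR_gt0// addr_gt0.
have : (0 <= SW1 mu nu)%E.
  by apply: integral_ge0 => th _; apply: wasserstein1_ge0 => x y; exact: normr_ge0.
have := fun eps eps0 => bound r eps mu nu r0 eps0 mur nur.
case: (SW1 mu nu) => [s||//]; last first.
  rewrite poweRyr ?invr_eq0//.
  by rewrite gt0_muley ?leey// lte_fin.
rewrite lee_fin le_eqVlt => h /predU1P[s0|s0].
  (* Here [eps] tends to 0. *)
  rewrite -s0 poweR0r ?invr_eq0// mule0.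
  apply/lee_addgt0Pr => e e0.
  have := h (e / C1) (divr_gt0 e0 C10).
  by rewrite -s0 mule0 adde0 mulrC divfK ?gt_eqF// add0e.
rewrite poweR_EFin -EFinM.
(* This [eps] solves [eps^d = r^(d-1) s], which makes both terms equal up to the
   constants. *)
set eps := r `^ ((d%:R - 1) / d%:R) * s `^ d%:R^-1.
have eps0 : 0 < eps by rewrite mulr_gt0// powR_gt0.
have epsd : eps ^+ d = r ^+ d.-1 * s.
  rewrite /eps exprMn -(powR_mulrn d (powR_ge0 r _)) -(powR_mulrn d (powR_ge0 s _)).
  rewrite -!powRrM divfK// mulVf// powRr1 ?(ltW s0)//.
  by congr (_ * _); rewrite -powR_mulrn ?(ltW r0)// -subn1 natrB// ltnW.
rewrite -mulrA -/eps; apply: le_trans (h eps eps0) _.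
rewrite -EFinM -EFinD lee_fin mulrDl lerD2l -mulrA ler_wpM2l ?(ltW C20)//.
rewrite expr_div_n mulrAC -epsd ler_pdivrMr ?exprn_gt0//.
by rewrite -exprS prednK// ltnW.
Qed.
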